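(* Let $A$ be a Hopf algebra in a braided autonomous category $\mathcal{B}$ admitting a coend $C$ and let $D(A)=A\otimes_\Omega Z(A)$ be the double of $A$ (a quasitriangular Hopf algebra in $\mathcal{B}$). Then there are isomorphisms of braided categories $$\mathcal{Z}(\mathcal{B}_A)\simeq\mathcal{B}_{D(A)}\simeq{}_{D(A)}\mathcal{B}\simeq\mathcal{Z}'({}_A\mathcal{B})\simeq\overline{\mathcal{Z}({}_A\mathcal{B})}.$$
   Context: Categories are small, monoidal categories are strict, with product $\otimes$, unit $\mathbf 1$. A monoidal category is autonomous if every object $X$ has a left dual ${}^\vee X$ (with $\mathrm{ev}_X\colon{}^\vee X\otimes X\to\mathbf 1$, $\mathrm{coev}_X\colon\mathbf 1\to X\otimes{}^\vee X$) and a right dual. The canonical isomorphisms ${}^\vee(X\otimes Y)\cong{}^\vee Y\otimes{}^\vee X$ are suppressed. Let $\tau$ be the braiding of $\mathcal{B}$. A braided isomorphism is a strong monoidal functor that preserves the braidings and is an isomorphism of categories. The mirror $\overline{\mathcal{A}}$ of a braided category $\mathcal{A}$ with braiding $c$ is the same monoidal category with braiding $\overline c_{X,Y}=c^{-1}_{Y,X}$. Hopf algebras and modules. A bialgebra in $\mathcal{B}$ is an object with an algebra structure $(m,u)$ and a coalgebra structure $(\Delta,\varepsilon)$ with $\Delta m=(m\otimes m)(\mathrm{id}\otimes\tau\otimes\mathrm{id})(\Delta\otimes\Delta)$, $\Delta u=u\otimes u$, $\varepsilon m=\varepsilon\otimes\varepsilon$, $\varepsilon u=\mathrm{id}$; a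 Hopf algebra is a bialgebra with an invertible antipode $S$. For a Hopf algebra $H$ in $\mathcal{B}$, ${}_H\mathcal{B}$ and $\mathcal{B}_H$ are the categories of left and right $H$-modules; they are monoidal with unit $(\mathbf 1,\varepsilon)$ and $(M,r)\otimes(N,s)$ equal to $M\otimes N$ with action $(r\otimes s)(\mathrm{id}_H\otimes\tau_{H,M}\otimes\mathrm{id}_N)(\Delta\otimes\mathrm{id}_{M\otimes N})$, resp. $(r\otimes s)(\mathrm{id}_M\otimes\tau_{N,H}\otimes\mathrm{id}_H)(\mathrm{id}_{M\otimes N}\otimes\Delta)$. Centers. $\mathcal{Z}(\mathcal{A})$ has objects $(M,\sigma)$ with $\sigma_Y\colon M\otimes Y\to Y\otimes M$ a natural isomorphism, $\sigma_{Y\otimes Z}=(\mathrm{id}_Y\otimes\sigma_Z)(\sigma_Y\otimes\mathrm{id}_Z)$, $\sigma_{\mathbf 1}=\mathrm{id}_M$; morphisms commute with the $\sigma$'s; $(M,\sigma)\otimes(N,\gamma)=(M\otimes N,(\sigma\otimes\mathrm{id}_N)(\mathrm{id}_M\otimes\gamma))$; braiding $\sigma_N$. $\mathcal{Z}'(\mathcal{A})$ has objects $(M,\sigma)$ with $\sigma_Y\colon Y\otimes M\to M\otimes Y$ a natural isomorphism, $\sigma_{Y\otimes Z}=(\sigma_Y\otimes\mathrm{id}_Z)(\mathrm{id}_Y\otimes\sigma_Z)$, $\sigma_{\mathbf 1}=\mathrm{id}_M$; $(M,\sigma)\otimes(N,\gamma)=(M\otimes N,(\mathrm{id}_M\otimes\gamma)(\sigma\otimes\mathrm{id}_N))$;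 braiding $\tau'_{(M,\sigma),(N,\gamma)}=\gamma_M$. The centralizer $Z(A)$. Let $C=\int^{Y\in\mathcal{B}}{}^\vee Y\otimes Y$ be the coend of $\mathcal{B}$, with universal dinatural transformation $i^C_Y\colon{}^\vee Y\otimes Y\to C$. Put $Z(A)={}^\vee A\otimes C$. It is the coend $\int^{Y}{}^\vee(Y\otimes A)\otimes Y$ with universal dinatural transformation $i_Y=\mathrm{id}_{{}^\vee A}\otimes i^C_Y\colon{}^\vee A\otimes{}^\vee Y\otimes Y\to{}^\vee A\otimes C$. Set $\delta_Y=(\mathrm{id}_{Y\otimes A}\otimes i_Y)(\mathrm{coev}_{Y\otimes A}\otimes\mathrm{id}_Y)\colon Y\to Y\otimes A\otimes Z(A)$. Let $T=?\otimes A$ denote the Hopf monad on $\mathcal{B}$ (a comonoidal monad with left and right antipodes) with product $\mathrm{id}\otimes m_A$, unit $\mathrm{id}\otimes u_A$, $T_2(X,Y)=(\mathrm{id}_X\otimes\tau_{Y,A}\otimes\mathrm{id}_A)(\mathrm{id}_{X\otimes Y}\otimes\Delta_A)$, $T_0=\varepsilon_A$. Then $Z(A)$ is a Hopf algebra in $\mathcal{B}$ with structure determined by: $(\mathrm{id}_{T(X)\otimes T(Y)}\otimes m_{Z(A)})(\mathrm{id}_{T(X)}\otimes\tau_{Z(A),T(Y)}\otimes\mathrm{id}_{Z(A)})(\delta_X\otimes\delta_Y)=(T_2(X,Y)\otimes\mathrm{id})\delta_{X\otimes Y}$, $u_{Z(A)}=(T_0\otimes\mathrm{id})\delta_{\mathbf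 1}$, $(\mathrm{id}_{T(X)}\otimes\Delta_{Z(A)})\delta_X=(\mathrm{id}_X\otimes m_A\otimes\mathrm{id}_{Z(A)\otimes Z(A)})(\delta_{T(X)}\otimes\mathrm{id}_{Z(A)})\delta_X$, $(\mathrm{id}_{T(X)}\otimes\varepsilon_{Z(A)})\delta_X=\mathrm{id}_X\otimes u_A$. Put $\partial_{X,Y}=(\tau_{X,Y\otimes A}\otimes\mathrm{id}_{Z(A)})(\mathrm{id}_X\otimes\delta_Y)\colon X\otimes Y\to Y\otimes A\otimes X\otimes Z(A)$; the pair $(?\otimes Z(A),\partial)$ is a centralizer of $T$, i.e. for all $X,W$, every natural family $\xi_Y\colon X\otimes Y\to T(Y)\otimes W$ equals $(\mathrm{id}_{T(Y)}\otimes r)\partial_{X,Y}$ for a unique $r\colon X\otimes Z(A)\to W$. The double $D(A)$. Let $T_3(X,Y,Z)=(\mathrm{id}\otimes T_2(Y,Z))T_2(X,Y\otimes Z)$, let $s^l_X=(\mathrm{ev}_A\otimes\mathrm{id}_{{}^\vee X})(\mathrm{id}_{{}^\vee A}\otimes\tau_{{}^\vee X,A})(\mathrm{id}_{{}^\vee A\otimes{}^\vee X}\otimes S_A^{-1})$ be the left antipode of $T$, $\mu=\mathrm{id}\otimes m_A$, and $j_{X,Y}=(\mathrm{ev}_{T(Y)}\otimes\mathrm{id})(\mathrm{id}_{{}^\vee T(Y)}\otimes\partial_{X,Y})\colon{}^\vee T(Y)\otimes X\otimes Y\to X\otimes Z(A)$. The canonical distributive law of $T$ is the natural transformation $\Omega_X\colon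 X\otimes Z(A)\otimes A\to X\otimes A\otimes Z(A)$ determined by $\Omega_XT(j_{X,Y})=j_{T(X),T(Y)}({}^\vee\mu_Ys^l_{T(Y)}T({}^\vee\mu_Y)\otimes\mathrm{id}_{T(X)\otimes T(Y)})T_3({}^\vee T(Y),X,Y)$; it is of the form $\mathrm{id}_X\otimes\Omega$ with $\Omega\colon Z(A)\otimes A\to A\otimes Z(A)$, the canonical distributive law of $A$. $D(A)=A\otimes_\Omega Z(A)$ is the Hopf algebra on $A\otimes Z(A)$ with product $(m_A\otimes m_{Z(A)})(\mathrm{id}_A\otimes\Omega\otimes\mathrm{id}_{Z(A)})$, unit $u_A\otimes u_{Z(A)}$, coproduct $(\mathrm{id}_A\otimes\tau_{A,Z(A)}\otimes\mathrm{id}_{Z(A)})(\Delta_A\otimes\Delta_{Z(A)})$, counit $\varepsilon_A\otimes\varepsilon_{Z(A)}$. Its quasitriangular structure is encoded by $R_{X,Y}=(\mathrm{id}_{Y\otimes A}\otimes u_{Z(A)}\otimes\mathrm{id}_X\otimes u_A\otimes\mathrm{id}_{Z(A)})\partial_{X,Y}\colon X\otimes Y\to Y\otimes D(A)\otimes X\otimes D(A)$: the braiding of $\mathcal{B}_{D(A)}$ is $c_{(M,r),(N,s)}=(s\otimes r)R_{M,N}$, and the braiding of ${}_{D(A)}\mathcal{B}$ is $c'_{(M,r),(N,s)}=\tau_{M,N}\,c_{F(N,s),F(M,r)}\,\tau^{-1}_{N,M}$, where $F(M,r)=(M,r\,\tau_{M,D(A)}(\mathrm{id}_M\otimes S_{D(A)}))$.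 *)

(* Defs.v *)
From mathcomp Require Import ssreflect ssrfun ssrbool.
From mathcomp Require Import boolp.

Set Implicit Arguments.
Unset Strict Implicit.
Unset Printing Implicit Defensive.

Declare Scope mon_scope.
Delimit Scope mon_scope with mon.
Local Open Scope mon_scope.

Reserved Notation "f ∷ X ⇒ Y" (at level 70, X at next level, Y at next level).
Reserved Notation "g ∘ f" (at level 45, right associativity).
Reserved Notation "X ⊗ Y" (at level 40, left associativity).
Reserved Notation "f ⊠ g" (at level 40, left associativity).

(* Small categories are given by a type of objects and a single type of
   arrows.  With this presentation the axioms of a strict monoidal category
   are plain equalities, without transport along equalities of objects.
   Composition is a total function, but it is specified only for composable
   arrows: the value of [comp g f] when [dom g <> cod f] carries no meaning
   and is never constrained, in categories or in functors. *)
Record cat := Cat {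
  ob : Type;
  mor : Type;
  dom : mor -> ob;
  cod : mor -> ob;
  idm : ob -> mor;
  comp : mor -> mor -> mor;
  dom_id : forall X, dom (idm X) = X;
  cod_id : forall X, cod (idm X) = X;
  dom_comp : forall g f, dom g = cod f -> dom (comp g f) = dom f;
  cod_comp : forall g f, dom g = cod f -> cod (comp g f) = cod g;
  comp1m : forall f, comp (idm (cod f)) f = f;
  compm1 : forall f, comp f (idm (dom f)) = f;
  compA : forall h g f, dom h = cod g -> dom g = cod f ->
    comp h (comp g f) = comp (comp h g) f }.

Arguments dom {_} _.
Arguments cod {_} _.
Arguments idm {_} _.
Arguments comp {_} _ _.
Notation "g ∘ f" := (comp g f) : mon_scope.

Definition hom (C : cat) (f : mor C) (X Y : ob C) : Prop :=
  dom f = X /\ cod f = Y.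
Notation "f ∷ X ⇒ Y" := (hom f X Y) : mon_scope.

Definition inverse (C : cat) (f g : mor C) : Prop :=
  [/\ dom g = cod f, cod g = dom f,
      g ∘ f = idm (dom f) & f ∘ g = idm (cod f)].

Definition is_iso (C : cat) (f : mor C) : Prop := exists g, inverse f g.

(* The inverse of [f] if [f] is an isomorphism, and [f] otherwise. *)
Definition inv (C : cat) (f : mor C) : mor C :=
  if pselect (is_iso f) is left fP then sval (cid fP) else f.

Record smcat := SMCat {
  smcat_cat :> cat;
  tens : ob smcat_cat -> ob smcat_cat -> ob smcat_cat;
  tunit : ob smcat_cat;
  tensm : mor smcat_cat -> mor smcat_cat -> mor smcat_cat;
  tensA : forall X Y Z, tens X (tens Y Z) = tens (tens X Y) Z;
  tens1x : forall X, tens tunit X = X;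
  tensx1 : forall X, tens X tunit = X;
  dom_tens : forall f g, dom (tensm f g) = tens (dom f) (dom g);
  cod_tens : forall f g, cod (tensm f g) = tens (cod f) (cod g);
  tens_id : forall X Y, tensm (idm X) (idm Y) = idm (tens X Y);
  tens_comp : forall g f g' f', dom g = cod f -> dom g' = cod f' ->
    tensm (g ∘ f) (g' ∘ f') = tensm g g' ∘ tensm f f';
  tensmA : forall f g h, tensm f (tensm g h) = tensm (tensm f g) h;
  tens1m : forall f, tensm (idm tunit) f = f;
  tensm1 : forall f, tensm f (idm tunit) = f }.

Arguments tens {_} _ _.
Arguments tunit {_}.
Arguments tensm {_} _ _.
Notation "X ⊗ Y" := (tens X Y) : mon_scope.
Notation "f ⊠ g" := (tensm f g) : mon_scope.

Create HintDb homdb.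

Ltac homs := repeat match goal with
  | H : hom _ _ _ |- _ => destruct H end.

Ltac typ1 := solve [ repeat match goal with
  | |- hom _ _ _ => split
  | |- context [dom (comp ?g ?f)] => rewrite (@dom_comp _ g f); [ | typ1 ]
  | |- context [cod (comp ?g ?f)] => rewrite (@cod_comp _ g f); [ | typ1 ]
  | H : dom _ = _ |- _ => progress rewrite !H
  | H : cod _ = _ |- _ => progress rewrite !H
  | _ => progress rewrite ?dom_id ?cod_id ?dom_tens ?cod_tens
  | _ => progress autorewrite with homdb
  end; rewrite ?tens1x ?tensx1 ?tensA ?tens1x ?tensx1; 
  first [ reflexivity | congruence ] ].
Ltac typ := intros; homs; typ1.

Section Category.

Variable C : cat.
Implicit Types (f g : mor C) (X Y : ob C).

Lemma comp_idl f Y : cod f = Y -> idm Y ∘ f = f.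
Proof. by move=> <-; exact: comp1m. Qed.

Lemma comp_idr f X : dom f = X -> f ∘ idm X = f.
Proof. by move=> <-; exact: compm1. Qed.

Lemma inverse_uniq f g h : inverse f g -> inverse f h -> g = h.
Proof.
move=> [dg cg gf fg] [dh ch hf fh].
by rewrite -(comp_idr dg) -fh compA // gf comp_idl.
Qed.

Lemma inverse_sym f g : inverse f g -> inverse g f.
Proof. by move=> [dg cg gf fg]; split; rewrite ?dg ?cg. Qed.

Lemma inverse_id X : inverse (idm X) (idm X).
Proof. by split; rewrite ?dom_id ?cod_id // comp_idl // cod_id. Qed.

Lemma inverse_comp f f' g g' : dom g = cod f ->
  inverse f f' -> inverse g g' -> inverse (g ∘ f) (f' ∘ g').
Proof.
move=> gf [d1 c1 l1 r1] [d2 c2 l2 r2]; split; try typ.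
- rewrite compA; [|typ|typ].
  rewrite -(@compA _ f' g' g); [|typ|typ].
  by rewrite l2 gf comp_idr // l1 dom_comp.
- rewrite compA; [|typ|typ].
  rewrite -(@compA _ g f f'); [|typ|typ].
  by rewrite r1 -gf comp_idr // r2 cod_comp.
Qed.

Lemma invP f : is_iso f -> inverse f (inv f).
Proof. by rewrite /inv; case: pselect => // fP _; case: cid. Qed.

Lemma inv_eq f g : inverse f g -> inv f = g.
Proof. by move=> fg; apply: (inverse_uniq _ fg); apply: invP; exists g. Qed.

End Category.

Section Monoidal.

Variable C : smcat.
Implicit Types (f g h : mor C) (X Y Z : ob C).

Lemma tens_l f g Z : dom g = cod f ->
  (g ∘ f) ⊠ idm Z = (g ⊠ idm Z) ∘ (f ⊠ idm Z).
Proof. by move=> gf; rewrite -tens_comp ?comp_idl //; typ. Qed.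

Lemma tens_r f g Z : dom g = cod f ->
  idm Z ⊠ (g ∘ f) = (idm Z ⊠ g) ∘ (idm Z ⊠ f).
Proof. by move=> gf; rewrite -tens_comp ?comp_idl //; typ. Qed.

Lemma tens_lr f g X Y : dom f = X -> cod g = Y ->
  (f ⊠ idm Y) ∘ (idm X ⊠ g) = f ⊠ g.
Proof. by move=> <- <-; rewrite -tens_comp ?compm1 ?comp1m //; typ. Qed.

Lemma tens_rl f g X Y : cod f = X -> dom g = Y ->
  (idm X ⊠ g) ∘ (f ⊠ idm Y) = f ⊠ g.
Proof. by move=> <- <-; rewrite -tens_comp ?compm1 ?comp1m //; typ. Qed.

Lemma tens_compr f g k X : dom f = X -> dom g = cod k ->
  f ⊠ (g ∘ k) = (f ⊠ g) ∘ (idm X ⊠ k).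
Proof. by move=> <- gk; rewrite -tens_comp ?compm1 //; typ. Qed.

Lemma tens_compl f g k X : dom f = X -> dom g = cod k ->
  (g ∘ k) ⊠ f = (g ⊠ f) ∘ (k ⊠ idm X).
Proof. by move=> <- gk; rewrite -tens_comp ?compm1 //; typ. Qed.

Lemma inverse_tens f f' g g' :
  inverse f f' -> inverse g g' -> inverse (f ⊠ g) (f' ⊠ g').
Proof.
move=> [d1 c1 l1 r1] [d2 c2 l2 r2]; split; try typ.
- by rewrite -tens_comp; try typ; rewrite l1 l2 dom_tens tens_id.
- by rewrite -tens_comp; try typ; rewrite r1 r2 cod_tens tens_id.
Qed.

End Monoidal.

Record braiding (C : smcat) := Braiding {
  br :> ob C -> ob C -> mor C;
  br_hom : forall X Y, br X Y ∷ X ⊗ Y ⇒ Y ⊗ X;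
  br_iso : forall X Y, is_iso (br X Y);
  br_nat : forall f g,
    br (cod f) (cod g) ∘ (f ⊠ g) = (g ⊠ f) ∘ br (dom f) (dom g);
  br_tensr : forall X Y Z,
    br X (Y ⊗ Z) = (idm Y ⊠ br X Z) ∘ (br X Y ⊠ idm Z);
  br_tensl : forall X Y Z,
    br (X ⊗ Y) Z = (br X Z ⊠ idm Y) ∘ (idm X ⊠ br Y Z) }.

Record brcat := BrCat {
  brcat_smcat :> smcat;
  brd : braiding brcat_smcat }.

Arguments brd {_}.
Notation τ := (@brd _).

(* A choice of a left dual [ld X] and of a right dual [rd X] of every object;
   the right dual has evaluation X ⊗ rd X -> 1. *)
Record autonomous (C : smcat) := Autonomous {
  ld : ob C -> ob C;
  ldev : ob C -> mor C;
  ldcoev : ob C -> mor C;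
  ldev_hom : forall X, ldev X ∷ ld X ⊗ X ⇒ tunit;
  ldcoev_hom : forall X, ldcoev X ∷ tunit ⇒ X ⊗ ld X;
  ld_zigzag1 : forall X, (idm X ⊠ ldev X) ∘ (ldcoev X ⊠ idm X) = idm X;
  ld_zigzag2 : forall X,
    (ldev X ⊠ idm (ld X)) ∘ (idm (ld X) ⊠ ldcoev X) = idm (ld X);
  rd : ob C -> ob C;
  rdev : ob C -> mor C;
  rdcoev : ob C -> mor C;
  rdev_hom : forall X, rdev X ∷ X ⊗ rd X ⇒ tunit;
  rdcoev_hom : forall X, rdcoev X ∷ tunit ⇒ rd X ⊗ X;
  rd_zigzag1 : forall X, (rdev X ⊠ idm X) ∘ (idm X ⊠ rdcoev X) = idm X;
  rd_zigzag2 : forall X,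
    (idm (rd X) ⊠ rdev X) ∘ (rdcoev X ⊠ idm (rd X)) = idm (rd X) }.

Record bialgebra (B : brcat) := Bialgebra {
  carrier :> ob B;
  mul : mor B;
  one : mor B;
  comul : mor B;
  counit : mor B;
  mul_hom : mul ∷ carrier ⊗ carrier ⇒ carrier;
  one_hom : one ∷ tunit ⇒ carrier;
  comul_hom : comul ∷ carrier ⇒ carrier ⊗ carrier;
  counit_hom : counit ∷ carrier ⇒ tunit;
  mulA : mul ∘ (idm carrier ⊠ mul) = mul ∘ (mul ⊠ idm carrier);
  mul1h : mul ∘ (one ⊠ idm carrier) = idm carrier;
  mulh1 : mul ∘ (idm carrier ⊠ one) = idm carrier;
  comulA : (idm carrier ⊠ comul) ∘ comul = (comul ⊠ idm carrier) ∘ comul;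
  comul1h : (counit ⊠ idm carrier) ∘ comul = idm carrier;
  comulh1 : (idm carrier ⊠ counit) ∘ comul = idm carrier;
  comul_mul : comul ∘ mul =
    (mul ⊠ mul) ∘ (idm carrier ⊠ τ carrier carrier ⊠ idm carrier)
      ∘ (comul ⊠ comul);
  comul_one : comul ∘ one = one ⊠ one;
  counit_mul : counit ∘ mul = counit ⊠ counit;
  counit_one : counit ∘ one = idm tunit }.

Record hopf (B : brcat) := Hopf {
  hopf_bialgebra :> bialgebra B;
  antipode : mor B;
  antipode_hom : antipode ∷ hopf_bialgebra ⇒ hopf_bialgebra;
  antipode_l : mul hopf_bialgebra ∘ (antipode ⊠ idm hopf_bialgebra)
      ∘ comul hopf_bialgebra = one hopf_bialgebra ∘ counit hopf_bialgebra;
  antipode_r : mul hopf_bialgebra ∘ (idm hopf_bialgebra ⊠ antipode)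
      ∘ comul hopf_bialgebra = one hopf_bialgebra ∘ counit hopf_bialgebra;
  antipode_iso : is_iso antipode }.

(* Objects of a strict monoidal category [C] equipped with additional
   structure.  The category of structured objects has as arrows the arrows of
   [C] satisfying [smor]; the forgetful functor to [C] is strict monoidal. *)
Record structured (C : smcat) := Structured {
  sob : Type;
  under : sob -> ob C;
  smor : sob -> sob -> mor C -> Prop;
  stens : sob -> sob -> sob;
  sunit : sob;
  smor_id : forall x, smor x x (idm (under x));
  smor_comp : forall x y z f g, f ∷ under x ⇒ under y -> g ∷ under y ⇒ under z ->
    smor x y f -> smor y z g -> smor x z (g ∘ f);
  smor_tens : forall x y x' y' f f',
    f ∷ under x ⇒ under y -> f' ∷ under x' ⇒ under y' ->
    smor x y f -> smor x' y' f' -> smor (stens x x') (stens y y') (f ⊠ f');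
  under_tens : forall x y, under (stens x y) = under x ⊗ under y;
  under_unit : under sunit = tunit;
  stensA : forall x y z, stens x (stens y z) = stens (stens x y) z;
  stens1x : forall x, stens sunit x = x;
  stensx1 : forall x, stens x sunit = x }.

Section Structured.

Variables (C : smcat) (S : structured C).

Record sarr := SArr {
  sdom : sob S;
  scod : sob S;
  arr :> mor C;
  sarr_hom : arr ∷ under sdom ⇒ under scod;
  sarr_smor : smor sdom scod arr }.

Lemma sarr_eq (f g : sarr) :
  sdom f = sdom g -> scod f = scod g -> f = g :> mor C -> f = g.
Proof.
case: f g => [x y f fh fm] [x' y' g gh gm] /= ex ey e.
by case: _ / ex ey e gh gm => ey; case: _ / ey => e; case: _ / e => gh gm;
  rewrite (Prop_irrelevance gh fh) (Prop_irrelevance gm fm).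
Qed.

Lemma sid_hom (x : sob S) : idm (under x) ∷ under x ⇒ under x.
Proof. by split; rewrite ?dom_id ?cod_id. Qed.

Definition sid (x : sob S) : sarr := SArr (sid_hom x) (smor_id x).

Lemma scomp_hom (g f : sarr) : sdom g = scod f ->
  g ∘ f ∷ under (sdom f) ⇒ under (scod g).
Proof.
by move=> gf; case: (sarr_hom f) (sarr_hom g) => ? ? [? ?]; typ.
Qed.

Lemma scomp_smor (g f : sarr) : sdom g = scod f ->
  smor (sdom f) (scod g) (g ∘ f).
Proof.
move: (sarr_hom g) (sarr_smor g) => + + gf; rewrite gf.
move=> gh gs; exact: smor_comp (sarr_hom f) gh (sarr_smor f) gs.
Qed.

Definition scomp (g f : sarr) : sarr :=
  if pselect (sdom g = scod f) is left gf
  then SArr (scomp_hom gf) (scomp_smor gf) else g.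

Lemma stens_hom (f g : sarr) :
  f ⊠ g ∷ under (stens (sdom f) (sdom g)) ⇒ under (stens (scod f) (scod g)).
Proof.
by rewrite !under_tens; case: (sarr_hom f) (sarr_hom g) => ? ? [? ?]; typ.
Qed.

Definition stensm (f g : sarr) : sarr := SArr (stens_hom f g)
  (smor_tens (sarr_hom f) (sarr_hom g) (sarr_smor f) (sarr_smor g)).

Lemma scompE (g f : sarr) : sdom g = scod f ->
  [/\ sdom (scomp g f) = sdom f, scod (scomp g f) = scod g &
      scomp g f = g ∘ f :> mor C].
Proof. by rewrite /scomp; case: pselect. Qed.

Lemma sdom_arr (f : sarr) : dom f = under (sdom f).
Proof. by case: (sarr_hom f). Qed.

Lemma scod_arr (f : sarr) : cod f = under (scod f).
Proof. by case: (sarr_hom f). Qed.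

Definition structured_cat : cat.
Proof.
refine (@Cat (sob S) sarr sdom scod sid scomp _ _ _ _ _ _ _) => //.
- by move=> g f /scompE[].
- by move=> g f /scompE[].
- move=> f; have [//|d c e] := @scompE (sid (scod f)) f.
  by apply: sarr_eq => //; rewrite e /= comp_idl // scod_arr.
- move=> f; have [//|d c e] := @scompE f (sid (sdom f)).
  by apply: sarr_eq => //; rewrite e /= comp_idr // sdom_arr.
- move=> h g f hg gf; have [dhg chg ehg] := scompE hg.
  have [dgf cgf egf] := scompE gf.
  have hgf : sdom h = scod (scomp g f) by rewrite cgf.
  have hgf' : sdom (scomp h g) = scod f by rewrite dhg.
  have [d1 c1 e1] := scompE hgf; have [d2 c2 e2] := scompE hgf'.
  apply: sarr_eq; rewrite ?d1 ?d2 ?c1 ?c2 //.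
  by rewrite e1 e2 ehg egf compA // sdom_arr scod_arr ?hg ?gf.
Defined.

Definition structured_smcat : smcat.
Proof.
refine (@SMCat structured_cat (@stens C S) (sunit S) stensm
  (@stensA C S) (@stens1x C S) (@stensx1 C S) _ _ _ _ _ _ _) => //.
- by move=> x y; apply: sarr_eq; rewrite //= under_tens tens_id.
- move=> g f g' f' /= gf gf'.
  have [d c e] := scompE gf; have [d' c' e'] := scompE gf'.
  have [| d1 c1 e1] := @scompE (stensm g g') (stensm f f').
    by rewrite /= gf gf'.
  apply: sarr_eq; rewrite ?d1 ?c1 /= ?d ?d' ?c ?c' // e1 e e' /= tens_comp //.
  - by rewrite sdom_arr gf scod_arr.
  - by rewrite sdom_arr gf' scod_arr.
- by move=> f g h; apply: sarr_eq; rewrite /= ?stensA ?tensmA.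
- by move=> f; apply: sarr_eq; rewrite /= ?stens1x ?under_unit ?tens1m.
- by move=> f; apply: sarr_eq; rewrite /= ?stensx1 ?under_unit ?tensm1.
Defined.

End Structured.

Lemma structured_iso (C : smcat) (S : structured C)
    (f : mor (structured_smcat S)) (g : mor C) :
  inverse (arr (f : sarr S)) g -> smor (scod (f : sarr S)) (sdom f) g ->
  is_iso f.
Proof.
move=> [dg cg gf fg] gP.
have gh : g ∷ under (scod (f : sarr S)) ⇒ under (sdom (f : sarr S)).
  by split; rewrite ?dg ?cg ?sdom_arr ?scod_arr.
exists (SArr gh gP : mor (structured_smcat S)); split=> //=.
- have [//|d c e] := @scompE _ S (SArr gh gP) f.
  by apply: sarr_eq => //; rewrite e /= gf sdom_arr.
- have [//|d c e] := @scompE _ S f (SArr gh gP).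
  by apply: sarr_eq => //; rewrite e /= fg scod_arr.
Qed.

Definition structured_braiding (C : smcat) (S : structured C)
    (c : sob S -> sob S -> mor C)
    (c_hom : forall x y, c x y ∷ under (stens x y) ⇒ under (stens y x))
    (c_smor : forall x y, smor (stens x y) (stens y x) (c x y))
    (c_iso : forall x y, exists2 g,
       inverse (c x y) g & smor (stens y x) (stens x y) g)
    (c_nat : forall x y x' y' f g, f ∷ under x ⇒ under x' ->
       g ∷ under y ⇒ under y' -> smor x x' f -> smor y y' g ->
       c x' y' ∘ (f ⊠ g) = (g ⊠ f) ∘ c x y)
    (c_tensr : forall x y z, c x (stens y z) =
       (idm (under y) ⊠ c x z) ∘ (c x y ⊠ idm (under z)))
    (c_tensl : forall x y z, c (stens x y) z =
       (c x z ⊠ idm (under y)) ∘ (idm (under x) ⊠ c y z)) :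
  braiding (structured_smcat S).
Proof.
refine (@Braiding (structured_smcat S)
  (fun x y => SArr (c_hom x y) (c_smor x y)) _ _ _ _ _).
- by move=> x y; split.
- by move=> x y; have [g gP gS] := c_iso x y; 
  exact: (@structured_iso C S (SArr (c_hom x y) (c_smor x y)) g gP gS).
- move=> f g /=.
  have [|d e a] := @scompE _ S (SArr (c_hom (scod f) (scod g))
    (c_smor (scod f) (scod g))) (stensm f g); first by [].
  have [|d' e' a'] := @scompE _ S (stensm g f)
    (SArr (c_hom (sdom f) (sdom g)) (c_smor (sdom f) (sdom g))); first by [].
  apply: sarr_eq; rewrite ?d ?d' ?e ?e' // a a' /=.
  exact: c_nat (sarr_hom f) (sarr_hom g) (sarr_smor f) (sarr_smor g).
- move=> x y z /=.
  have [|d e a] := @scompE _ S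
    (stensm (sid y) (SArr (c_hom x z) (c_smor x z)))
    (stensm (SArr (c_hom x y) (c_smor x y)) (sid z)); first by rewrite /= stensA.
  by apply: sarr_eq; rewrite ?d ?e ?a //= stensA.
- move=> x y z /=.
  have [|d e a] := @scompE _ S
    (stensm (SArr (c_hom x z) (c_smor x z)) (sid y))
    (stensm (sid x) (SArr (c_hom y z) (c_smor y z))); first by rewrite /= stensA.
  by apply: sarr_eq; rewrite ?d ?e ?a //= stensA.
Defined.

Lemma is_iso_comp (C : cat) (f g : mor C) :
  dom g = cod f -> is_iso f -> is_iso g -> is_iso (g ∘ f).
Proof. by move=> gf [f' ff'] [g' gg']; exists (f' ∘ g'); exact: inverse_comp. Qed.

Lemma is_iso_tens (C : smcat) (f g : mor C) :
  is_iso f -> is_iso g -> is_iso (f ⊠ g).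
Proof. by move=> [f' ff'] [g' gg']; exists (f' ⊠ g'); exact: inverse_tens. Qed.

Lemma is_iso_id (C : cat) (X : ob C) : is_iso (idm X).
Proof. by exists (idm X); exact: inverse_id. Qed.

Section Centers.

Variable C : smcat.

Record half_braided := HalfBraided {
  hb_ob : ob C;
  hb : ob C -> mor C;
  hb_hom : forall Y, hb Y ∷ hb_ob ⊗ Y ⇒ Y ⊗ hb_ob;
  hb_iso : forall Y, is_iso (hb Y);
  hb_nat : forall f : mor C,
    (f ⊠ idm hb_ob) ∘ hb (dom f) = hb (cod f) ∘ (idm hb_ob ⊠ f);
  hb_tens : forall Y Z,
    hb (Y ⊗ Z) = (idm Y ⊠ hb Z) ∘ (hb Y ⊠ idm Z);
  hb_unit : hb tunit = idm hb_ob }.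

Lemma half_braided_eq (x y : half_braided) :
  hb_ob x = hb_ob y -> hb x =1 hb y -> x = y.
Proof.
case: x y => [M s h1 h2 h3 h4 h5] [N t k1 k2 k3 k4 k5] /= e /funext e'.
case: _ / e e' k1 k2 k3 k4 k5 => e'; case: _ / e' => *.
by congr HalfBraided; apply: Prop_irrelevance.
Qed.

Lemma hb_dom x Y : dom (hb x Y) = hb_ob x ⊗ Y.
Proof. by case: (hb_hom x Y). Qed.

Lemma hb_cod x Y : cod (hb x Y) = Y ⊗ hb_ob x.
Proof. by case: (hb_hom x Y). Qed.

Hint Rewrite hb_dom hb_cod : homdb.

Definition half_braided_tens (x y : half_braided) : half_braided.
Proof.
refine (@HalfBraided (hb_ob x ⊗ hb_ob y)
  (fun Y => (hb x Y ⊠ idm (hb_ob y)) ∘ (idm (hb_ob x) ⊠ hb y Y)) _ _ _ _ _).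
- by move=> Y; typ.
- move=> Y; apply: is_iso_comp; first typ.
    by apply: is_iso_tens; [exact: is_iso_id | exact: hb_iso].
  by apply: is_iso_tens; [exact: hb_iso | exact: is_iso_id].
- move=> f; rewrite compA; [|typ|typ].
  rewrite -tens_id tensmA -tens_l; last typ.
  rewrite hb_nat tens_l; last typ.
  rewrite -compA; [|typ|typ].
  rewrite -tensmA -tens_r; last typ.
  rewrite hb_nat tens_r; last typ.
  by rewrite compA ?tensmA //; typ.
- move=> Y Z; rewrite !hb_tens !tens_l ?tens_r; try typ.
  rewrite !tensmA -!compA; try typ; congr (_ ∘ _).
  rewrite !compA; try typ; congr (_ ∘ _).
  rewrite -(tensmA _ (idm Z)) -(tensmA _ _ (idm Z)) !tens_id.
  by rewrite tens_lr ?tens_rl //; typ.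
- by rewrite !hb_unit tens_id comp_idl //; typ.
Defined.

Definition half_braided_unit : half_braided.
Proof.
refine (@HalfBraided tunit (fun Y => idm Y) _ _ _ _ _) => //.
- by move=> Y; typ.
- by move=> Y; exact: is_iso_id.
- by move=> f; rewrite tens1m tensm1 comp_idl // comp_idr.
- by move=> Y Z; rewrite tens_id comp_idl //; typ.
Defined.

Definition center_structured : structured C.
Proof.
refine (@Structured C half_braided hb_ob
  (fun x y f => forall Y, (idm Y ⊠ f) ∘ hb x Y = hb y Y ∘ (f ⊠ idm Y))
  half_braided_tens half_braided_unit _ _ _ _ _ _ _ _) => //.
- by move=> x Y; rewrite !tens_id comp_idl ?comp_idr //; typ.
- move=> x y z f g [df cf] [dg cg] fP gP Y.
  rewrite tens_r ?tens_l; try typ.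
  rewrite -compA; [|typ|typ].
  rewrite fP compA; [|typ|typ].
  by rewrite gP compA; [|typ|typ].
- move=> x y x' y' f f' [df cf] [df' cf'] fP fP' Y /=.
  have e1 : (idm Y ⊠ (f ⊠ f')) ∘ (hb x Y ⊠ idm (hb_ob x')) =
            (hb y Y ⊠ idm (hb_ob y')) ∘ (f ⊠ idm Y ⊠ f').
    rewrite tensmA -!tens_comp; try typ.
    by rewrite fP comp_idl ?comp_idr.
  have e2 : (f ⊠ idm Y ⊠ f') ∘ (idm (hb_ob x) ⊠ hb x' Y) =
            (idm (hb_ob y) ⊠ hb y' Y) ∘ (f ⊠ f' ⊠ idm Y).
    rewrite -!tensmA -!tens_comp; try typ.
    by rewrite fP' comp_idl ?comp_idr.
  rewrite compA; [|typ|typ]; rewrite e1 -compA; [|typ|typ].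
  by rewrite e2 compA; [|typ|typ].
- move=> x y z; apply: half_braided_eq => [|Y] /=; first by rewrite tensA.
  rewrite tens_l ?tens_r; try typ.
  by rewrite -!tens_id !tensmA compA //; typ.
- move=> x; apply: half_braided_eq => [|Y] /=; first by rewrite tens1x.
  by rewrite tens_id tens1m comp_idl //; typ.
- move=> x; apply: half_braided_eq => [|Y] /=; first by rewrite tensx1.
  by rewrite tens_id tensm1 comp_idr //; typ.
Defined.

Definition center_smcat : smcat := structured_smcat center_structured.

Lemma center_br_smor (x y : half_braided) :
  smor (s := center_structured) (half_braided_tens x y) (half_braided_tens y x)
    (hb x (hb_ob y)).
Proof.
move=> Y /=.
rewrite compA; [|typ|typ].
rewrite -hb_tens.
have := hb_nat x (hb y Y); rewrite hb_dom hb_cod => <-.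
by rewrite hb_tens compA; [|typ|typ].
Qed.

Lemma center_br_hom (x y : half_braided) :
  hb x (hb_ob y) ∷ under (s := center_structured) (half_braided_tens x y)
     ⇒ under (s := center_structured) (half_braided_tens y x).
Proof. exact: hb_hom. Qed.

Lemma inverse_smor (x y : half_braided) (f g : mor C) :
  f ∷ hb_ob x ⇒ hb_ob y -> inverse f g ->
  smor (s := center_structured) x y f -> smor (s := center_structured) y x g.
Proof.
move=> [df cf] [dg cg gf fg] fP Y /=.
rewrite -[RHS](@comp_idl _ _ (Y ⊗ hb_ob x)); last typ.
rewrite -tens_id -{1}df -gf tens_r; last typ.
rewrite -compA; [|typ|typ]; congr (_ ∘ _).
rewrite compA; [|typ|typ]; rewrite fP -compA; [|typ|typ].
rewrite -tens_l; last typ.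
by rewrite fg cf tens_id comp_idr //; typ.
Qed.

Definition center_braiding : braiding center_smcat.
Proof.
refine (@structured_braiding C center_structured (fun x y => hb x (hb_ob y))
  center_br_hom center_br_smor _ _ _ _).
- move=> x y; have [g gP] := hb_iso x (hb_ob y); exists g => //.
  exact: inverse_smor (center_br_hom x y) gP (center_br_smor x y).
- move=> x y x' y' f g [/= df cf] [/= dg cg] fP gP.
  rewrite -(@tens_rl _ f g (hb_ob x') (hb_ob y)) //.
  rewrite compA; [|typ|typ]; rewrite -cg -hb_nat dg -compA; [|typ|typ].
  rewrite -fP compA; [|typ|typ]; congr (_ ∘ _).
  by rewrite tens_lr.
- by move=> x y z; exact: hb_tens.
- by [].
Defined.

Definition center : brcat := BrCat center_braiding.

End Centers.

Section PrimedCenter.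

Variable C : smcat.

Record half_braided' := HalfBraided' {
  hb'_ob : ob C;
  hb' : ob C -> mor C;
  hb'_hom : forall Y, hb' Y ∷ Y ⊗ hb'_ob ⇒ hb'_ob ⊗ Y;
  hb'_iso : forall Y, is_iso (hb' Y);
  hb'_nat : forall f : mor C,
    (idm hb'_ob ⊠ f) ∘ hb' (dom f) = hb' (cod f) ∘ (f ⊠ idm hb'_ob);
  hb'_tens : forall Y Z,
    hb' (Y ⊗ Z) = (hb' Y ⊠ idm Z) ∘ (idm Y ⊠ hb' Z);
  hb'_unit : hb' tunit = idm hb'_ob }.

Lemma half_braided'_eq (x y : half_braided') :
  hb'_ob x = hb'_ob y -> hb' x =1 hb' y -> x = y.
Proof.
case: x y => [M s h1 h2 h3 h4 h5] [N t k1 k2 k3 k4 k5] /= e /funext e'.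
case: _ / e e' k1 k2 k3 k4 k5 => e'; case: _ / e' => *.
by congr HalfBraided'; apply: Prop_irrelevance.
Qed.

Lemma hb'_dom x Y : dom (hb' x Y) = Y ⊗ hb'_ob x.
Proof. by case: (hb'_hom x Y). Qed.

Lemma hb'_cod x Y : cod (hb' x Y) = hb'_ob x ⊗ Y.
Proof. by case: (hb'_hom x Y). Qed.

Hint Rewrite hb'_dom hb'_cod : homdb.

Definition half_braided'_tens (x y : half_braided') : half_braided'.
Proof.
refine (@HalfBraided' (hb'_ob x ⊗ hb'_ob y)
  (fun Y => (idm (hb'_ob x) ⊠ hb' y Y) ∘ (hb' x Y ⊠ idm (hb'_ob y))) _ _ _ _ _).
- by move=> Y; typ.
- move=> Y; apply: is_iso_comp; first typ.
    by apply: is_iso_tens; [exact: hb'_iso | exact: is_iso_id].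
  by apply: is_iso_tens; [exact: is_iso_id | exact: hb'_iso].
- move=> f; rewrite compA; [|typ|typ].
  rewrite -tens_id -tensmA -tens_r; last typ.
  rewrite hb'_nat tens_r; last typ.
  rewrite -compA; [|typ|typ].
  rewrite tensmA -tens_l; last typ.
  rewrite hb'_nat tens_l; last typ.
  by rewrite compA -?tensmA //; typ.
- move=> Y Z; rewrite !hb'_tens !tens_l ?tens_r; try typ.
  rewrite !tensmA -!compA; try typ; congr (_ ∘ _).
  rewrite !compA; try typ; congr (_ ∘ _).
  rewrite -(tensmA _ (idm Z)) -(tensmA _ _ (idm Z)) !tens_id.
  by rewrite tens_lr ?tens_rl //; typ.
- by rewrite !hb'_unit tens_id comp_idl //; typ.
Defined.

Definition half_braided'_unit : half_braided'.
Proof.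
refine (@HalfBraided' tunit (fun Y => idm Y) _ _ _ _ _) => //.
- by move=> Y; typ.
- by move=> Y; exact: is_iso_id.
- by move=> f; rewrite tens1m tensm1 comp_idl // comp_idr.
- by move=> Y Z; rewrite tens_id comp_idl //; typ.
Defined.

Definition center'_structured : structured C.
Proof.
refine (@Structured C half_braided' hb'_ob
  (fun x y f => forall Y, (f ⊠ idm Y) ∘ hb' x Y = hb' y Y ∘ (idm Y ⊠ f))
  half_braided'_tens half_braided'_unit _ _ _ _ _ _ _ _) => //.
- by move=> x Y; rewrite !tens_id comp_idl ?comp_idr //; typ.
- move=> x y z f g [df cf] [dg cg] fP gP Y.
  rewrite tens_r ?tens_l; try typ.
  rewrite -compA; [|typ|typ].
  rewrite fP compA; [|typ|typ].
  by rewrite gP compA; [|typ|typ].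
- move=> x y x' y' f f' [df cf] [df' cf'] fP fP' Y /=.
  have e1 : (f ⊠ f' ⊠ idm Y) ∘ (idm (hb'_ob x) ⊠ hb' x' Y) =
            (idm (hb'_ob y) ⊠ hb' y' Y) ∘ (f ⊠ idm Y ⊠ f').
    rewrite -!tensmA -!tens_comp; try typ.
    by rewrite fP' comp_idl ?comp_idr.
  have e2 : (f ⊠ idm Y ⊠ f') ∘ (hb' x Y ⊠ idm (hb'_ob x')) =
            (hb' y Y ⊠ idm (hb'_ob y')) ∘ (idm Y ⊠ (f ⊠ f')).
    rewrite tensmA -!tens_comp; try typ.
    by rewrite fP comp_idl ?comp_idr.
  rewrite compA; [|typ|typ]; rewrite e1 -compA; [|typ|typ].
  by rewrite e2 compA; [|typ|typ].
- move=> x y z; apply: half_braided'_eq => [|Y] /=; first by rewrite tensA.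
  rewrite tens_l ?tens_r; try typ.
  by rewrite -!tens_id !tensmA compA //; typ.
- move=> x; apply: half_braided'_eq => [|Y] /=; first by rewrite tens1x.
  by rewrite tens_id tens1m comp_idr //; typ.
- move=> x; apply: half_braided'_eq => [|Y] /=; first by rewrite tensx1.
  by rewrite tens_id tensm1 comp_idl //; typ.
Defined.

Definition center'_smcat : smcat := structured_smcat center'_structured.

Lemma center'_br_smor (x y : half_braided') :
  smor (s := center'_structured) (half_braided'_tens x y)
    (half_braided'_tens y x) (hb' y (hb'_ob x)).
Proof.
move=> Y /=.
rewrite compA; [|typ|typ].
rewrite -hb'_tens.
have := hb'_nat y (hb' x Y); rewrite hb'_dom hb'_cod => <-.
by rewrite hb'_tens compA; [|typ|typ].
Qed.

Lemma center'_br_hom (x y : half_braided') :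
  hb' y (hb'_ob x) ∷ under (s := center'_structured) (half_braided'_tens x y)
     ⇒ under (s := center'_structured) (half_braided'_tens y x).
Proof. exact: hb'_hom. Qed.

Lemma inverse_smor' (x y : half_braided') (f g : mor C) :
  f ∷ hb'_ob x ⇒ hb'_ob y -> inverse f g ->
  smor (s := center'_structured) x y f -> smor (s := center'_structured) y x g.
Proof.
move=> [df cf] [dg cg gf fg] fP Y /=.
rewrite -[RHS](@comp_idl _ _ (hb'_ob x ⊗ Y)); last typ.
rewrite -tens_id -{1}df -gf tens_l; last typ.
rewrite -compA; [|typ|typ]; congr (_ ∘ _).
rewrite compA; [|typ|typ]; rewrite fP -compA; [|typ|typ].
rewrite -tens_r; last typ.
by rewrite fg cf tens_id comp_idr //; typ.
Qed.

Definition center'_braiding : braiding center'_smcat.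
Proof.
refine (@structured_braiding C center'_structured
  (fun x y => hb' y (hb'_ob x)) center'_br_hom center'_br_smor _ _ _ _).
- move=> x y; have [g gP] := hb'_iso y (hb'_ob x); exists g => //.
  exact: inverse_smor' (center'_br_hom x y) gP (center'_br_smor x y).
- move=> x y x' y' f g [/= df cf] [/= dg cg] fP gP.
  rewrite -(@tens_lr _ f g (hb'_ob x) (hb'_ob y')) //.
  rewrite compA; [|typ|typ]; rewrite -cf -hb'_nat df -compA; [|typ|typ].
  rewrite -gP compA; [|typ|typ]; congr (_ ∘ _).
  by rewrite tens_rl.
- by [].
- by move=> x y z; exact: hb'_tens.
Defined.

Definition center' : brcat := BrCat center'_braiding.

End PrimedCenter.

Section Mirror.

Variable A : brcat.

Lemma inv_br (X Y : ob A) : inverse (τ X Y) (inv (τ X Y)).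
Proof. by apply: invP; exact: br_iso. Qed.

Lemma br_dom (X Y : ob A) : dom (τ X Y) = X ⊗ Y.
Proof. by case: (br_hom (@brd A) X Y). Qed.

Lemma br_cod (X Y : ob A) : cod (τ X Y) = Y ⊗ X.
Proof. by case: (br_hom (@brd A) X Y). Qed.

Lemma inv_br_dom (X Y : ob A) : dom (inv (τ X Y)) = Y ⊗ X.
Proof. by case: (inv_br X Y) => ->; rewrite br_cod. Qed.

Lemma inv_br_cod (X Y : ob A) : cod (inv (τ X Y)) = X ⊗ Y.
Proof. by case: (inv_br X Y) => _ ->; rewrite br_dom. Qed.

Hint Rewrite br_dom br_cod inv_br_dom inv_br_cod : homdb.

Definition mirror_braiding : braiding A.
Proof.
refine (@Braiding A (fun X Y => inv (τ Y X)) _ _ _ _ _).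
- by move=> X Y; typ.
- by move=> X Y; exists (τ Y X); apply: inverse_sym; exact: inv_br.
- move=> f g; have [_ _ _ r] := inv_br (dom g) (dom f).
  have [_ _ l _] := inv_br (cod g) (cod f).
  rewrite -[f ⊠ g](@comp_idr _ _ (dom f ⊗ dom g)); last typ.
  rewrite -[dom f ⊗ dom g]br_cod -r.
  rewrite [(f ⊠ g) ∘ _]compA; [|typ|typ].
  rewrite -br_nat -compA; [|typ|typ].
  rewrite compA; [|typ|typ].
  by rewrite l comp_idl //; typ.
- move=> X Y Z; apply: inv_eq; rewrite br_tensl.
  apply: inverse_comp; first typ.
    by apply: inverse_tens; [exact: inverse_id | exact: inv_br].
  by apply: inverse_tens; [exact: inv_br | exact: inverse_id].
- move=> X Y Z; apply: inv_eq; rewrite br_tensr.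
  apply: inverse_comp; first typ.
    by apply: inverse_tens; [exact: inv_br | exact: inverse_id].
  by apply: inverse_tens; [exact: inverse_id | exact: inv_br].
Defined.

Definition mirror : brcat := BrCat mirror_braiding.

End Mirror.

Lemma comp_rw (C : cat) (a b c k : mor C) :
  a ∘ b = c -> dom a = cod b -> dom b = cod k -> a ∘ b ∘ k = c ∘ k.
Proof. by move=> <- ab bk; rewrite compA. Qed.

Ltac asr := repeat (rewrite -compA; [|typ|typ]).

Section BraidingLemmas.

Variable B : brcat.
Hint Rewrite br_dom br_cod : homdb.

Lemma br_natl (f : mor B) X Y Z : f ∷ X ⇒ Y ->
  τ Y Z ∘ (f ⊠ idm Z) = (idm Z ⊠ f) ∘ τ X Z.
Proof.
by move=> [dX cY]; have := br_nat brd f (idm Z); rewrite dom_id cod_id dX cY.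
Qed.

Lemma br_natr (f : mor B) X Y Z : f ∷ X ⇒ Y ->
  τ Z Y ∘ (idm Z ⊠ f) = (f ⊠ idm Z) ∘ τ Z X.
Proof.
by move=> [dX cY]; have := br_nat brd (idm Z) f; rewrite dom_id cod_id dX cY.
Qed.

Lemma br_1x (X : ob B) : τ tunit X = idm X.
Proof.
have [_ _ l _] := inv_br tunit X.
have e := br_tensl brd tunit tunit X.
rewrite tens1x tensm1 tens1m in e.
have d : dom (τ tunit X) = X by rewrite br_dom tens1x.
have c : cod (τ tunit X) = X by rewrite br_cod tensx1.
have di := inv_br_dom tunit X; rewrite tensx1 in di.
by rewrite -[LHS](@comp_idl _ _ X) // -{1}d -l -compA -?e ?l ?d // ?di ?c.
Qed.

Lemma br_x1 (X : ob B) : τ X tunit = idm X.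
Proof.
have [_ _ l _] := inv_br X tunit.
have e := br_tensr brd X tunit tunit.
rewrite tens1x tensm1 tens1m in e.
have d : dom (τ X tunit) = X by rewrite br_dom tensx1.
have c : cod (τ X tunit) = X by rewrite br_cod tens1x.
have di := inv_br_dom X tunit; rewrite tens1x in di.
by rewrite -[LHS](@comp_idl _ _ X) // -{1}d -l -compA -?e ?l ?d // ?di ?c.
Qed.

End BraidingLemmas.

Section Modules.

Variables (B : brcat) (H : bialgebra B).
Local Notation h := (idm (carrier H)).

Lemma mul_dom : dom (mul H) = H ⊗ H. Proof. by case: (mul_hom H). Qed.
Lemma mul_cod : cod (mul H) = H. Proof. by case: (mul_hom H). Qed.
Lemma one_dom : dom (one H) = tunit. Proof. by case: (one_hom H). Qed.
Lemma one_cod : cod (one H) = H. Proof. by case: (one_hom H). Qed.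
Lemma comul_dom : dom (comul H) = H. Proof. by case: (comul_hom H). Qed.
Lemma comul_cod : cod (comul H) = H ⊗ H.
Proof. by case: (comul_hom H). Qed.
Lemma counit_dom : dom (counit H) = H. Proof. by case: (counit_hom H). Qed.
Lemma counit_cod : cod (counit H) = tunit.
Proof. by case: (counit_hom H). Qed.

Hint Rewrite br_dom br_cod mul_dom mul_cod one_dom one_cod comul_dom comul_cod
  counit_dom counit_cod : homdb.

Record lmodule := LModule {
  lm_ob : ob B;
  lact : mor B;
  lact_hom : lact ∷ H ⊗ lm_ob ⇒ lm_ob;
  lactA : lact ∘ (h ⊠ lact) = lact ∘ (mul H ⊠ idm lm_ob);
  lact1 : lact ∘ (one H ⊠ idm lm_ob) = idm lm_ob }.

Record rmodule := RModule {
  rm_ob : ob B;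
  ract : mor B;
  ract_hom : ract ∷ rm_ob ⊗ H ⇒ rm_ob;
  ractA : ract ∘ (ract ⊠ h) = ract ∘ (idm rm_ob ⊠ mul H);
  ract1 : ract ∘ (idm rm_ob ⊠ one H) = idm rm_ob }.

Lemma lact_dom x : dom (lact x) = H ⊗ lm_ob x.
Proof. by case: (lact_hom x). Qed.
Lemma lact_cod x : cod (lact x) = lm_ob x.
Proof. by case: (lact_hom x). Qed.
Lemma ract_dom x : dom (ract x) = rm_ob x ⊗ H.
Proof. by case: (ract_hom x). Qed.
Lemma ract_cod x : cod (ract x) = rm_ob x.
Proof. by case: (ract_hom x). Qed.

Hint Rewrite lact_dom lact_cod ract_dom ract_cod : homdb.

Lemma lmodule_eq (x y : lmodule) :
  lm_ob x = lm_ob y -> lact x = lact y -> x = y.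
Proof.
case: x y => [M r r1 r2 r3] [N s s1 s2 s3] /= e e'.
case: _ / e e' s1 s2 s3 => e'; case: _ / e' => *.
by congr LModule; apply: Prop_irrelevance.
Qed.

Lemma rmodule_eq (x y : rmodule) :
  rm_ob x = rm_ob y -> ract x = ract y -> x = y.
Proof.
case: x y => [M r r1 r2 r3] [N s s1 s2 s3] /= e e'.
case: _ / e e' s1 s2 s3 => e'; case: _ / e' => *.
by congr RModule; apply: Prop_irrelevance.
Qed.

Section LeftTensor.

Variables (x y : lmodule).
Local Notation M := (lm_ob x).
Local Notation N := (lm_ob y).

Definition lact_tens : mor B := (lact x ⊠ lact y)
  ∘ (h ⊠ τ H M ⊠ idm N) ∘ (comul H ⊠ idm (M ⊗ N)).

Local Definition lrho : mor B := (lact x ⊠ lact y) ∘ (h ⊠ τ H M ⊠ idm N).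

Local Lemma lrho_dom : dom lrho = H ⊗ H ⊗ M ⊗ N.
Proof. by rewrite /lrho; typ. Qed.
Local Lemma lrho_cod : cod lrho = M ⊗ N.
Proof. by rewrite /lrho; typ. Qed.
Hint Rewrite lrho_dom lrho_cod : homdb.

Lemma lact_tensE : lact_tens = lrho ∘ (comul H ⊠ idm (M ⊗ N)).
Proof. by rewrite /lact_tens /lrho compA //; typ. Qed.

Lemma lact_tens_hom : lact_tens ∷ H ⊗ (M ⊗ N) ⇒ M ⊗ N.
Proof. by rewrite lact_tensE; typ. Qed.

Local Lemma lrhoA : lrho ∘ (h ⊠ h ⊠ lrho) =
  lrho ∘ (((mul H ⊠ mul H) ∘ (h ⊠ τ H H ⊠ h)) ⊠ idm (M ⊗ N)).
Proof.
have eB : (h ⊠ τ H M ⊠ idm N) ∘ (h ⊠ h ⊠ (lact x ⊠ lact y)) =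
  (h ⊠ lact x ⊠ (h ⊠ lact y)) ∘ (h ⊠ τ H (H ⊗ M) ⊠ idm (H ⊗ N)).
  have -> : h ⊠ h ⊠ (lact x ⊠ lact y) = h ⊠ (h ⊠ lact x) ⊠ lact y.
    by rewrite !tensmA.
  have -> : h ⊠ lact x ⊠ (h ⊠ lact y) = h ⊠ (lact x ⊠ h) ⊠ lact y.
    by rewrite !tensmA.
  rewrite -!tens_comp; try typ.
  by rewrite (br_natr _ (lact_hom x)) !(comp_idl, comp_idr) //; typ.
have eC : (h ⊠ τ H M ⊠ idm N) ∘ (mul H ⊠ mul H ⊠ idm (M ⊗ N)) =
  (mul H ⊠ idm M ⊠ (mul H ⊠ idm N)) ∘ (h ⊠ h ⊠ τ (H ⊗ H) M ⊠ idm N).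
  have -> : mul H ⊠ mul H ⊠ idm (M ⊗ N) = mul H ⊠ (mul H ⊠ idm M) ⊠ idm N.
    by rewrite -tens_id !tensmA.
  have -> : mul H ⊠ idm M ⊠ (mul H ⊠ idm N) = mul H ⊠ (idm M ⊠ mul H) ⊠ idm N.
    by rewrite !tensmA.
  rewrite -!tens_comp; try typ.
  by rewrite (br_natl _ (mul_hom H)) tens_id !(comp_idl, comp_idr) //; typ.
have eD : (lact x ⊠ lact y) ∘ (h ⊠ lact x ⊠ (h ⊠ lact y)) =
  (lact x ⊠ lact y) ∘ (mul H ⊠ idm M ⊠ (mul H ⊠ idm N)).
  by rewrite -!tens_comp ?lactA //; typ.
have eE : (h ⊠ τ H (H ⊗ M) ⊠ idm (H ⊗ N)) ∘ (h ⊠ h ⊠ (h ⊠ τ H M ⊠ idm N)) =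
  (h ⊠ h ⊠ τ (H ⊗ H) M ⊠ idm N) ∘ (h ⊠ τ H H ⊠ h ⊠ idm (M ⊗ N)).
  have -> : h ⊠ τ H (H ⊗ M) ⊠ idm (H ⊗ N) = h ⊠ (τ H (H ⊗ M) ⊠ h) ⊠ idm N.
    by rewrite -tens_id !tensmA.
  have -> : h ⊠ h ⊠ (h ⊠ τ H M ⊠ idm N) = h ⊠ (h ⊠ h ⊠ τ H M) ⊠ idm N.
    by rewrite !tensmA.
  have -> : h ⊠ h ⊠ τ (H ⊗ H) M ⊠ idm N = h ⊠ (h ⊠ τ (H ⊗ H) M) ⊠ idm N.
    by rewrite !tensmA.
  have -> : h ⊠ τ H H ⊠ h ⊠ idm (M ⊗ N) = h ⊠ (τ H H ⊠ idm (H ⊗ M)) ⊠ idm N.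
    by rewrite -!tens_id !tensmA.
  rewrite -!tens_l; try typ; rewrite -!tens_r; try typ.
  congr (_ ⊠ _ ⊠ _).
  rewrite br_tensr br_tensl tens_l ?tens_r; try typ.
  rewrite !tensmA -!compA; try typ; congr (_ ∘ _).
  rewrite -(tensmA _ (idm M)) !tens_id.
  by rewrite tens_lr ?tens_rl //; typ.
have -> : lrho ∘ (h ⊠ h ⊠ lrho) = (lact x ⊠ lact y) ∘
    ((h ⊠ τ H M ⊠ idm N) ∘ (h ⊠ h ⊠ (lact x ⊠ lact y)))
    ∘ (h ⊠ h ⊠ (h ⊠ τ H M ⊠ idm N)).
  by rewrite /lrho tens_id tens_r -?tens_id; try typ; asr.
rewrite eB; asr; rewrite eE (comp_rw eD); try typ; asr.
rewrite /lrho tens_l; try typ; asr.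
by rewrite (comp_rw eC); try typ; asr.
Qed.

Lemma lact_tensA : lact_tens ∘ (h ⊠ lact_tens) =
  lact_tens ∘ (mul H ⊠ idm (M ⊗ N)).
Proof.
rewrite lact_tensE.
have := lrhoA; have := lrho_dom; have := lrho_cod.
move: lrho => rho rc rd rhoA; rewrite tens_r; last typ.
have e : (comul H ⊠ idm (M ⊗ N)) ∘ (h ⊠ rho) =
    (h ⊠ h ⊠ rho) ∘ (comul H ⊠ idm (H ⊗ H ⊗ (M ⊗ N))).
  by rewrite tens_id tens_lr ?tens_rl //; typ.
asr; rewrite (comp_rw e); try typ; asr.
rewrite (comp_rw rhoA); try typ; asr; congr (_ ∘ _).
rewrite -tens_l; last typ.
have -> : comul H ∘ mul H = ((mul H ⊠ mul H) ∘ (h ⊠ τ H H ⊠ h))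
    ∘ (comul H ⊠ comul H) by rewrite comul_mul compA //; typ.
rewrite [in RHS]tens_l; last typ; congr (_ ∘ _).
by rewrite tens_lr ?tensmA //; typ.
Qed.

Lemma lact_tens1 : lact_tens ∘ (one H ⊠ idm (M ⊗ N)) = idm (M ⊗ N).
Proof.
rewrite lact_tensE -compA; try typ.
rewrite -tens_l ?comul_one; last typ.
rewrite /lrho -compA; try typ.
have -> : one H ⊠ one H ⊠ idm (M ⊗ N) = one H ⊠ (one H ⊠ idm M) ⊠ idm N.
  by rewrite -tens_id !tensmA.
have -> : (h ⊠ τ H M ⊠ idm N) ∘ (one H ⊠ (one H ⊠ idm M) ⊠ idm N) =
    one H ⊠ idm M ⊠ (one H ⊠ idm N).
  rewrite -!tens_comp; try typ.
  rewrite (br_natl _ (one_hom H)) br_1x !(comp_idl, comp_idr); try typ.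
  by rewrite !tensmA.
by rewrite -tens_comp ?lact1 ?tens_id //; typ.
Qed.

Definition lmodule_tens : lmodule :=
  LModule lact_tens_hom lact_tensA lact_tens1.

End LeftTensor.

Definition lmodule_unit : lmodule.
Proof.
refine (@LModule tunit (counit H) _ _ _).
- by typ.
- by rewrite tensm1 counit_mul -(@tens_lr _ (counit H) (counit H) H tunit)
    ?tensm1 //; typ.
- by rewrite tensm1 counit_one.
Defined.

Lemma lact_tens_tensA (x y z : lmodule) :
  lact_tens x (lmodule_tens y z) = lact_tens (lmodule_tens x y) z.
Proof.
rewrite /lact_tens /= /lact_tens.
set M := lm_ob x; set N := lm_ob y; set P := lm_ob z.
have eL0 : lact x ⊠ ((lact y ⊠ lact z) ∘ (h ⊠ τ H N ⊠ idm P)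
      ∘ (comul H ⊠ idm (N ⊗ P))) =
    (lact x ⊠ (lact y ⊠ lact z)) ∘ (h ⊠ idm M ⊠ (h ⊠ τ H N ⊠ idm P))
      ∘ (h ⊠ idm M ⊠ (comul H ⊠ idm (N ⊗ P))).
  rewrite (tens_compr (lact_dom x)); last typ.
  by rewrite tens_id tens_r //; typ.
have eR0 : ((lact x ⊠ lact y) ∘ (h ⊠ τ H M ⊠ idm N)
      ∘ (comul H ⊠ idm (M ⊗ N))) ⊠ lact z =
    (lact x ⊠ (lact y ⊠ lact z)) ∘ (h ⊠ τ H M ⊠ idm N ⊠ idm (H ⊗ P))
      ∘ (comul H ⊠ idm (M ⊗ N) ⊠ idm (H ⊗ P)).
  rewrite (tens_compl (lact_dom z)); last typ.
  by rewrite tens_l ?tensmA //; typ.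
have eL1 : (h ⊠ idm M ⊠ (comul H ⊠ idm (N ⊗ P))) ∘ (h ⊠ τ H M ⊠ idm (N ⊗ P)) =
    (h ⊠ τ (H ⊗ H) M ⊠ idm (N ⊗ P)) ∘ (h ⊠ (comul H ⊠ idm M) ⊠ idm (N ⊗ P)).
  have -> : h ⊠ idm M ⊠ (comul H ⊠ idm (N ⊗ P)) =
      h ⊠ (idm M ⊠ comul H) ⊠ idm (N ⊗ P) by rewrite !tensmA.
  rewrite -!tens_l; try typ; rewrite -!tens_r; try typ.
  by rewrite (br_natl _ (comul_hom H)).
have eL2 : (h ⊠ (comul H ⊠ idm M) ⊠ idm (N ⊗ P)) ∘ (comul H ⊠ idm (M ⊗ (N ⊗ P)))
    = ((h ⊠ comul H) ∘ comul H) ⊠ idm (M ⊗ N ⊗ P).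
  rewrite tens_l; last typ.
  by rewrite -!tens_id !tensmA -?tensmA.
have eR1 : (comul H ⊠ idm (M ⊗ N) ⊠ idm (H ⊗ P)) ∘ (h ⊠ τ H (M ⊗ N) ⊠ idm P) =
    (h ⊠ (h ⊠ τ H (M ⊗ N)) ⊠ idm P) ∘ (comul H ⊠ idm (H ⊗ M ⊗ N ⊗ P)).
  have -> : comul H ⊠ idm (M ⊗ N) ⊠ idm (H ⊗ P) = comul H ⊠ idm (M ⊗ N ⊗ H ⊗ P).
    by rewrite -!tens_id !tensmA.
  have -> : h ⊠ (h ⊠ τ H (M ⊗ N)) ⊠ idm P =
      idm (H ⊗ H) ⊠ (τ H (M ⊗ N) ⊠ idm P) by rewrite -tens_id !tensmA.
  by rewrite -(tensmA h) tens_lr ?tens_rl //; typ.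
have eR2 : (comul H ⊠ idm (H ⊗ M ⊗ N ⊗ P)) ∘ (comul H ⊠ idm (M ⊗ N ⊗ P)) =
    ((comul H ⊠ h) ∘ comul H) ⊠ idm (M ⊗ N ⊗ P).
  by rewrite tens_l -?tens_id ?tensmA //; typ.
have eC : (h ⊠ idm M ⊠ (h ⊠ τ H N ⊠ idm P)) ∘ (h ⊠ τ (H ⊗ H) M ⊠ idm (N ⊗ P)) =
    (h ⊠ τ H M ⊠ idm N ⊠ idm (H ⊗ P)) ∘ (h ⊠ (h ⊠ τ H (M ⊗ N)) ⊠ idm P).
  have -> : h ⊠ idm M ⊠ (h ⊠ τ H N ⊠ idm P) = h ⊠ (idm (M ⊗ H) ⊠ τ H N) ⊠ idm P.
    by rewrite -tens_id !tensmA.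
  have -> : h ⊠ τ (H ⊗ H) M ⊠ idm (N ⊗ P) = h ⊠ (τ (H ⊗ H) M ⊠ idm N) ⊠ idm P.
    by rewrite -tens_id !tensmA.
  have -> : h ⊠ τ H M ⊠ idm N ⊠ idm (H ⊗ P) = h ⊠ (τ H M ⊠ idm (N ⊗ H)) ⊠ idm P.
    by rewrite -!tens_id !tensmA.
  rewrite -!tens_l; try typ; rewrite -!tens_r; try typ; congr (_ ⊠ _ ⊠ _).
  rewrite br_tensr br_tensl tens_l ?tens_r; try typ.
  rewrite compA; try typ; rewrite compA; try typ.
  rewrite !tensmA; congr (_ ∘ _).
  by rewrite -tensmA !tens_id tens_lr ?tens_rl //; typ.
rewrite eL0 eR0; asr; congr (_ ∘ _).
rewrite (comp_rw eL1); try typ; asr; rewrite eL2 (comp_rw eC); try typ; asr.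
rewrite (comp_rw eR1); try typ; asr.
by rewrite -[M ⊗ N ⊗ P]/(M ⊗ N ⊗ P) eR2 comulA.
Qed.

Definition lmod_structured : structured B.
Proof.
refine (@Structured B lmodule lm_ob
  (fun x y f => f ∘ lact x = lact y ∘ (h ⊠ f))
  lmodule_tens lmodule_unit _ _ _ _ _ _ _ _) => //.
- by move=> x; rewrite tens_id comp_idl ?comp_idr //; typ.
- move=> x y z f g [df cf] [dg cg] fP gP.
  rewrite -compA; [|typ|typ]; rewrite fP tens_r; last typ.
  by rewrite compA ?gP; try typ; asr.
- move=> x y x' y' f f' [df cf] [df' cf'] fP fP' /=.
  have e1 : (f ⊠ f') ∘ (lact x ⊠ lact x') =
      (lact y ⊠ lact y') ∘ (h ⊠ f ⊠ (h ⊠ f')).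
    by rewrite -!tens_comp ?fP ?fP' //; typ.
  have e2 : (h ⊠ f ⊠ (h ⊠ f')) ∘ (h ⊠ τ H (lm_ob x) ⊠ idm (lm_ob x')) =
      (h ⊠ τ H (lm_ob y) ⊠ idm (lm_ob y')) ∘ (h ⊠ (h ⊠ f) ⊠ f').
    have -> : h ⊠ f ⊠ (h ⊠ f') = h ⊠ (f ⊠ h) ⊠ f' by rewrite !tensmA.
    rewrite -!tens_comp; try typ.
    by rewrite (br_natr H (conj df cf)) !(comp_idl, comp_idr) //; typ.
  have e3 : (h ⊠ (h ⊠ f) ⊠ f') ∘ (comul H ⊠ idm (lm_ob x ⊗ lm_ob x')) =
      (comul H ⊠ idm (lm_ob y ⊗ lm_ob y')) ∘ (h ⊠ (f ⊠ f')).
    have -> : h ⊠ (h ⊠ f) ⊠ f' = idm (H ⊗ H) ⊠ (f ⊠ f').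
      by rewrite -tens_id !tensmA.
    by rewrite tens_rl ?tens_lr //; typ.
  rewrite /lact_tens (comp_rw e1); try typ; asr.
  by rewrite (comp_rw e2); try typ; asr; rewrite e3.
- move=> x y z; apply: lmodule_eq => /=; first by rewrite tensA.
  exact: lact_tens_tensA.
- move=> x; apply: lmodule_eq => /=; first by rewrite tens1x.
  rewrite /lact_tens /= br_x1 tens1x tens_id tens_id comp_idl; last typ.
  have -> : counit H ⊠ lact x = lact x ∘ (counit H ⊠ h ⊠ idm (lm_ob x)).
    rewrite -[in LHS](@tens_rl _ (counit H) (lact x) tunit (H ⊗ lm_ob x));
      try typ.
    by rewrite tens1m -tens_id tensmA.
  rewrite -compA; try typ.
  by rewrite -tens_l ?comul1h ?tens_id ?comp_idr //; typ.
- move=> x; apply: lmodule_eq => /=; first by rewrite tensx1.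
  rewrite /lact_tens /= tensx1 !tensm1.
  have -> : lact x ⊠ counit H =
      lact x ∘ (h ⊠ (idm (lm_ob x) ⊠ counit H)).
    rewrite -[in LHS](@tens_lr _ (lact x) (counit H) (H ⊗ lm_ob x) tunit);
      try typ.
    by rewrite tensm1 -tens_id tensmA.
  rewrite -compA; try typ.
  have e : (h ⊠ (idm (lm_ob x) ⊠ counit H)) ∘ (h ⊠ τ H (lm_ob x)) =
      h ⊠ counit H ⊠ idm (lm_ob x).
    rewrite -tens_r; last typ.
    by rewrite -(br_natl _ (counit_hom H)) br_1x comp_idl ?tensmA //; typ.
  rewrite (comp_rw e); try typ.
  by rewrite -tens_l ?comulh1 ?tens_id ?comp_idr //; typ.
Defined.

End Modules.

(* The reversed tensor product, used to transfer results on left modules to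
   right modules. *)
Section Reversal.

Definition rev_smcat (C : smcat) : smcat.
Proof.
refine (@SMCat C (fun X Y => Y ⊗ X) tunit (fun f g => g ⊠ f)
  _ (@tensx1 C) (@tens1x C) _ _ _ _ _ (@tensm1 C) (@tens1m C)).
- by move=> X Y Z; rewrite tensA.
- by move=> f g; exact: dom_tens.
- by move=> f g; exact: cod_tens.
- by move=> X Y; exact: tens_id.
- by move=> g f g' f' gf gf'; exact: tens_comp.
- by move=> f g h; rewrite tensmA.
Defined.

Variable B : brcat.

Definition rev_braiding : braiding (rev_smcat B).
Proof.
refine (@Braiding (rev_smcat B) (fun X Y => τ Y X) _ _ _ _ _).
- by move=> X Y; exact: (br_hom (@brd B) Y X).
- by move=> X Y; exact: (br_iso (@brd B) Y X).
- by move=> f g; exact: (br_nat (@brd B) g f).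
- by move=> X Y Z; exact: (br_tensl (@brd B) Z Y X).
- by move=> X Y Z; exact: (br_tensr (@brd B) Z Y X).
Defined.

Definition rev_brcat : brcat := BrCat rev_braiding.

Definition rev_bialgebra (H : bialgebra B) : bialgebra rev_brcat.
Proof.
refine (@Bialgebra rev_brcat (carrier H) (mul H) (one H) (comul H) (counit H)
  (mul_hom H) (one_hom H) (comul_hom H) (counit_hom H)
  _ (mulh1 H) (mul1h H) _ (comulh1 H) (comul1h H) _ (comul_one H)
  (counit_mul H) (counit_one H)).
- by rewrite /= mulA.
- by rewrite /= comulA.
- by rewrite /= comul_mul tensmA.
Defined.

End Reversal.

Section RightModules.

Variables (B : brcat) (H : bialgebra B).
Local Notation h := (idm (carrier H)).

Hint Rewrite br_dom br_cod mul_dom mul_cod one_dom one_cod comul_dom comul_cod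
  counit_dom counit_cod ract_dom ract_cod : homdb.

Definition rev_rmodule (x : rmodule H) : lmodule (rev_bialgebra H) :=
  @LModule _ (rev_bialgebra H) (rm_ob x) (ract x) (ract_hom x) (ractA x)
    (ract1 x).

Section RightTensor.

Variables (x y : rmodule H).
Local Notation M := (rm_ob x).
Local Notation N := (rm_ob y).

Definition ract_tens : mor B := (ract x ⊠ ract y)
  ∘ (idm M ⊠ τ N H ⊠ h) ∘ (idm (M ⊗ N) ⊠ comul H).

Lemma ract_tensE : ract_tens = lact_tens (rev_rmodule y) (rev_rmodule x).
Proof. by rewrite /ract_tens /lact_tens /= tensmA. Qed.

Lemma ract_tens_hom : ract_tens ∷ M ⊗ N ⊗ H ⇒ M ⊗ N.
Proof. by rewrite /ract_tens; typ. Qed.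

Lemma ract_tensA : ract_tens ∘ (ract_tens ⊠ h) =
  ract_tens ∘ (idm (M ⊗ N) ⊠ mul H).
Proof.
by rewrite ract_tensE; exact: (lact_tensA (rev_rmodule y) (rev_rmodule x)).
Qed.

Lemma ract_tens1 : ract_tens ∘ (idm (M ⊗ N) ⊠ one H) = idm (M ⊗ N).
Proof.
by rewrite ract_tensE; exact: (lact_tens1 (rev_rmodule y) (rev_rmodule x)).
Qed.

Definition rmodule_tens : rmodule H :=
  RModule ract_tens_hom ract_tensA ract_tens1.

End RightTensor.

Lemma rev_rmodule_tens (x y : rmodule H) :
  rev_rmodule (rmodule_tens x y) = lmodule_tens (rev_rmodule y) (rev_rmodule x).
Proof. by apply: lmodule_eq => //=; exact: ract_tensE. Qed.

Definition rmodule_unit : rmodule H.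
Proof.
refine (@RModule B H tunit (counit H) _ _ _).
- by typ.
- by rewrite tens1m counit_mul -(@tens_rl _ (counit H) (counit H) tunit H)
    ?tens1m //; typ.
- by rewrite tens1m counit_one.
Defined.

Local Notation L := (lmod_structured (rev_bialgebra H)).

Lemma rev_rmodule_unit : rev_rmodule rmodule_unit = sunit L.
Proof. exact: lmodule_eq. Qed.

Definition rmod_structured : structured B.
Proof.
refine (@Structured B (rmodule H) (@rm_ob B H)
  (fun x y f => f ∘ ract x = ract y ∘ (f ⊠ h))
  rmodule_tens rmodule_unit _ _ _ _ _ _ _ _) => //.
- by move=> x; exact: (smor_id (s := L) (rev_rmodule x)).
- move=> x y z f g; exact: (smor_comp (s := L) (x := rev_rmodule x)
    (y := rev_rmodule y) (z := rev_rmodule z)).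
- move=> x y x' y' f f' fh fh' fP fP' /=; rewrite !ract_tensE.
  exact: (smor_tens (s := L) (x := rev_rmodule x') (y := rev_rmodule y')
    (x' := rev_rmodule x) (y' := rev_rmodule y) fh' fh fP' fP).
- move=> x y z; apply: rmodule_eq => /=; first by rewrite tensA.
  rewrite !ract_tensE !rev_rmodule_tens.
  have := stensA (s := L) (rev_rmodule z) (rev_rmodule y) (rev_rmodule x).
  by move=> /(congr1 (@lact _ _)) /= ->.
- move=> x; apply: rmodule_eq => /=; first by rewrite tens1x.
  rewrite ract_tensE rev_rmodule_unit.
  by have /(congr1 (@lact _ _)) := stensx1 (s := L) (rev_rmodule x).
- move=> x; apply: rmodule_eq => /=; first by rewrite tensx1.
  rewrite ract_tensE rev_rmodule_unit.
  by have /(congr1 (@lact _ _)) := stens1x (s := L) (rev_rmodule x).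
Defined.

End RightModules.

#[export] Hint Rewrite hb_dom hb_cod hb'_dom hb'_cod br_dom br_cod inv_br_dom
  inv_br_cod mul_dom mul_cod one_dom one_cod comul_dom comul_cod counit_dom
  counit_cod lact_dom lact_cod ract_dom ract_cod : homdb.

Definition lmod (B : brcat) (H : bialgebra B) : smcat :=
  structured_smcat (lmod_structured H).

Definition rmod (B : brcat) (H : bialgebra B) : smcat :=
  structured_smcat (rmod_structured H).

Record strong_functor (C D : smcat) := StrongFunctor {
  fob :> ob C -> ob D;
  fmor : mor C -> mor D;
  fmor_hom : forall f, fmor f ∷ fob (dom f) ⇒ fob (cod f);
  fmor_id : forall X, fmor (idm X) = idm (fob X);
  fmor_comp : forall g f, dom g = cod f -> fmor (g ∘ f) = fmor g ∘ fmor f;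
  f2 : ob C -> ob C -> mor D;
  f0 : mor D;
  f2_hom : forall X Y, f2 X Y ∷ fob X ⊗ fob Y ⇒ fob (X ⊗ Y);
  f0_hom : f0 ∷ tunit ⇒ fob tunit;
  f2_iso : forall X Y, is_iso (f2 X Y);
  f0_iso : is_iso f0;
  f2_nat : forall f g, fmor (f ⊠ g) ∘ f2 (dom f) (dom g) =
    f2 (cod f) (cod g) ∘ (fmor f ⊠ fmor g);
  f2A : forall X Y Z, f2 (X ⊗ Y) Z ∘ (f2 X Y ⊠ idm (fob Z)) =
    f2 X (Y ⊗ Z) ∘ (idm (fob X) ⊠ f2 Y Z);
  f21x : forall X, f2 tunit X ∘ (f0 ⊠ idm (fob X)) = idm (fob X);
  f2x1 : forall X, f2 X tunit ∘ (idm (fob X) ⊠ f0) = idm (fob X) }.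

Definition braided (C D : brcat) (F : strong_functor C D) : Prop :=
  forall X Y, fmor F (τ X Y) ∘ f2 F X Y = f2 F Y X ∘ τ (F X) (F Y).

Definition braided_isomorphic (C D : brcat) : Prop :=
  exists F : strong_functor C D,
    [/\ braided F, bijective F & bijective (fmor F)].

Section Coend.

Variables (C : smcat) (d : autonomous C).

(* The left dual ∨f : ∨Y -> ∨X of an arrow f : X -> Y. *)
Definition ldual (f : mor C) : mor C :=
  (ldev d (cod f) ⊠ idm (ld d (dom f)))
    ∘ (idm (ld d (cod f)) ⊠ f ⊠ idm (ld d (dom f)))
    ∘ (idm (ld d (cod f)) ⊠ ldcoev d (dom f)).

(* The canonical isomorphism ∨(X ⊗ Y) -> ∨Y ⊗ ∨X. *)
Definition ld_tens (X Y : ob C) : mor C :=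
  (ldev d (X ⊗ Y) ⊠ idm (ld d Y ⊗ ld d X))
    ∘ (idm (ld d (X ⊗ Y))
       ⊠ ((idm X ⊠ ldcoev d Y ⊠ idm (ld d X)) ∘ ldcoev d X)).

Definition dinatural (W : ob C) (k : ob C -> mor C) : Prop :=
  (forall Y, k Y ∷ ld d Y ⊗ Y ⇒ W) /\
  (forall f, k (dom f) ∘ (ldual f ⊠ idm (dom f)) =
     k (cod f) ∘ (idm (ld d (cod f)) ⊠ f)).

Record coend := Coend {
  coend_ob :> ob C;
  coend_in : ob C -> mor C;
  coend_in_dinatural : dinatural coend_ob coend_in;
  coend_universal : forall W k, dinatural W k ->
    exists! r, r ∷ coend_ob ⇒ W /\ (forall Y, r ∘ coend_in Y = k Y) }.

End Coend.

Section Double.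

Variables (B : brcat) (d : autonomous B) (C : coend d) (A : hopf B).
Local Notation "'id" := idm (at level 0).
Local Notation "∨ X" := (ld d X) (at level 30, right associativity).

Definition ZA : ob B := ∨ A ⊗ C.

Definition T (X : ob B) : ob B := X ⊗ A.
Definition Tm (f : mor B) : mor B := f ⊠ 'id A.
Definition T2 (X Y : ob B) : mor B :=
  ('id X ⊠ τ Y A ⊠ 'id A) ∘ ('id (X ⊗ Y) ⊠ comul A).
Definition T3 (X Y Z : ob B) : mor B := ('id (T X) ⊠ T2 Y Z) ∘ T2 X (Y ⊗ Z).
Definition T0 : mor B := counit A.
Definition Tmu (X : ob B) : mor B := 'id X ⊠ mul A.

(* Left duals are chosen independently for all objects; the isomorphisms
   ∨(X ⊗ A) -> ∨A ⊗ ∨X occur in [iZ] and in the left antipode [sl]. *)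
Definition iZ (Y : ob B) : mor B :=
  ('id (∨ A) ⊠ coend_in C Y) ∘ (ld_tens d Y A ⊠ 'id Y).

Definition delta (Y : ob B) : mor B :=
  ('id (Y ⊗ A) ⊠ iZ Y) ∘ (ldcoev d (Y ⊗ A) ⊠ 'id Y).

Definition partial (X Y : ob B) : mor B :=
  (τ X (Y ⊗ A) ⊠ 'id ZA) ∘ ('id X ⊠ delta Y).

Definition sl (X : ob B) : mor B :=
  (ldev d A ⊠ 'id (∨ X)) ∘ ('id (∨ A) ⊠ τ (∨ X) A)
    ∘ ('id (∨ A ⊗ ∨ X) ⊠ inv (antipode A)) ∘ (ld_tens d X A ⊠ 'id A).

Definition jay (X Y : ob B) : mor B :=
  (ldev d (T Y) ⊠ 'id (X ⊗ ZA)) ∘ ('id (∨ (T Y)) ⊠ partial X Y).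

(* The equations determining the Hopf algebra structure of Z(A). *)
Record centralizer_structure (Z : hopf B) : Prop := CentralizerStructure {
  cz_ob : carrier Z = ZA;
  cz_mul : forall X Y,
    ('id (T X ⊗ T Y) ⊠ mul Z) ∘ ('id (T X) ⊠ τ ZA (T Y) ⊠ 'id ZA)
      ∘ (delta X ⊠ delta Y) = (T2 X Y ⊠ 'id ZA) ∘ delta (X ⊗ Y);
  cz_one : one Z = (T0 ⊠ 'id ZA) ∘ delta tunit;
  cz_comul : forall X, ('id (T X) ⊠ comul Z) ∘ delta X =
    ('id X ⊠ mul A ⊠ 'id (ZA ⊗ ZA)) ∘ (delta (T X) ⊠ 'id ZA) ∘ delta X;
  cz_counit : forall X, ('id (T X) ⊠ counit Z) ∘ delta X = 'id X ⊠ one A }.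

(* [idm X ⊠ Omega] is the canonical distributive law of the Hopf monad T. *)
Record distributive_law (Omega : mor B) : Prop := DistributiveLaw {
  dl_hom : Omega ∷ ZA ⊗ A ⇒ A ⊗ ZA;
  dl_eq : forall X Y, ('id X ⊠ Omega) ∘ Tm (jay X Y) =
    jay (T X) (T Y)
      ∘ ((ldual d (Tmu Y) ∘ sl (T Y) ∘ Tm (ldual d (Tmu Y)))
         ⊠ 'id (T X ⊗ T Y))
      ∘ T3 (∨ (T Y)) X Y }.

Record double_structure (Z : hopf B) (Omega : mor B) (D : hopf B) : Prop :=
  DoubleStructure {
  ds_ob : carrier D = A ⊗ ZA;
  ds_mul : mul D = (mul A ⊠ mul Z) ∘ ('id A ⊠ Omega ⊠ 'id ZA);
  ds_one : one D = one A ⊠ one Z;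
  ds_comul : comul D = ('id A ⊠ τ A ZA ⊠ 'id ZA) ∘ (comul A ⊠ comul Z);
  ds_counit : counit D = counit A ⊠ counit Z }.

Section Braidings.

Variables (Z D : hopf B).

Definition Rmx (X Y : ob B) : mor B :=
  ('id (Y ⊗ A) ⊠ one Z ⊠ 'id X ⊠ one A ⊠ 'id ZA) ∘ partial X Y.

(* (s ⊗ r) R_{M,N}, where r and s are actions M ⊗ D -> M and N ⊗ D -> N. *)
Definition R_braid (M : ob B) (r : mor B) (N : ob B) (s : mor B) : mor B :=
  (s ⊠ r) ∘ Rmx M N.

(* The action of the right D-module F(M, r). *)
Definition F_act (x : lmodule D) : mor B :=
  lact x ∘ τ (lm_ob x) D ∘ ('id (lm_ob x) ⊠ antipode D).

Definition R_braiding (c : braiding (rmod D)) : Prop :=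
  forall x y : rmodule D,
    arr (c x y : sarr (rmod_structured D)) =
      R_braid (rm_ob x) (ract x) (rm_ob y) (ract y).

Definition R_braiding' (c : braiding (lmod D)) : Prop :=
  forall x y : lmodule D,
    arr (c x y : sarr (lmod_structured D)) =
      τ (lm_ob x) (lm_ob y)
        ∘ R_braid (lm_ob y) (F_act y) (lm_ob x) (F_act x)
        ∘ inv (τ (lm_ob y) (lm_ob x)).

End Braidings.

(* The quasitriangular Hopf algebra D(A): the Hopf algebra Z(A), the canonical
   distributive law, the Hopf algebra structure on A ⊗ Z(A), and the braidings
   of its categories of right and left modules.  All data are uniquely
   determined by the equations. *)
Record double := Double {
  dbl_Z : hopf B;
  dbl_Z_structure : centralizer_structure dbl_Z;
  dbl_Omega : mor B;
  dbl_Omega_law : distributive_law dbl_Omega;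
  dbl_hopf :> hopf B;
  dbl_structure : double_structure dbl_Z dbl_Omega dbl_hopf;
  dbl_rbraiding : braiding (rmod dbl_hopf);
  dbl_rbraidingE : R_braiding dbl_Z dbl_rbraiding;
  dbl_lbraiding : braiding (lmod dbl_hopf);
  dbl_lbraidingE : R_braiding' dbl_Z dbl_lbraiding }.

Definition double_rmod (D : double) : brcat := BrCat (dbl_rbraiding D).
Definition double_lmod (D : double) : brcat := BrCat (dbl_lbraiding D).

Lemma antipode_dom (H : hopf B) : dom (antipode H) = H.
Proof. by case: (antipode_hom H). Qed.
Lemma antipode_cod (H : hopf B) : cod (antipode H) = H.
Proof. by case: (antipode_hom H). Qed.
Lemma inv_antipode_dom (H : hopf B) : dom (inv (antipode H)) = H.
Proof. by case: (invP (antipode_iso H)) => ->; rewrite antipode_cod. Qed.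
Lemma inv_antipode_cod (H : hopf B) : cod (inv (antipode H)) = H.
Proof. by case: (invP (antipode_iso H)) => _ ->; rewrite antipode_dom. Qed.
Lemma ldev_dom X : dom (ldev d X) = ∨ X ⊗ X.
Proof. by case: (ldev_hom d X). Qed.
Lemma ldev_cod X : cod (ldev d X) = tunit.
Proof. by case: (ldev_hom d X). Qed.
Lemma ldcoev_dom X : dom (ldcoev d X) = tunit.
Proof. by case: (ldcoev_hom d X). Qed.
Lemma ldcoev_cod X : cod (ldcoev d X) = X ⊗ ∨ X.
Proof. by case: (ldcoev_hom d X). Qed.
Lemma coend_in_dom X : dom (coend_in C X) = ∨ X ⊗ X.
Proof. by case: (coend_in_dinatural C) => /(_ X) []. Qed.
Lemma coend_in_cod X : cod (coend_in C X) = C.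
Proof. by case: (coend_in_dinatural C) => /(_ X) []. Qed.

Hint Rewrite antipode_dom antipode_cod inv_antipode_dom inv_antipode_cod
  ldev_dom ldev_cod ldcoev_dom ldcoev_cod coend_in_dom coend_in_cod : homdb.

(* Since [comp] is total, an ill-typed composite would not be rejected; the
   following lemmas show that the composites above are well typed. *)

Lemma ldual_hom f : ldual d f ∷ ∨ (cod f) ⇒ ∨ (dom f).
Proof. by rewrite /ldual; typ. Qed.

Lemma ld_tens_hom X Y : ld_tens d X Y ∷ ∨ (X ⊗ Y) ⇒ ∨ Y ⊗ ∨ X.
Proof. by rewrite /ld_tens; typ. Qed.

Lemma T2_hom X Y : T2 X Y ∷ T (X ⊗ Y) ⇒ T X ⊗ T Y.
Proof. by rewrite /T2 /T; typ. Qed.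

Lemma T3_hom X Y Z : T3 X Y Z ∷ T (X ⊗ Y ⊗ Z) ⇒ T X ⊗ T Y ⊗ T Z.
Proof. by rewrite /T3 /T2 /T; typ. Qed.

Lemma Tmu_hom X : Tmu X ∷ T (T X) ⇒ T X.
Proof. by rewrite /Tmu /T; typ. Qed.

Lemma iZ_hom Y : iZ Y ∷ ∨ (T Y) ⊗ Y ⇒ ZA.
Proof. by rewrite /iZ /ZA /T; move: (ld_tens_hom Y A) => ?; typ. Qed.

Lemma delta_hom Y : delta Y ∷ Y ⇒ T Y ⊗ ZA.
Proof. by rewrite /delta; move: (iZ_hom Y) => e; rewrite /T in e *; typ. Qed.

Lemma partial_hom X Y : partial X Y ∷ X ⊗ Y ⇒ T Y ⊗ X ⊗ ZA.
Proof. by rewrite /partial; move: (delta_hom Y) => e; rewrite /T in e *; typ. Qed.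

Lemma sl_hom X : sl X ∷ T (∨ (T X)) ⇒ ∨ X.
Proof. by rewrite /sl /T; move: (ld_tens_hom X A) => ?; typ. Qed.

Lemma jay_hom X Y : jay X Y ∷ ∨ (T Y) ⊗ X ⊗ Y ⇒ X ⊗ ZA.
Proof. by rewrite /jay; move: (partial_hom X Y) => e; rewrite /T in e *; typ. Qed.

Lemma Omega_lhs_hom (Omega : mor B) X Y : Omega ∷ ZA ⊗ A ⇒ A ⊗ ZA ->
  ('id X ⊠ Omega) ∘ Tm (jay X Y)
    ∷ T (∨ (T Y) ⊗ X ⊗ Y) ⇒ T X ⊗ ZA.
Proof.
by rewrite /Tm /T => Oh; move: (jay_hom X Y) => jh; rewrite /T in jh; typ.
Qed.

Lemma Omega_rhs_hom X Y : jay (T X) (T Y)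
    ∘ ((ldual d (Tmu Y) ∘ sl (T Y) ∘ Tm (ldual d (Tmu Y))) ⊠ 'id (T X ⊗ T Y))
    ∘ T3 (∨ (T Y)) X Y ∷ T (∨ (T Y) ⊗ X ⊗ Y) ⇒ T X ⊗ ZA.
Proof.
have jh := jay_hom (T X) (T Y); have sh := sl_hom (T Y).
have th := T3_hom (∨ (T Y)) X Y.
have mh : ldual d (Tmu Y) ∷ ∨ (T Y) ⇒ ∨ (T (T Y)).
  by case: (Tmu_hom Y) (ldual_hom (Tmu Y)) => -> ->.
rewrite /Tm; set a := ldual d (Tmu Y) in mh *; set b := sl _ in sh *.
by rewrite /T in jh sh th mh *; typ.
Qed.

Lemma Rmx_hom (Z : hopf B) X Y : carrier Z = ZA ->
  Rmx Z X Y ∷ X ⊗ Y ⇒ Y ⊗ (A ⊗ ZA) ⊗ X ⊗ (A ⊗ ZA).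
Proof.
move=> eZ; rewrite /Rmx; move: (partial_hom X Y) => ph; rewrite /T in ph.
by have oc := one_cod Z; rewrite eZ in oc; typ.
Qed.

End Double.

(* Main.v *)
(* The universal property of (Z(A), delta) replaces all computations with the
   coend: an arrow Z(A) ⊗ V -> W amounts to a natural family
   Y ⊗ V -> Y ⊗ A ⊗ W.  It yields the Hopf algebra Z(A), whose antipode and
   inverse antipode come from the left and right duals, and turns the equation of
   the canonical distributive law, after bending the dual of Y, into
     a h_1 ⊗ Omega(z ⊗ h_2) = h_2 a ⊗ h_1 ⊗ z   for delta(y) = y ⊗ a ⊗ z
   in the symmetric case; the coproduct of A allows to solve it for Omega, and
   the axioms of a distributive law follow by uniqueness.

   A right D(A)-module is a right A-module M with a compatible action of Z(A).
   By the universal property the actions of Z(A) are the natural families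
   M ⊗ Y -> Y ⊗ A ⊗ M, that is, evaluating on free modules Y ⊗ A, the half
   braidings of M in the category of right A-modules.  This is the first
   isomorphism, and it is strict.  The antipode exchanges left and right
   modules and reverses the tensor product, up to the braiding of B; composed
   with the braiding of D(A)-modules this gives a monoidal isomorphism between
   right and left D(A)-modules, and transporting the first isomorphism gives
   the third one.  Inverting half braidings gives the last one. *)

From mathcomp Require Import ssreflect ssrfun ssrbool eqtype ssrnat seq.
From mathcomp Require Import boolp.
Require Import Defs.

Set Implicit Arguments.
Unset Strict Implicit.
Unset Printing Implicit Defensive.
Local Open Scope mon_scope.

(** * Words of string diagrams *)

(** The braiding is not symmetric, so a computation with elements becomes an equation of diagrams in
    which every crossing has a sign and every use of an axiom is prepared by isotopies. Such
    equations are checked by reflection. An arrow is flattened to a word of elementary layers, an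
    untrusted search finds rewriting steps from a given list of axioms, and only the execution of
    these steps is proved sound. The signs also account for the inverse antipodes: the reversed
    product [mul ∘ inv τ] has the inverse antipode as its antipode. Conversely, an antipode is shown
    to be invertible by exhibiting an antipode for the reversed product; this is done for Z(A) and
    for the double. Z(A) behaves like a dual of A: its product comes from the coproduct of A and its
    coproduct from the product, and each of its axioms reduces to the dual axiom of A. Passing from
    left to right modules reverses tensor products, and τ alone does not restore the order; the
    second isomorphism is therefore built with a nontrivial monoidal structure. In the third one the
    order is reversed a second time, by the passage between half braidings on the two sides, the
    crossings cancel and strictness returns. *)

Fixpoint leb (m n : nat) : bool :=
  match m, n with 0, _ => true | m'.+1, 0 => false | m'.+1, n'.+1 => leb m' n' end.

Lemma lebE m n : leb m n = (m <= n).
Proof. by elim: m n => [|m IH] [|n] //=; rewrite IH. Qed.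

Fixpoint eqs (s t : seq nat) : bool :=
  match s, t with
  | [::], [::] => true
  | x :: s', y :: t' => eqn x y && eqs s' t'
  | _, _ => false
  end.

Lemma eqsP s t : eqs s t -> s = t.
Proof. by elim: s t => [|x s IH] [|y t] //= /andP[/eqnP-> /IH->]. Qed.

Lemma eqs_refl s : eqs s s.
Proof. by elim: s => //= x s ->; rewrite andbT; apply/eqnP. Qed.

(** For two layers acting at disjoint places on the same strands, [m] is the list of strands between
    them. *)
Lemma cat_split (T : Type) (a b c e : seq T) :
  a ++ b = c ++ e -> size a <= size c -> exists m, c = a ++ m /\ b = m ++ e.
Proof.
elim: a c => [|x a IH] [|y c] //=; first by move=> ->; exists [::].
  by move=> ->; exists (y :: c).
by move=> [-> /IH{}IH] /IH [m [-> ->]]; exists m.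
Qed.

(* The arguments are the number of a box, resp. the numbers of the objects on
   the two strands of a positive or inverse crossing. *)
Inductive gen := Box of nat | Crs of nat & nat | CrsV of nat & nat.

Definition eqg (g h : gen) : bool :=
  match g, h with
  | Box i, Box j => eqn i j
  | Crs i j, Crs i' j' => eqn i i' && eqn j j'
  | CrsV i j, CrsV i' j' => eqn i i' && eqn j j'
  | _, _ => false
  end.

Lemma eqgP g h : eqg g h -> g = h.
Proof.
case: g h => [i|i j|i j] [i'|i' j'|i' j'] //= => [/eqnP->|/andP[/eqnP-> /eqnP->]|].
- by [].
- by [].
- by move=> /andP[/eqnP-> /eqnP->].
Qed.

(* The number of strands on the left of a generator, and the generator. *)
Definition layer := (nat * gen)%type.
Definition word := seq layer.

Fixpoint eqw (v w : word) : bool :=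
  match v, w with
  | [::], [::] => true
  | (k, g) :: v', (l, h) :: w' => [&& eqn k l, eqg g h & eqw v' w']
  | _, _ => false
  end.

Lemma eqwP v w : eqw v w -> v = w.
Proof.
by elim: v w => [|[k g] v IH] [|[l h] w] //= /and3P[/eqnP-> /eqgP-> /IH->].
Qed.

Inductive oexp := OUnit | OAt of nat | OTens of oexp & oexp.

Fixpoint onf (x : oexp) : seq nat :=
  match x with OUnit => [::] | OAt n => [:: n] | OTens x y => onf x ++ onf y end.

Inductive mexp :=
  | MId of oexp | MBox of nat | MBr of oexp & oexp | MBrV of oexp & oexp
  | MComp of mexp & mexp | MTens of mexp & mexp.

Definition shift (k : nat) (w : word) : word := [seq (k + l.1, l.2) | l <- w].

(** The order of the elementary crossings is the one of the hexagon axioms [br_tensr] and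
    [br_tensl]: the last strand of [X] crosses first. The inverse versions [crs1V] and [crsV] list
    the inverse crossings in the opposite order. *)
Fixpoint crs1 (k x : nat) (Y : seq nat) : word :=
  if Y is y :: Y' then (k, Crs x y) :: crs1 k.+1 x Y' else [::].
Fixpoint crs (k : nat) (X Y : seq nat) : word :=
  if X is x :: X' then crs k.+1 X' Y ++ crs1 k x Y else [::].

Fixpoint crs1V (k x : nat) (Y : seq nat) : word :=
  if Y is y :: Y' then rcons (crs1V k.+1 x Y') (k, CrsV x y) else [::].
Fixpoint crsV (k : nat) (X Y : seq nat) : word :=
  if X is x :: X' then crs1V k x Y ++ crsV k.+1 X' Y else [::].

Section Arities.

Variable ar : seq (seq nat * seq nat).

Definition gdom (g : gen) : seq nat :=
  match g with
  | Box i => (nth ([::], [::]) ar i).1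
  | Crs i j => [:: i; j] | CrsV i j => [:: j; i] end.
Definition gcod (g : gen) : seq nat :=
  match g with
  | Box i => (nth ([::], [::]) ar i).2
  | Crs i j => [:: j; i] | CrsV i j => [:: i; j] end.
Definition gok (g : gen) : bool :=
  if g is Box i then leb i.+1 (size ar) else true.

Definition lcod (X : seq nat) (l : layer) : seq nat :=
  take l.1 X ++ gcod l.2 ++ drop (l.1 + size (gdom l.2)) X.
Definition lok (X : seq nat) (l : layer) : bool :=
  [&& gok l.2, leb l.1 (size X) & eqs (take (size (gdom l.2)) (drop l.1 X)) (gdom l.2)].

Fixpoint wcod (X : seq nat) (w : word) : seq nat :=
  if w is l :: w' then wcod (lcod X l) w' else X.
Fixpoint wok (X : seq nat) (w : word) : bool :=
  if w is l :: w' then lok X l && wok (lcod X l) w' else true.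

Lemma lokP X l : lok X l -> exists L R,
  [/\ X = L ++ gdom l.2 ++ R, size L = l.1 & gok l.2].
Proof.
case: l => k g /and3P[/= ok]; rewrite lebE => kX /eqsP e.
exists (take k X), (drop (k + size (gdom g)) X); split=> //.
  rewrite -[LHS](cat_take_drop k); congr (_ ++ _).
  by rewrite -[LHS](cat_take_drop (size (gdom g))) e drop_drop addnC.
by rewrite size_takel.
Qed.

Lemma lcodE L R g : lcod (L ++ gdom g ++ R) (size L, g) = L ++ gcod g ++ R.
Proof.
by rewrite /lcod /= take_size_cat // addnC -drop_drop drop_size_cat // drop_size_cat.
Qed.

Lemma lokE L R g : gok g -> lok (L ++ gdom g ++ R) (size L, g).
Proof.
move=> ok; rewrite /lok ok lebE size_cat leq_addr /= drop_size_cat //.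
by rewrite take_size_cat // eqs_refl.
Qed.

Lemma wcod_cat X v w : wcod X (v ++ w) = wcod (wcod X v) w.
Proof. by elim: v X => //=. Qed.

Lemma wok_cat X v w : wok X (v ++ w) = wok X v && wok (wcod X v) w.
Proof. by elim: v X => //= l v IH X; rewrite IH andbA. Qed.

Lemma lok_whisker L R X l : lok X l -> 
  lok (L ++ X ++ R) (size L + l.1, l.2) /\
  lcod (L ++ X ++ R) (size L + l.1, l.2) = L ++ lcod X l ++ R.
Proof.
case: l => k g /lokP [L' [R' [-> /= <- ok]]].
have -> : L ++ (L' ++ gdom g ++ R') ++ R = (L ++ L') ++ gdom g ++ (R' ++ R).
  by rewrite !catA.
by rewrite -size_cat lokE // lcodE lcodE !catA.
Qed.

Lemma wok_whisker L R X w : wok X w ->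
  wok (L ++ X ++ R) (shift (size L) w) /\
  wcod (L ++ X ++ R) (shift (size L) w) = L ++ wcod X w ++ R.
Proof.
elim: w X => //= l w IH X /andP[lX wX].
have [ok e] := lok_whisker L R lX.
by rewrite ok e; have [-> ->] := IH _ wX.
Qed.

Fixpoint mtyp (e : mexp) : option (seq nat * seq nat) :=
  match e with
  | MId x => Some (onf x, onf x)
  | MBox i => if leb i.+1 (size ar) then Some (nth ([::], [::]) ar i) else None
  | MBr x y => Some (onf x ++ onf y, onf y ++ onf x)
  | MBrV x y => Some (onf y ++ onf x, onf x ++ onf y)
  | MComp g f =>
      match mtyp g, mtyp f with
      | Some (a, b), Some (a', b') => if eqs a b' then Some (a', b) else None
      | _, _ => None
      end
  | MTens f g =>
      match mtyp f, mtyp g with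
      | Some (a, b), Some (a', b') => Some (a ++ a', b ++ b')
      | _, _ => None
      end
  end.

Definition mcod_size (e : mexp) : nat :=
  if mtyp e is Some (_, b) then size b else 0.

Fixpoint flat (e : mexp) : word :=
  match e with
  | MId _ => [::]
  | MBox i => [:: (0, Box i)]
  | MBr x y => crs 0 (onf x) (onf y)
  | MBrV x y => crsV 0 (onf x) (onf y)
  | MComp g f => flat f ++ flat g
  | MTens f g => flat f ++ shift (mcod_size f) (flat g)
  end.

(* [true]: the second layer lies to the right of the first one. *)
Definition swap2 (l m : layer) (b : bool) : option (layer * layer) :=
  let: (k, g) := l in let: (k', g') := m in
  if b then
    if leb (k + size (gcod g)) k'
    then Some ((k' - size (gcod g) + size (gdom g), g'), (k, g)) else None
  else
    if leb (k' + size (gdom g')) k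
    then Some ((k', g'), (k - size (gdom g') + size (gcod g'), g)) else None.

Fixpoint swap (n : nat) (b : bool) (w : word) : option word :=
  match n with
  | 0 => if w is l :: m :: w' then
           if swap2 l m b is Some (m', l') then Some (m' :: l' :: w') else None
         else None
  | n'.+1 => if w is l :: w' then
           if swap n' b w' is Some v then Some (l :: v) else None
         else None
  end.

Record rule := Rule { rX : seq nat; rl : word; rr : word }.

Fixpoint wprefix (v w : word) : option word :=
  match v, w with
  | [::], _ => Some w
  | (k, g) :: v', (l, h) :: w' =>
      if eqn k l && eqg g h then wprefix v' w' else None
  | _, _ => None
  end.

(** The strands are compared with [rX] too: a left-hand side may be empty, as when a pair of inverse
    crossings is inserted, and then the layers do not determine the type. *)
Definition apply_rule (r : rule) (k : nat) (X : seq nat) (w : word) : option word :=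
  if leb k (size X) && eqs (take (size (rX r)) (drop k X)) (rX r) then
    if wprefix (shift k (rl r)) w is Some v
    then Some (shift k (rr r) ++ v) else None
  else None.

Fixpoint apply_at (r : rule) (n k : nat) (X : seq nat) (w : word) : option word :=
  match n, w with
  | 0, _ => apply_rule r k X w
  | n'.+1, l :: w' =>
      if apply_at r n' k (lcod X l) w' is Some v then Some (l :: v) else None
  | _, _ => None
  end.

(* Naturality of the braiding: [nat_rule g z left inv back] moves the strand
   [z], starting on the left of [g] iff [left], across [g].  The crossings
   follow the box in the first word; [back] exchanges the two words. *)
Definition nat_rule (g : gen) (z : nat) (left inv back : bool) : rule :=
  let X := gdom g in let Y := gcod g in
  let c := fun k U => match left, inv with
    | true, false => crs k [:: z] U | true, true => crsV k U [:: z]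
    | false, false => crs k U [:: z] | false, true => crsV k [:: z] U end in
  let v := if left then (1, g) :: c 0 Y else (0, g) :: c 0 Y in
  let w := if left then c 0 X ++ [:: (0, g)] else c 0 X ++ [:: (1, g)] in
  let D := if left then z :: X else rcons X z in
  if back then Rule D w v else Rule D v w.

Definition cancel_rule (i j : nat) (b : bool) : rule :=
  if b then Rule [:: i; j] [:: (0, Crs i j); (0, CrsV i j)] [::]
  else Rule [:: j; i] [:: (0, CrsV i j); (0, Crs i j)] [::].

Definition flip (r : rule) : rule := Rule (rX r) (rr r) (rl r).

(** A certificate is a list of these. The last two numbers of the rewriting commands are the layers
    passed before the redex and the strands on its left; the first number of [Apply] selects an
    equation. *)
Inductive cmd :=
  | Swap of nat & bool
  | Apply of nat & nat & nat
  | Nat of gen & nat & bool & bool & bool & nat & nat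
  | Cancel of nat & nat & bool & nat & nat
  | Uncancel of nat & nat & bool & nat & nat.

Variable rules : seq rule.
(** It is sound, hence a harmless default for indices out of range and for equations whose sides are
    not parallel. *)
Definition norule := Rule [::] [::] [::].

Definition exec1 (X : seq nat) (c : cmd) (w : word) : option word :=
  match c with
  | Swap n b => swap n b w
  | Apply i n k => apply_at (nth norule rules i) n k X w
  | Nat g z l v b n k =>
      if gok g then apply_at (nat_rule g z l v b) n k X w else None
  | Cancel i j b n k => apply_at (cancel_rule i j b) n k X w
  | Uncancel i j b n k => apply_at (flip (cancel_rule i j b)) n k X w
  end.

Fixpoint exec (X : seq nat) (cs : seq cmd) (w : word) : option word :=
  match cs with
  | [::] => Some w
  | c :: cs' => if exec1 X c w is Some v then exec X cs' v else None
  end.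

End Arities.

(** * Interpretation of words *)

Section Interpretation.

Variable B : brcat.
Variable os : seq (ob B).

Definition oat (n : nat) : ob B := nth tunit os n.
Fixpoint oden (X : seq nat) : ob B :=
  if X is x :: X' then oat x ⊗ oden X' else tunit.
Fixpoint oev (x : oexp) : ob B :=
  match x with OUnit => tunit | OAt n => oat n | OTens x y => oev x ⊗ oev y end.

Lemma oden_cat X Y : oden (X ++ Y) = oden X ⊗ oden Y.
Proof. by elim: X => [|x X IH] /=; rewrite ?tens1x // IH tensA. Qed.

(** By strictness bracketing and units leave no trace, so typing reduces to the comparison of lists
    of atoms. *)
Lemma oev_onf x : oev x = oden (onf x).
Proof. by elim: x => //= [n|x -> y ->]; rewrite ?tensx1 ?oden_cat. Qed.

Variable oar : seq (oexp * oexp).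
Variable gm : seq (mor B).

Fixpoint gens_ok (a : seq (oexp * oexp)) (m : seq (mor B)) : Prop :=
  match a, m with
  | (x, y) :: a', f :: m' => (f ∷ oev x ⇒ oev y) /\ gens_ok a' m'
  | [::], [::] => True
  | _, _ => False
  end.

Lemma gens_ok_nth a m i : gens_ok a m -> i < size a ->
  nth (idm tunit) m i ∷ oden (nth ([::], [::]) [seq (onf x.1, onf x.2) | x <- a] i).1
     ⇒ oden (nth ([::], [::]) [seq (onf x.1, onf x.2) | x <- a] i).2.
Proof.
elim: a m i => [|[x y] a IH] [|f m] //= [|i] [fh ok] lti; last first.
  by apply: (IH m i).
by rewrite /= -!oev_onf.
Qed.

Hypothesis gm_ok : gens_ok oar gm.

Definition ars := [seq (onf a.1, onf a.2) | a <- oar].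
Local Notation gdom := (gdom ars).
Local Notation gcod := (gcod ars).

Definition gden (g : gen) : mor B :=
  match g with
  | Box i => nth (idm tunit) gm i
  | Crs i j => τ (oat i) (oat j)
  | CrsV i j => inv (τ (oat i) (oat j)) end.

Lemma gden_hom g : gok ars g -> gden g ∷ oden (gdom g) ⇒ oden (gcod g).
Proof.
case: g => [i|i j|i j]; last 2 first.
- by move=> _; rewrite /= !tensx1; typ.
- by move=> _; rewrite /= !tensx1; typ.
rewrite /gok lebE /ars size_map; exact: gens_ok_nth.
Qed.

Definition lden (X : seq nat) (l : layer) : mor B :=
  idm (oden (take l.1 X)) ⊠ gden l.2
    ⊠ idm (oden (drop (l.1 + size (gdom l.2)) X)).
Fixpoint wden (X : seq nat) (w : word) : mor B :=
  if w is l :: w' then wden (lcod ars X l) w' ∘ lden X l else idm (oden X).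

Lemma ldenE L R g : lden (L ++ gdom g ++ R) (size L, g) =
  idm (oden L) ⊠ gden g ⊠ idm (oden R).
Proof.
by rewrite /lden /= take_size_cat // addnC -drop_drop drop_size_cat // drop_size_cat.
Qed.

Lemma lden_hom X l : lok ars X l -> lden X l ∷ oden X ⇒ oden (lcod ars X l).
Proof.
case: l => k g /lokP [L [R [-> /= <- /gden_hom [d c]]]].
rewrite ldenE lcodE; split; first by rewrite !dom_tens !dom_id d !oden_cat tensA.
by rewrite !cod_tens !cod_id c !oden_cat tensA.
Qed.

Lemma wden_hom X w : wok ars X w -> wden X w ∷ oden X ⇒ oden (wcod ars X w).
Proof.
elim: w X => [|l w IH] X /=; first by split; rewrite ?dom_id ?cod_id.
move=> /andP[/lden_hom [dl cl] /IH [dw cw]].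
by split; rewrite ?dom_comp ?cod_comp // dw cl.
Qed.

Lemma wden_cat X v w : wok ars X (v ++ w) ->
  wden X (v ++ w) = wden (wcod ars X v) w ∘ wden X v.
Proof.
elim: v X => [|l v IH] X /=.
  by move=> /wden_hom[dw _]; rewrite comp_idr.
move=> /andP[/lden_hom [dl cl]] ok; have := ok; rewrite wok_cat => /andP[vok wok].
rewrite (IH _ ok) compA //.
  by case: (wden_hom vok) (wden_hom wok) => _ -> [-> _].
by case: (wden_hom vok) => -> _.
Qed.

(** Typing is assumed of the first word only and handed on to the second. A chain of steps thus
    needs typing at its start alone, and no step has to check it again. *)
Definition wsim (X : seq nat) (v w : word) : Prop :=
  wok ars X v -> [/\ wok ars X w, wcod ars X w = wcod ars X v & wden X w = wden X v].

Lemma wsim_trans X u v w : wsim X u v -> wsim X v w -> wsim X u w.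
Proof. by move=> uv vw /uv [/vw [? e1 e2] e3 e4]; split; rewrite ?e1 ?e2. Qed.

Lemma wsim_cons X l v w : wsim (lcod ars X l) v w -> wsim X (l :: v) (l :: w).
Proof. by rewrite /wsim /= => vw /andP[-> /vw [-> -> ->]]. Qed.

Lemma interchange f g L M R X Y X' Y' : f ∷ X ⇒ Y -> g ∷ X' ⇒ Y' ->
  (idm (L ⊗ Y ⊗ M) ⊠ g ⊠ idm R) ∘ (idm L ⊠ f ⊠ idm (M ⊗ X' ⊗ R)) =
  (idm L ⊠ f ⊠ idm (M ⊗ Y' ⊗ R)) ∘ (idm (L ⊗ X ⊗ M) ⊠ g ⊠ idm R) :> mor B.
Proof.
move=> [df cf] [dg cg].
have e Q : idm (L ⊗ Q ⊗ M) ⊠ g ⊠ idm R = idm L ⊠ idm Q ⊠ (idm M ⊠ g ⊠ idm R).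
  by rewrite -!tens_id !tensmA.
have e' Q : idm L ⊠ f ⊠ idm (M ⊗ Q ⊗ R) = idm L ⊠ f ⊠ (idm M ⊠ idm Q ⊠ idm R).
  by rewrite !tens_id.
rewrite !{}e !{}e' -!tens_comp; try typ.
by rewrite !(comp_idl, comp_idr) //; typ.
Qed.

(** The interchange law on an explicit decomposition of the strands, where the truncated
    subtractions of [swap2] do not occur; both directions of the swap are instances. *)
Lemma swap_canon L M R g g' (X := L ++ gdom g ++ M ++ gdom g' ++ R)
    (l := (size L, g)) (m := (size (L ++ gcod g ++ M), g'))
    (m' := (size (L ++ gdom g ++ M), g')) :
  gok ars g -> gok ars g' ->
  [/\ lok ars X l && lok ars (lcod ars X l) m,
      lok ars X m' && lok ars (lcod ars X m') l,
      lcod ars (lcod ars X m') l = lcod ars (lcod ars X l) m &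
      lden (lcod ars X m') l ∘ lden X m' = lden (lcod ars X l) m ∘ lden X l].
Proof.
move=> gk gk'; rewrite {}/X {}/l {}/m {}/m'.
have e1 U : L ++ U ++ M ++ gdom g' ++ R = (L ++ U ++ M) ++ gdom g' ++ R.
  by rewrite !catA.
have e2 U : (L ++ gdom g ++ M) ++ U ++ R = L ++ gdom g ++ (M ++ U ++ R).
  by rewrite !catA.
have lE : lcod ars (L ++ gdom g ++ M ++ gdom g' ++ R) (size L, g) =
    (L ++ gcod g ++ M) ++ gdom g' ++ R by rewrite lcodE !catA.
have mE : lcod ars (L ++ gdom g ++ M ++ gdom g' ++ R) (size (L ++ gdom g ++ M), g')
    = L ++ gdom g ++ (M ++ gcod g' ++ R) by rewrite e1 lcodE !catA.
rewrite lE mE !lcodE !lokE // ldenE ldenE ldenE.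
have -> : lok ars (L ++ gdom g ++ M ++ gdom g' ++ R) (size (L ++ gdom g ++ M), g').
  by rewrite e1 lokE.
have -> : lden (L ++ gdom g ++ M ++ gdom g' ++ R) (size (L ++ gdom g ++ M), g')
    = idm (oden (L ++ gdom g ++ M)) ⊠ gden g' ⊠ idm (oden R) by rewrite e1 ldenE.
split=> //; first by rewrite !catA.
have := interchange (oden L) (oden M) (oden R) (gden_hom gk) (gden_hom gk').
by rewrite !oden_cat !tensA => ->.
Qed.

Lemma swap2_sound X l m b l' m' w : swap2 ars l m b = Some (m', l') ->
  wsim X (l :: m :: w) (m' :: l' :: w).
Proof.
suff H : swap2 ars l m b = Some (m', l') -> lok ars X l -> lok ars (lcod ars X l) m ->
   [/\ lok ars X m', lok ars (lcod ars X m') l',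
      lcod ars (lcod ars X m') l' = lcod ars (lcod ars X l) m &
      lden (lcod ars X m') l' ∘ lden X m' = lden (lcod ars X l) m ∘ lden X l].
  move=> sw; rewrite /wsim /= => /and3P[lX mX wX]; have [mX' lX' ec ed] := H sw lX mX.
  rewrite mX' lX' ec; split=> //.
  case: (lden_hom lX) (lden_hom mX) (wden_hom wX) => [_ cl] [dm cm] [dw _].
  case: (lden_hom mX') (lden_hom lX') => [_ cm'] [dl' cl'].
  by rewrite -compA ?dl' ?cm' ?dw ?cl' ?ec // ed compA ?cl ?dm ?dw ?cm.
case: l m => [k g] [k' g'] /=; case: b; rewrite lebE; case: leqP => // le [<- <-].
- move=> /lokP [L [R [-> /= ek gk]]]; rewrite -ek.
  rewrite {1}lcodE => /lokP [L' [R' [e /= ek' gk']]].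
  (* The strands between the two layers are split in two ways; the test on positions says that the
     second generator starts after the outputs of the first, and [M] is the gap. *)
  have [||M [eL' eR]] := @cat_split _ (L ++ gcod g) R L' (gdom g' ++ R').
  - by rewrite -catA.
  - by rewrite size_cat ek ek'.
  have -> : k' - size (gcod g) + size (gdom g) = size (L ++ gdom g ++ M).
    by rewrite -ek' eL' !size_cat addnAC addnK addnAC addnA.
  rewrite -ek' eL' eR -[(L ++ gcod g) ++ M]catA.
  by have [/andP[_ _] /andP[-> ->] -> ->] := swap_canon L M R' gk gk'.
- move=> /lokP [L [R [-> /= ek gk]]]; rewrite -ek {1}lcodE.
  move=> /lokP [L' [R' [e /= ek' gk']]].
  have [||M [eL eR']] := @cat_split _ (L' ++ gdom g') R' L (gcod g ++ R).
  - by rewrite -catA.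
  - by rewrite size_cat ek ek'.
  have -> : size L - size (gdom g') + size (gcod g') = size (L' ++ gcod g' ++ M).
    by rewrite eL !size_cat addnAC addnK addnAC addnA.
  rewrite -ek' eL -[(L' ++ gdom g') ++ M]catA.
  have -> : (L' ++ gdom g' ++ M) ++ gdom g ++ R = L' ++ gdom g' ++ M ++ gdom g ++ R.
    by rewrite !catA.
  by have [/andP[-> ->] _ <- <-] := swap_canon L' M R gk' gk.
Qed.

(** Typing and denotation travel together because the denotation of a concatenation is a composite
    only for well-typed words. *)
Definition wd (X : seq nat) (w : word) (Y : seq nat) (f : mor B) : Prop :=
  [/\ wok ars X w, wcod ars X w = Y & wden X w = f].

Lemma wd_hom X w Y f : wd X w Y f -> f ∷ oden X ⇒ oden Y.
Proof. by move=> [/wden_hom + <- <-]. Qed.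

Lemma wd_nil X : wd X [::] X (idm (oden X)).
Proof. by []. Qed.

Lemma wd_cat X v Y f w Z g : wd X v Y f -> wd Y w Z g -> wd X (v ++ w) Z (g ∘ f).
Proof.
move=> [vok ev fE] [wok' ew gE]; have ok : wok ars X (v ++ w).
  by rewrite wok_cat vok ev wok'.
by split=> //; rewrite ?wcod_cat ?wden_cat ?ev // gE fE.
Qed.

Lemma wd_gen g : gok ars g -> wd (gdom g) [:: (0, g)] (gcod g) (gden g).
Proof.
move=> gk; have := lokE [::] [::] gk; have := lcodE ars [::] [::] g.
have := ldenE [::] [::] g; rewrite !cats0 !cat0s /= tens1m tensm1 => e ec ok.
split; rewrite /= ?ok ?ec // e comp_idl //; by case: (gden_hom gk).
Qed.

Lemma lden_whisker L R X l : lok ars X l ->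
  lden (L ++ X ++ R) (size L + l.1, l.2) = idm (oden L) ⊠ lden X l ⊠ idm (oden R).
Proof.
case: l => k g /lokP [L' [R' [-> /= <- gk]]].
have -> : L ++ (L' ++ gdom g ++ R') ++ R = (L ++ L') ++ gdom g ++ (R' ++ R).
  by rewrite !catA.
by rewrite -size_cat !ldenE !oden_cat -!tens_id !tensmA.
Qed.

Lemma wd_whisker L R X w Y f : wd X w Y f ->
  wd (L ++ X ++ R) (shift (size L) w) (L ++ Y ++ R) (idm (oden L) ⊠ f ⊠ idm (oden R)).
Proof.
move=> [ok <- <-]; have [ok' e] := wok_whisker L R ok; split=> //.
elim: w X ok {ok' e} => [|l w IH] X /=; first by rewrite !oden_cat !tens_id tensA.
move=> /andP[lX wX]; have [_ ->] := lok_whisker L R lX; rewrite IH // lden_whisker //.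
have e : dom (wden (lcod ars X l) w) = cod (lden X l).
  by case: (wden_hom wX) (lden_hom lX) => -> _ [_ ->].
by rewrite -!tens_comp ?comp_idl //; typ.
Qed.

Lemma wd_left Z X w Y f : wd X w Y f ->
  wd (Z ++ X) (shift (size Z) w) (Z ++ Y) (idm (oden Z) ⊠ f).
Proof.
by move=> /(wd_whisker Z [::]); rewrite !cats0 /= tensm1.
Qed.

Lemma shift0 w : shift 0 w = w.
Proof. by elim: w => [|[k g] w IH] //=; rewrite IH. Qed.

Lemma wd_right Z X w Y f : wd X w Y f -> wd (X ++ Z) w (Y ++ Z) (f ⊠ idm (oden Z)).
Proof.
by move=> /(wd_whisker [::] Z); rewrite /= tens1m shift0.
Qed.

Lemma wd_tens X v Y f X' v' Y' f' : wd X v Y f -> wd X' v' Y' f' ->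
  wd (X ++ X') (v ++ shift (size Y) v') (Y ++ Y') (f ⊠ f').
Proof.
move=> vP vP'; rewrite -(@tens_rl _ f f' (oden Y) (oden X')); first last.
- by case: (wd_hom vP').
- by case: (wd_hom vP).
exact: wd_cat (wd_right _ vP) (wd_left _ vP').
Qed.

Lemma shiftD m n w : shift m (shift n w) = shift (m + n) w.
Proof. by rewrite /shift -map_comp; apply: eq_map => l /=; rewrite addnA. Qed.

Lemma shift_crs1 k x Y : crs1 k x Y = shift k (crs1 0 x Y).
Proof.
elim: Y k => //= y Y IH k; rewrite addn0 IH (IH 1) shiftD; congr (_ :: shift _ _).
by rewrite addn1.
Qed.

Lemma shift_crs k X Y : crs k X Y = shift k (crs 0 X Y).
Proof.
elim: X k => //= x X IH k; rewrite IH (IH 1) {1}shift_crs1 /shift map_cat.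
by rewrite -/(shift _ _) -/(shift _ (shift _ _)) shiftD addn1.
Qed.

Lemma shift_crs1V k x Y : crs1V k x Y = shift k (crs1V 0 x Y).
Proof.
elim: Y k => //= y Y IH k.
by rewrite IH (IH 1) /shift map_rcons -/(shift _ (shift _ _)) shiftD addn1 addn0.
Qed.

Lemma shift_crsV k X Y : crsV k X Y = shift k (crsV 0 X Y).
Proof.
elim: X k => //= x X IH k; rewrite IH (IH 1) {1}shift_crs1V /shift map_cat.
by rewrite -/(shift _ _) -/(shift _ (shift _ _)) shiftD addn1.
Qed.

Lemma wd_crs1 x Y : wd (x :: Y) (crs1 0 x Y) (rcons Y x) (τ (oat x) (oden Y)).
Proof.
elim: Y => [|y Y IH] /=.
  by rewrite br_x1; have := wd_nil [:: x]; rewrite /= tensx1.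
rewrite br_tensr shift_crs1 -(cat1s y (rcons _ _)).
rewrite -[(0, _) :: _]cat1s.
have -> : x :: y :: Y = gdom (Crs x y) ++ Y by [].
apply: wd_cat; first by apply: wd_right; exact: wd_gen.
by have := wd_left [:: y] IH; rewrite /= tensx1.
Qed.

Lemma wd_crs X Y : wd (X ++ Y) (crs 0 X Y) (Y ++ X) (τ (oden X) (oden Y)).
Proof.
elim: X => [|x X IH] /=.
  by rewrite br_1x cats0; exact: wd_nil.
rewrite br_tensl shift_crs; apply: wd_cat.
  by have := wd_left [:: x] IH; rewrite /= tensx1; apply.
by have := wd_right X (wd_crs1 x Y); rewrite cat_rcons.
Qed.

Lemma wd_crs1V x Y : wd (rcons Y x) (crs1V 0 x Y) (x :: Y) (inv (τ (oat x) (oden Y))).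
Proof.
elim: Y => [|y Y IH] /=.
  rewrite br_x1 (inv_eq (inverse_id _)).
  by have := wd_nil [:: x]; rewrite /= tensx1.
have -> : inv (τ (oat x) (oat y ⊗ oden Y)) =
    (inv (τ (oat x) (oat y)) ⊠ idm (oden Y)) ∘ (idm (oat y) ⊠ inv (τ (oat x) (oden Y))).
  apply: inv_eq; rewrite br_tensr; apply: inverse_comp; first typ.
    by apply: inverse_tens; [exact: inv_br | exact: inverse_id].
  by apply: inverse_tens; [exact: inverse_id | exact: inv_br].
rewrite shift_crs1V -[rcons (shift _ _) _]cats1; apply: (@wd_cat _ _ (y :: x :: Y)).
  by have := wd_left [:: y] IH; rewrite /= tensx1.
exact: (@wd_right Y _ _ _ _ (wd_gen (g := CrsV x y) _)).
Qed.

Lemma wd_crsV X Y : wd (Y ++ X) (crsV 0 X Y) (X ++ Y) (inv (τ (oden X) (oden Y))).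
Proof.
elim: X => [|x X IH] /=.
  by rewrite br_1x (inv_eq (inverse_id _)) cats0; exact: wd_nil.
have -> : inv (τ (oat x ⊗ oden X) (oden Y)) =
    (idm (oat x) ⊠ inv (τ (oden X) (oden Y))) ∘ (inv (τ (oat x) (oden Y)) ⊠ idm (oden X)).
  apply: inv_eq; rewrite br_tensl; apply: inverse_comp; first typ.
    by apply: inverse_tens; [exact: inverse_id | exact: inv_br].
  by apply: inverse_tens; [exact: inv_br | exact: inverse_id].
rewrite shift_crsV; apply: (@wd_cat _ _ (x :: Y ++ X)).
  by have := wd_right X (wd_crs1V x Y); rewrite cat_rcons.
by have := wd_left [:: x] IH; rewrite /= tensx1.
Qed.

Definition rule_ok (r : rule) : Prop :=
  exists Y f, wd (rX r) (rl r) Y f /\ wd (rX r) (rr r) Y f.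

Lemma flip_ok r : rule_ok r -> rule_ok (flip r).
Proof. by move=> [Y [f [? ?]]]; exists Y, f. Qed.

(** Naturality of the inverse braiding is naturality of the mirror braiding. *)
Lemma inv_br_natl (f : mor B) X Y Z : f ∷ X ⇒ Y ->
  inv (τ Z Y) ∘ (f ⊠ idm Z) = (idm Z ⊠ f) ∘ inv (τ Z X).
Proof.
move=> [dX cY]; have := br_nat (mirror_braiding B) f (idm Z).
by rewrite dom_id cod_id dX cY.
Qed.

Lemma inv_br_natr (f : mor B) X Y Z : f ∷ X ⇒ Y ->
  inv (τ Y Z) ∘ (idm Z ⊠ f) = (f ⊠ idm Z) ∘ inv (τ X Z).
Proof.
move=> [dX cY]; have := br_nat (mirror_braiding B) (idm Z) f.
by rewrite dom_id cod_id dX cY.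
Qed.

Lemma nat_rule_ok g z left inv back : gok ars g -> rule_ok (nat_rule ars g z left inv back).
Proof.
move=> gk; suff H : rule_ok (nat_rule ars g z left inv false).
  by case: back => //; exact: flip_ok H.
have gh := gden_hom gk; have gP := wd_gen gk.
have gl := wd_left [:: z] gP; have gr := wd_right [:: z] gP.
rewrite /= addn0 !tensx1 in gl gr.
case: left inv => [] [] /=; rewrite /rule_ok /=.
- exists (rcons (gcod g) z); rewrite -!cats1; eexists; split.
    apply: (wd_cat gl); exact: (wd_crsV (gcod g) [:: z]).
  rewrite /= tensx1 (inv_br_natr _ gh).
  by have := wd_crsV (gdom g) [:: z]; rewrite /= tensx1 => /wd_cat; apply.
- exists (rcons (gcod g) z); rewrite -!cats1; eexists; split.
    apply: (wd_cat gl); exact: (wd_crs [:: z] (gcod g)).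
  rewrite /= tensx1 (br_natr _ gh).
  by have := wd_crs [:: z] (gdom g); rewrite /= tensx1 => /wd_cat; apply.
- exists (z :: gcod g); rewrite -!cats1; eexists; split.
    apply: (wd_cat gr); exact: (wd_crsV [:: z] (gcod g)).
  rewrite /= tensx1 (inv_br_natl _ gh).
  by have := wd_crsV [:: z] (gdom g); rewrite /= tensx1 => /wd_cat; apply.
- exists (z :: gcod g); rewrite -!cats1; eexists; split.
    apply: (wd_cat gr); exact: (wd_crs (gcod g) [:: z]).
  rewrite /= tensx1 (br_natl _ gh).
  by have := wd_crs (gdom g) [:: z]; rewrite /= tensx1 => /wd_cat; apply.
Qed.

Lemma cancel_rule_ok i j b : rule_ok (cancel_rule i j b).
Proof.
have P : wd [:: i; j] [:: (0, Crs i j)] [:: j; i] (τ (oat i) (oat j)).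
  exact: wd_gen (Crs i j) _.
have Q : wd [:: j; i] [:: (0, CrsV i j)] [:: i; j] (inv (τ (oat i) (oat j))).
  exact: wd_gen (CrsV i j) _.
have [_ _ l r] := inv_br (oat i) (oat j).
case: b; rewrite /rule_ok /=.
  exists [:: i; j]; eexists; split; first exact: wd_cat P Q.
  by rewrite l br_dom; have := wd_nil [:: i; j]; rewrite /= tensx1.
exists [:: j; i]; eexists; split; first exact: wd_cat Q P.
by rewrite r br_cod; have := wd_nil [:: j; i]; rewrite /= tensx1.
Qed.

Lemma wprefixE v w u : wprefix v w = Some u -> w = v ++ u.
Proof.
elim: v w => [w [->] //|[k g] v IH [|[l h] w] //=].
by case: ifP => // /andP[/eqnP-> /eqgP->] /IH->.
Qed.

Lemma apply_rule_sound r k X w w' : rule_ok r ->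
  apply_rule r k X w = Some w' -> wsim X w w'.
Proof.
move=> [Y [f [lP rP]]]; rewrite /apply_rule lebE; case: ifP => // /andP[kX /eqsP e].
case ew: wprefix => [u|//] [<-]; rewrite (wprefixE ew).
have -> : X = take k X ++ rX r ++ drop (k + size (rX r)) X.
  rewrite -[LHS](cat_take_drop k); congr (_ ++ _).
  by rewrite -[LHS](cat_take_drop (size (rX r))) e drop_drop addnC.
move: (take k X) (drop _ X) (size_takel kX) => L R <-.
have [lok le ld] := wd_whisker L R lP; have [rok re rd] := wd_whisker L R rP.
rewrite /wsim !wok_cat lok le rok re !wcod_cat le re /= => uok; split=> //.
by rewrite !wden_cat ?wok_cat ?lok ?rok ?le ?re // ld rd.
Qed.

Lemma apply_at_sound r n k X w w' : rule_ok r ->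
  apply_at ars r n k X w = Some w' -> wsim X w w'.
Proof.
move=> rP; elim: n X w w' => [|n IH] X w w' /=; first exact: apply_rule_sound.
case: w => // l w; case e: apply_at => [v|//] [<-].
by apply: wsim_cons; exact: IH e.
Qed.

Lemma swap_sound w n b X w' : swap ars n b w = Some w' -> wsim X w w'.
Proof.
elim: n w X w' => [|n IH] [|l w] X w' //=.
  case: w => // m w; case e: swap2 => [[m' l']|//] [<-]; exact: swap2_sound e.
by case e: swap => [v|//] [<-]; apply: wsim_cons; exact: IH e.
Qed.

Fixpoint rules_ok (rs : seq rule) : Prop :=
  if rs is r :: rs' then rule_ok r /\ rules_ok rs' else True.

Lemma norule_ok : rule_ok norule.
Proof. by exists [::], (idm tunit). Qed.

Lemma rules_ok_nth rs i : rules_ok rs -> rule_ok (nth norule rs i).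
Proof.
elim: rs i => [|r rs IH] [|i] //=; try by move=> _; exact: norule_ok.
  by case.
by case=> _; exact: IH.
Qed.

Lemma exec_sound rs X cs w w' : rules_ok rs ->
  exec ars rs X cs w = Some w' -> wsim X w w'.
Proof.
move=> rsP; elim: cs w => [|c cs IH] w /=; first by move=> [->] ?.
case e: exec1 => [v|//] /IH; apply: wsim_trans; case: c e => /=.
- by move=> n b; exact: swap_sound.
- by move=> i n k; apply: apply_at_sound; exact: rules_ok_nth.
- move=> g z l i b n k; case: ifP => // gk; apply: apply_at_sound.
  exact: nat_rule_ok.
- by move=> i j b n k; apply: apply_at_sound; exact: cancel_rule_ok.
- by move=> i j b n k; apply: apply_at_sound; apply: flip_ok; exact: cancel_rule_ok.
Qed.

Fixpoint mden (e : mexp) : mor B :=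
  match e with
  | MId x => idm (oev x)
  | MBox i => nth (idm tunit) gm i
  | MBr x y => τ (oev x) (oev y)
  | MBrV x y => inv (τ (oev x) (oev y))
  | MComp g f => mden g ∘ mden f
  | MTens f g => mden f ⊠ mden g
  end.

Lemma flat_sound e X Y : mtyp ars e = Some (X, Y) -> wd X (flat ars e) Y (mden e).
Proof.
elim: e X Y => [x|i|x y|x y|g IHg f IHf|f IHf g IHg] X Y /=.
- by move=> [<- <-]; rewrite oev_onf; exact: wd_nil.
- case: ifP => // gk [e]; have := wd_gen (g := Box i) gk.
  by rewrite /= e.
- by move=> [<- <-]; rewrite !oev_onf; exact: wd_crs.
- by move=> [<- <-]; rewrite !oev_onf; exact: wd_crsV.
- case: mtyp IHg => [[a b]|//] /(_ _ _ erefl) gP.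
  case: mtyp IHf => [[a' b']|//] /(_ _ _ erefl) fP.
  by case: ifP => // /eqsP e [<- <-]; apply: wd_cat fP _; rewrite -e.
- rewrite /mcod_size; case: mtyp IHf => [[a b]|//] /(_ _ _ erefl) fP.
  case: mtyp IHg => [[a' b']|//] /(_ _ _ erefl) gP [<- <-].
  exact: wd_tens.
Qed.

Fixpoint eqns_ok (es : seq (mexp * mexp)) : Prop :=
  if es is (l, r) :: es' then mden l = mden r /\ eqns_ok es' else True.

End Interpretation.

Definition erule ar (e : mexp * mexp) : rule :=
  match mtyp ar e.1, mtyp ar e.2 with
  | Some (X, Y), Some (X', Y') =>
      if eqs X X' && eqs Y Y' then Rule X (flat ar e.1) (flat ar e.2) else norule
  | _, _ => norule
  end.

Definition check ar es (l r : mexp) (cl cr : seq cmd) : bool :=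
  match mtyp ar l, mtyp ar r with
  | Some (X, Y), Some (X', Y') =>
      let rs := [seq erule ar e | e <- es] in
      if eqs X X' then
        match exec ar rs X cl (flat ar l), exec ar rs X cr (flat ar r) with
        | Some v, Some w => eqw v w
        | _, _ => false
        end
      else false
  | _, _ => false
  end.

(** Both sides are rewritten and the results compared syntactically, so soundness of the single
    steps suffices; how the certificates were found does not matter. *)
Lemma check_sound (B : brcat) (os : seq (ob B)) oar (gm : seq (mor B)) es l r cl cr :
  gens_ok os oar gm -> eqns_ok os gm es ->
  check (ars oar) es l r cl cr -> mden os gm l = mden os gm r.
Proof.
move=> gP eP; rewrite /check; case el: mtyp => [[X Y]|//].
case er: mtyp => [[X' Y']|//]; case: ifP => // /eqsP e.
case ev: exec => [v|//]; case ew: exec => [w|//] /eqwP vw.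
rewrite {}vw -{}e in er ev ew *.
have [lok _ <-] := flat_sound gP el; have [rok _ <-] := flat_sound gP er.
suff rsP : rules_ok os oar gm [seq erule (ars oar) e | e <- es].
  have [_ _ <-] := exec_sound gP rsP ev lok.
  by have [_ _ <-] := exec_sound gP rsP ew rok.
elim: es eP {ev ew} => //= [] [a b] es IH [e /IH{}IH]; split=> //.
rewrite /erule /=; case ea: mtyp => [[U V]|]; last exact: norule_ok.
case eb: mtyp => [[U' V']|]; last exact: norule_ok.
case: ifP => [/andP[/eqsP eU /eqsP eV]|_]; last exact: norule_ok.
exists V, (mden os gm a); split; first exact: flat_sound ea.
by rewrite /= eU eV e; exact: flat_sound eb.
Qed.

Definition hom_check ar (e : mexp) (x y : oexp) : bool :=
  if mtyp ar e is Some (X, Y) then eqs X (onf x) && eqs Y (onf y) else false.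

Lemma hom_sound (B : brcat) (os : seq (ob B)) oar (gm : seq (mor B)) e x y :
  gens_ok os oar gm -> hom_check (ars oar) e x y ->
  mden os gm e ∷ oev os x ⇒ oev os y.
Proof.
move=> gP; rewrite /hom_check; case E: mtyp => [[X Y]|//] /andP[/eqsP eX /eqsP eY].
by rewrite !oev_onf -eX -eY; exact: wd_hom (flat_sound gP E).
Qed.

(** * Search for certificates *)

Section Search.

Variable ar : seq (seq nat * seq nat).
Variable rules : seq rule.

Definition eql (l m : layer) : bool := eqn l.1 m.1 && eqg l.2 m.2.

Definition opts (A : Type) (f : bool -> option A) : seq (bool * A) :=
  (if f false is Some a then [:: (false, a)] else [::]) ++
  (if f true is Some a then [:: (true, a)] else [::]).

(* Moves [l] to the left of the word [rev q]. *)
Fixpoint over (q : word) (l : layer) : seq (layer * word * seq bool) :=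
  if q is m :: q' then
    flatten [seq (let: (b, (l', m')) := o in
                  [seq (x.1.1, m' :: x.1.2, b :: x.2) | x <- over q' l'])
            | o <- opts (swap2 ar m l)]
  else [:: (l, [::], [::])].

Fixpoint swaps (n : nat) (bs : seq bool) : seq cmd :=
  if bs is b :: bs' then Swap n.-1 b :: swaps n.-1 bs' else [::].

Fixpoint ofind (A B : Type) (f : A -> option B) (s : seq A) : option B :=
  if s is x :: s' then if f x is Some y then Some y else ofind f s' else None.

(* Commands transforming [v] into [w]; [n] is the index of the head of [v]. *)
Fixpoint pick (n : nat) (q v : word) (l : layer) : seq (word * seq cmd) :=
  if v is m :: v' then
    [seq (catrev x.1.2 v', swaps n x.2) | x <- over q m & eql x.1.1 l]
      ++ pick n.+1 (m :: q) v' l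
  else [::].

Fixpoint align (n : nat) (v w : word) : option (seq cmd) :=
  match w with
  | [::] => if v is [::] then Some [::] else None
  | l :: w' =>
      ofind (fun x => if align n.+1 x.1 w' is Some cs' then Some (x.2 ++ cs') else None)
        (pick n [::] v l)
  end.

(* Linear extensions of a word. *)
Fixpoint firsts (q v : word) : seq (layer * word) :=
  if v is m :: v' then
    [seq (x.1.1, catrev x.1.2 v') | x <- over q m] ++ firsts (m :: q) v'
  else [::].

Fixpoint exts (fuel : nat) (v : word) : seq word :=
  if fuel is f.+1 then
    if v is [::] then [:: [::]] else
    flatten [seq [seq x.1 :: u | u <- exts f x.2] | x <- firsts [::] v]
  else [:: v].

Fixpoint isshift (k : nat) (p w : word) : bool :=
  match p, w with
  | (i, g) :: p', (j, h) :: w' => [&& eqn (k + i) j, eqg g h & isshift k p' w']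
  | [::], [::] => true
  | _, _ => false
  end.

Definition shiftof (p w : word) : option nat :=
  match p, w with
  | (i, _) :: _, (j, _) :: _ =>
     if leb i j && isshift (j - i) p w then Some (j - i) else None
  | _, _ => None
  end.

(* [b] and [q] are reversed: the matched block and the postponed layers. [m]
   is the matched part of the pattern, [p] the rest. *)
Fixpoint grow (np nb nq : nat) (m p b q rest : word) (k : nat) (cs : seq cmd) :
    seq (nat * nat * seq cmd) :=
  (if p is [::] then [:: (np, k, cs)] else [::]) ++
  match rest with
  | [::] => [::]
  | l :: rest' =>
      let os := over q l in
      let next := if p is (i, g) :: p' then
        ofind (fun x => if eql x.1.1 (k + i, g) then Some (i, g, p', x) else None) os
        else None in
      match next with
      | Some (i, g, p', (l', q', bs)) =>
          grow np nb.+1 nq (rcons m (i, g)) p' (l' :: b) q' rest' k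
            (cs ++ swaps (np + nb + nq) bs)
      | None =>
          match ofind (fun x => ofind (fun y =>
              if shiftof m (rev y.1.2) is Some k' then Some (y.1.2, x.1.2, x.2 ++ y.2, k')
              else None) (over b x.1.1)) os with
          | Some (b', q', bs, k') =>
              grow np.+1 nb nq m p b' q' rest' k' (cs ++ swaps (np + nb + nq) bs)
          | None => grow np nb nq.+1 m p b (l :: q) rest' k cs
          end
      end
  end.

Fixpoint matches (n : nat) (p w : word) : seq (nat * nat * seq cmd) :=
  match p, w with
  | (i, g) :: p', (j, h) :: w' =>
      (if eqg g h && leb i j then
         grow n 1 0 [:: (i, g)] p' [:: (j, h)] [::] w' (j - i) [::]
       else [::]) ++ matches n.+1 p w'
  | _, _ => [::]
  end.

(** The pattern is sought in each of its linear extensions; once its layers are contiguous, [align]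
    restores the order they have in the rule. The fuel 12 bounds the number of pattern layers that
    are permuted. *)
Definition rulesof (c : nat -> nat -> cmd) (r : rule) (w : word) : seq (seq cmd) :=
  flatten [seq [seq (let: (n, k, cs) := x in
     cs ++ (if align n p (rl r) is Some cs' then cs' else [::]) ++ [:: c n k])
     | x <- matches 0 p w] | p <- exts 12 (rl r)].

Definition tryall (X : seq nat) (w : word) (css : seq (seq cmd)) :
    seq (seq cmd * word) :=
  pmap (fun cs => if exec ar rules X cs w is Some v then Some (cs, v) else None) css.

Fixpoint gens (w : word) : seq gen :=
  if w is l :: w' then
    let s := gens w' in if has (eqg l.2) s then s else l.2 :: s
  else [::].

Definition is_box (g : gen) : bool := if g is Box _ then true else false.
Definition crossings (w : word) : seq gen := [seq g <- gens w | ~~ is_box g].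

Definition is_nil (A : Type) (s : seq A) : bool := if s is [::] then true else false.

(* Candidate instances of naturality: the crossing next to the box in the
   first word of the rule occurs in [w]. *)
Definition nats (back : bool) (gs : seq gen) (w : word) : seq (gen * nat * bool * bool) :=
  let cs := crossings w in
  flatten [seq
    let U := if back then gdom ar g else gcod ar g in
    if U is u :: U' then
      let u' := last u U' in
      flatten [seq match c with
        | Crs i j => (if eqn i u' then [:: (g, j, false, false)] else [::]) ++
                     (if eqn j u then [:: (g, i, true, false)] else [::])
        | CrsV i j => (if eqn j u' then [:: (g, i, false, true)] else [::]) ++
                      (if eqn i u then [:: (g, j, true, true)] else [::])
        | _ => [::] end | c <- cs]
    else [::] | g <- gs].

Definition natmoves (back : bool) (gs : seq gen) (w : word) : seq (seq cmd) :=
  flatten [seq (let: (g, z, l, v) := x in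
     rulesof (Nat g z l v back) (nat_rule ar g z l v back) w) | x <- nats back gs w].

Definition cancels (w : word) : seq (seq cmd) :=
  flatten [seq match c with
    | Crs i j => rulesof (Cancel i j true) (cancel_rule i j true) w ++
                 rulesof (Cancel i j false) (cancel_rule i j false) w
    | _ => [::] end | c <- crossings w].

Definition ohead (A : Type) (s : seq A) : option A := if s is x :: _ then Some x else None.

Definition movable (back : bool) (g : gen) : bool :=
  is_box g && (if back then ~~ is_nil (gdom ar g) else ~~ is_nil (gcod ar g)).

(* One step towards crossings before boxes ([back = false]) or after them. *)
Definition norm1 (back : bool) (X : seq nat) (w : word) : option (seq cmd * word) :=
  if ohead (tryall X w (cancels w)) is Some r then Some r else
  let gs := [seq g <- gens w | movable back g] in
  let ds := [seq g <- gens w | is_box g && is_nil (if back then gcod ar g else gdom ar g)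
               && ~~ is_nil (if back then gdom ar g else gcod ar g)] in
  let es := [seq g <- gens w | is_box g && is_nil (if back then gdom ar g else gcod ar g)] in
  if ohead (tryall X w (natmoves back ds w ++ natmoves (~~ back) es w)) is Some r
  then Some r else
  ohead (tryall X w (natmoves back gs w)).

Fixpoint norm (fuel : nat) (back : bool) (X : seq nat) (w : word) : seq cmd * word :=
  if fuel is f.+1 then
    if norm1 back X w is Some (cs, v) then
      let: (cs', u) := norm f back X v in (cs ++ cs', u)
    else ([::], w)
  else ([::], w).

Definition glt (l m : layer) : bool :=
  let code g := match g with
    | Box i => (0, i, 0) | Crs i j => (1, i, j) | CrsV i j => (2, i, j)
    end in
  let lt a b := leb a.+1 b in
  let: (a, b, c) := code l.2 in let: (a', b', c') := code m.2 in
  lt l.1 m.1 || eqn l.1 m.1 && (lt a a' || eqn a a' && (lt b b' || eqn b b' && lt c c')).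

Fixpoint least (s : seq (layer * word)) : option (layer * word) :=
  if s is x :: s' then
    if least s' is Some y then (if glt y.1 x.1 then Some y else Some x) else Some x
  else None.

(** A representative up to interchange, taking greedily the least layer that can come first; it
    serves to discard words already met. *)
Fixpoint canon (fuel : nat) (w : word) : word :=
  if fuel is f.+1 then
    if least (firsts [::] w) is Some (l, v) then l :: canon f v else [::]
  else w.

Definition moves (all : bool) (X : seq nat) (w : word) : seq (seq cmd * word) :=
  let gs := if all then gens w else crossings w in
  tryall X w (cancels w ++ natmoves false gs w ++ natmoves true gs w).

Fixpoint bfs (A : Type) (all : bool) (fuel : nat) (X : seq nat) (test : word -> option A)
    (seen : seq word) (todo : seq (seq cmd * word)) : option (seq cmd * A) :=
  match fuel, todo with
  | f.+1, (cs, w) :: todo' =>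
      if test w is Some a then Some (cs, a) else
      let new := [seq (x.1, x.2, canon (size x.2) x.2) | x <- moves all X w] in
      let: (seen', next) := foldl (fun acc x => let: (c, v, n) := x in
         let: (s, t) := acc in
         if has (eqw n) s then acc else (n :: s, (cs ++ c, v) :: t)) (seen, [::]) new in
      bfs all f X test seen' (todo' ++ rev next)
  | _, _ => None
  end.

(** Cancellations and moves of crossings across crossings are tried first, since moving boxes as
    well enlarges the search; 600 and 300 bound the number of words examined. *)
Definition search (A : Type) (X : seq nat) (test : word -> option A) (w : word) :=
  let start all n := bfs all n X test [:: canon (size w) w] [:: ([::], w)] in
  if start false 600 is Some r then Some r else start true 300.

Definition distinct (s : seq (seq cmd * word)) : seq (seq cmd * word) :=
  unzip1 (foldr (fun x acc => let c := canon (size x.2) x.2 in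
    if has (fun y => eqw y.2 c) acc then acc else (x, c) :: acc) [::] s).

(* Creates strands as early ([b]) or as late as possible. *)
Fixpoint units (b : bool) (fuel : nat) (w : word) : word :=
  if fuel is f.+1 then
    let s := firsts [::] w in
    let t := [seq x <- s | eqb (is_nil (gdom ar x.1.2)) b] in
    if t ++ (if b then s else rev s) is (l, v) :: _ then l :: units b f v else [::]
  else w.

Definition apply_all (X : seq nat) (i : nat) (w : word) : seq (seq cmd * word) :=
  let once v := tryall X v (rulesof (Apply i) (nth norule rules i) v) in
  let s := once w in
  if s is _ :: _ then s else
  let try b :=
    let v := units b (size w) w in
    if align 0 w v is Some cs then [seq (cs ++ x.1, x.2) | x <- once v] else [::] in
  if try true is (_ :: _) as s then s else try false.

Inductive ucmd :=
  | URule of nat & nat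
  | UEarly | ULate.

Definition step (X : seq nat) (c : ucmd) (w : word) : option (seq cmd * word) :=
  match c with
  | URule i occ =>
     let test v :=
       let s := apply_all X i v in
       if occ is 0 then ohead s else ohead (drop occ (distinct s)) in
     if test w is Some r then Some r else
     if search X test w is Some (cs, (cs', v)) then Some (cs ++ cs', v) else None
  | UEarly => Some (norm 200 false X w)
  | ULate => Some (norm 200 true X w)
  end.

Fixpoint steps (X : seq nat) (us : seq ucmd) (w : word) : option (seq cmd * word) :=
  if us is u :: us' then
    if step X u w is Some (cs, v) then
      if steps X us' v is Some (cs', v') then Some (cs ++ cs', v') else None
    else None
  else Some ([::], w).

End Search.

Definition solve ar (es : seq (mexp * mexp)) (l r : mexp) (ul ur : seq ucmd) :
    option (seq cmd * seq cmd) :=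
  let rs := [seq erule ar e | e <- es] in
  if mtyp ar l is Some (X, _) then
    match steps ar rs X ul (flat ar l), steps ar rs X ur (flat ar r) with
    | Some (cl, v), Some (cr, w) =>
      if search ar rs X (fun u => align ar 0 u w) v is Some (cs, cs')
      then Some (cl ++ cs ++ cs', cr) else None
    | _, _ => None
    end
  else None.

(** Reification learns the type of an atomic arrow by instance search. Hypotheses of the context
    count as instances, hence the many typing facts stated just before [diag] and [dhom]. *)
Class Hom (B : smcat) (f : mor B) (X Y : ob B) := hom_pf : f ∷ X ⇒ Y.

Definition early := tt.
Definition late := tt.
Definition occ (n : nat) (A : Type) (x : A) := x.

(* [diag (e1, e2)] rewrites the left-hand side of an equation of arrows with the
   equations [e1] and [e2], up to the axioms of a braided category; [early] and
   [late] move the crossings before, resp. after, the boxes.  [diag2] rewrites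
   both sides.  The search only produces a certificate for [check_sound]. *)
Ltac d_add x l :=
  lazymatch l with
  | context [@cons _ x _] => l
  | _ => constr:(cons x l)
  end.

Ltac d_idx x l :=
  lazymatch l with
  | cons x _ => constr:(O)
  | cons _ ?l' => let n := d_idx x l' in constr:(S n)
  end.

Ltac d_mors f l :=
  lazymatch f with
  | comp ?g ?h => let l := d_mors g l in d_mors h l
  | tensm ?g ?h => let l := d_mors g l in d_mors h l
  | idm _ => l
  | br _ _ _ => l
  | inv (br _ _ _) => l
  | _ => d_add f l
  end.

Ltac d_obs X l :=
  lazymatch X with
  | tens ?Y ?Z => let l := d_obs Y l in d_obs Z l
  | tunit => l
  | _ => d_add X l
  end.

Ltac d_mobs f l :=
  lazymatch f with
  | comp ?g ?h => let l := d_mobs g l in d_mobs h l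
  | tensm ?g ?h => let l := d_mobs g l in d_mobs h l
  | idm ?X => d_obs X l
  | br _ ?X ?Y => let l := d_obs X l in d_obs Y l
  | inv (br _ ?X ?Y) => let l := d_obs X l in d_obs Y l
  | _ => l
  end.

Ltac d_ob os X :=
  lazymatch X with
  | tens ?Y ?Z => let y := d_ob os Y in let z := d_ob os Z in constr:(OTens y z)
  | tunit => constr:(OUnit)
  | _ => let n := d_idx X os in constr:(OAt n)
  end.

Ltac d_mor os gm f :=
  lazymatch f with
  | comp ?g ?h => let g := d_mor os gm g in let h := d_mor os gm h in constr:(MComp g h)
  | tensm ?g ?h => let g := d_mor os gm g in let h := d_mor os gm h in constr:(MTens g h)
  | idm ?X => let x := d_ob os X in constr:(MId x)
  | br _ ?X ?Y => let x := d_ob os X in let y := d_ob os Y in constr:(MBr x y)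
  | inv (br _ ?X ?Y) => let x := d_ob os X in let y := d_ob os Y in constr:(MBrV x y)
  | _ => let n := d_idx f gm in constr:(MBox n)
  end.

Ltac d_cmds t acc :=
  lazymatch t with
  | (?a, ?b) => let acc := d_cmds a acc in d_cmds b acc
  | tt => acc
  | _ =>
    lazymatch acc with
    | (?n, ?ps, ?us) =>
      lazymatch t with
      | early => constr:((n, ps, cons UEarly us))
      | late => constr:((n, ps, cons ULate us))
      | occ ?k ?p => constr:((S n, (p, ps), cons (URule n k) us))
      | ?p => constr:((S n, (p, ps), cons (URule n 0) us))
      end
    end
  end.

Ltac d_eqs f ps l :=
  lazymatch ps with
  | (?p, ?ps) =>
    let T := type of p in
    let T := eval cbv beta in T in
    lazymatch T with
    | @eq _ ?a ?b => let l := f a l in let l := f b l in d_eqs f ps l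
    end
  | _ => l
  end.

Ltac d_homs gm os :=
  lazymatch gm with
  | cons ?f ?gm =>
    let p := constr:(@hom_pf _ f _ _ _) in
    lazymatch type of p with
    | hom _ ?X ?Y => let os := d_obs X os in let os := d_obs Y os in d_homs gm os
    | Hom _ ?X ?Y => let os := d_obs X os in let os := d_obs Y os in d_homs gm os
    end
  | _ => os
  end.

Ltac d_ar os gm :=
  lazymatch gm with
  | cons ?f ?gm =>
    let p := constr:(@hom_pf _ f _ _ _) in
    lazymatch d_ar os gm with
    | (?ar, ?pf) =>
      lazymatch type of p with
      | hom _ ?X ?Y => let x := d_ob os X in let y := d_ob os Y in
          constr:((cons (x, y) ar, conj p pf))
      | Hom _ ?X ?Y => let x := d_ob os X in let y := d_ob os Y in
          constr:((cons (x, y) ar, conj p pf))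
      end
    end
  | _ => constr:((@nil (oexp * oexp), I))
  end.

Ltac d_rules os gm ps es pf :=
  lazymatch ps with
  | (?p, ?ps) =>
    let T := type of p in
    let T := eval cbv beta in T in
    lazymatch T with
    | @eq _ ?a ?b =>
      let x := d_mor os gm a in let y := d_mor os gm b in
      d_rules os gm ps constr:(cons (x, y) es) constr:(conj p pf)
    end
  | _ => constr:((es, pf))
  end.

Ltac diag2 tl tr :=
  lazymatch goal with
  | |- @eq (mor ?B) ?l ?r =>
    let B := lazymatch B with smcat_cat (brcat_smcat ?B) => B end in
    lazymatch d_cmds tl constr:((O, tt, @nil ucmd)) with
    | (?n, ?ps, ?ul) =>
      lazymatch d_cmds tr constr:((n, ps, @nil ucmd)) with
      | (_, ?ps, ?ur) =>
        let gm := d_mors l constr:(@nil (mor B)) in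
        let gm := d_mors r gm in
        let gm := d_eqs d_mors ps gm in
        let os := d_mobs l constr:(@nil (ob B)) in
        let os := d_mobs r os in
        let os := d_eqs d_mobs ps os in
        let os := d_homs gm os in
        lazymatch d_ar os gm with
        | (?oar, ?gpf) =>
          lazymatch d_rules os gm ps constr:(@nil (mexp * mexp)) I with
          | (?es, ?epf) =>
            let x := d_mor os gm l in let y := d_mor os gm r in
            let res := eval vm_compute in
              (solve (ars oar) es x y (rev ul) (rev ur)) in
            lazymatch res with
            | Some (?cl, ?cr) =>
              exact (@check_sound B os oar gm es x y cl cr gpf epf
                (eq_refl true <: check (ars oar) es x y cl cr = true))
            | None => fail 1 "the diagrams do not match"
            end
          end
        end
      end
    end
  end.

Ltac diag tl := diag2 tl tt.

Ltac dhom :=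
  lazymatch goal with
  | |- @hom ?B ?f ?X ?Y =>
    let B := lazymatch B with smcat_cat (brcat_smcat ?B) => B end in
    let gm := d_mors f constr:(@nil (mor B)) in
    let os := d_mobs f constr:(@nil (ob B)) in
    let os := d_homs gm os in let os := d_obs X os in let os := d_obs Y os in
    lazymatch d_ar os gm with
    | (?oar, ?gpf) =>
      let e := d_mor os gm f in let x := d_ob os X in let y := d_ob os Y in
      exact (@hom_sound B os oar gm e x y gpf
        (eq_refl true <: hom_check (ars oar) e x y = true))
    end
  end.

#[export] Instance mul_Hom (B : brcat) (H : bialgebra B) :
  Hom (mul H) (carrier H ⊗ carrier H) (carrier H) := mul_hom H.
#[export] Instance one_Hom (B : brcat) (H : bialgebra B) :
  Hom (one H) tunit (carrier H) := one_hom H.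
#[export] Instance comul_Hom (B : brcat) (H : bialgebra B) :
  Hom (comul H) (carrier H) (carrier H ⊗ carrier H) := comul_hom H.
#[export] Instance counit_Hom (B : brcat) (H : bialgebra B) :
  Hom (counit H) (carrier H) tunit := counit_hom H.
#[export] Instance antipode_Hom (B : brcat) (H : hopf B) :
  Hom (antipode H) (carrier H) (carrier H) := antipode_hom H.
#[export] Instance ldev_Hom (B : smcat) (d : autonomous B) X :
  Hom (ldev d X) (ld d X ⊗ X) tunit := ldev_hom d X.
#[export] Instance ldcoev_Hom (B : smcat) (d : autonomous B) X :
  Hom (ldcoev d X) tunit (X ⊗ ld d X) := ldcoev_hom d X.
#[export] Instance rdev_Hom (B : smcat) (d : autonomous B) X :
  Hom (rdev d X) (X ⊗ rd d X) tunit := rdev_hom d X.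
#[export] Instance rdcoev_Hom (B : smcat) (d : autonomous B) X :
  Hom (rdcoev d X) tunit (rd d X ⊗ X) := rdcoev_hom d X.
#[export] Hint Extern 0 (Hom _ _ _) => (unfold Hom; eassumption) : typeclass_instances.

Lemma inv_antipode_hom (B : brcat) (H : hopf B) :
  inv (antipode H) ∷ carrier H ⇒ carrier H.
Proof. by split; rewrite ?inv_antipode_dom ?inv_antipode_cod. Qed.
#[export] Instance inv_antipode_Hom (B : brcat) (H : hopf B) :
  Hom (inv (antipode H)) (carrier H) (carrier H) := inv_antipode_hom H.

Section Braid.

Variable B : brcat.
Implicit Types P Q H : ob B.

Lemma inv_braidK P Q : inv (τ P Q) ∘ τ P Q = idm (P ⊗ Q).
Proof. by have [_ _ + _] := inv_br P Q; rewrite br_dom. Qed.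

(** A strand slides past a cup by naturality, and one of the two resulting crossings is moved to the
    other side. The search does not guess this insertion of inverse crossings, so it is provided as
    a rule. *)
Lemma cup_braid c P Q H : c ∷ tunit ⇒ P ⊗ Q ->
  (idm P ⊠ τ Q H) ∘ (c ⊠ idm H) = (inv (τ P H) ⊠ idm Q) ∘ (idm H ⊠ c).
Proof.
move=> ch.
transitivity ((inv (τ P H) ⊠ idm Q) ∘ (τ P H ⊠ idm Q) ∘ (idm P ⊠ τ Q H) ∘ (c ⊠ idm H)).
  by apply/esym; diag (inv_braidK P H).
by diag (br_natl H ch).
Qed.

End Braid.

(** * Antipodes *)

Section Antipode.

Variable B : brcat.

Section Convolution.

Variables (X Y : ob B) (D e m u : mor B).
Hypotheses (Dh : D ∷ X ⇒ X ⊗ X) (eh : e ∷ X ⇒ tunit).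
Hypotheses (mh : m ∷ Y ⊗ Y ⇒ Y) (uh : u ∷ tunit ⇒ Y).
Hypothesis DA : (idm X ⊠ D) ∘ D = (D ⊠ idm X) ∘ D.
Hypothesis De1 : (e ⊠ idm X) ∘ D = idm X.
Hypothesis D1e : (idm X ⊠ e) ∘ D = idm X.
Hypothesis mA : m ∘ (idm Y ⊠ m) = m ∘ (m ⊠ idm Y).
Hypothesis mu1 : m ∘ (u ⊠ idm Y) = idm Y.
Hypothesis m1u : m ∘ (idm Y ⊠ u) = idm Y.

(** In the convolution monoid a left and a right inverse of [g] agree, by computing [f g h] in two
    ways. The coalgebra and the algebra are unbundled because [H ⊗ H] is used in either role. *)
Lemma convolution_inverse_uniq f g h : f ∷ X ⇒ Y -> g ∷ X ⇒ Y -> h ∷ X ⇒ Y ->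
  m ∘ (f ⊠ g) ∘ D = u ∘ e -> m ∘ (g ⊠ h) ∘ D = u ∘ e -> f = h.
Proof.
move=> fh gh hh fg gk.
transitivity (m ∘ (f ⊠ (m ∘ (g ⊠ h) ∘ D)) ∘ D).
  by apply/esym; diag (gk, D1e, m1u).
by diag (mA, DA, fg, De1, mu1).
Qed.

End Convolution.

Section Bialgebra.

Variables (H : bialgebra B) (S : mor B).
Local Notation h := (idm (carrier H)).
Local Notation m := (mul H).
Local Notation D := (comul H).
Local Notation u := (one H).
Local Notation e := (counit H).
Local Notation t := (τ (carrier H) (carrier H)).

Hypothesis Sh : S ∷ H ⇒ H.
Hypothesis Sl : m ∘ (S ⊠ h) ∘ D = u ∘ e.
Hypothesis Sr : m ∘ (h ⊠ S) ∘ D = u ∘ e.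

(** For the convolution of arrows from [H ⊗ H] to [H], the two sides are a left and a right inverse
    of [m]. *)
Lemma antimul : S ∘ m = m ∘ t ∘ (S ⊠ S).
Proof.
apply: (@convolution_inverse_uniq (H ⊗ H) H ((h ⊠ t ⊠ h) ∘ (D ⊠ D)) (e ⊠ e) m u
  _ _ _ _ _ _ _ (mulA H) (mul1h H) (mulh1 H) _ m); try dhom.
- by diag2 (late, comulA H, comulA H) (late).
- by diag (late, comul1h H, comul1h H).
- by diag (late, comulh1 H, comulh1 H).
- by diag (esym (comul_mul H), Sl, counit_mul H).
- by diag (esym (mulA H), mulA H, early, Sr, late, mul1h H, Sr).
Qed.

(** Dually, the two sides are a left and a right inverse of [D] for the convolution of arrows from
    [H] to [H ⊗ H]. *)
Lemma anticomul : D ∘ S = (S ⊠ S) ∘ t ∘ D.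
Proof.
apply: (@convolution_inverse_uniq H (H ⊗ H) D e ((m ⊠ m) ∘ (h ⊠ t ⊠ h)) (u ⊠ u)
  _ _ _ _ (comulA H) (comul1h H) (comulh1 H) _ _ _ _ D); try dhom.
- by diag2 (early, mulA H, mulA H) (early).
- by diag (late, mul1h H, mul1h H).
- by diag (late, mulh1 H, mulh1 H).
- by diag (esym (comul_mul H), Sl, comul_one H).
- by diag (comulA H, occ 1 (esym (comulA H)), late, Sr, early, comulh1 H, Sr).
Qed.

Lemma antione : S ∘ u = u.
Proof.
transitivity (m ∘ (S ⊠ h) ∘ D ∘ u); last by diag (Sl, counit_one H).
by apply/esym; diag (comul_one H, mulh1 H).
Qed.

Lemma anticounit : e ∘ S = e.
Proof.
transitivity (e ∘ m ∘ (S ⊠ h) ∘ D); last by diag (Sl, counit_one H).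
by apply/esym; diag (counit_mul H, comulh1 H).
Qed.

Local Notation t' := (inv t).

(** Applying [S] to the equation of [T] on the right, or precomposing the other one with [S], and
    using antimultiplicativity, resp. anticomultiplicativity, shows that [S ∘ T], resp. [T ∘ S], is
    a right convolution inverse of [S], as the identity is. *)
Lemma antipode_inverse T : T ∷ H ⇒ H ->
  m ∘ t' ∘ (T ⊠ h) ∘ D = u ∘ e -> m ∘ t' ∘ (h ⊠ T) ∘ D = u ∘ e -> inverse S T.
Proof.
move=> Th Tl Tr.
have uniq f : f ∷ H ⇒ H -> m ∘ (S ⊠ f) ∘ D = u ∘ e -> f = h.
  move=> fh Sf; apply/esym; apply: (@convolution_inverse_uniq H H D e m u
    _ _ _ _ (comulA H) (comul1h H) (comulh1 H) (mulA H) (mul1h H) (mulh1 H) _ S) => //.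
  all: try dhom.
have ST : S ∘ T = h.
  apply: uniq; first dhom.
  transitivity (S ∘ m ∘ t' ∘ (h ⊠ T) ∘ D); last by diag (Tr, antione).
  by apply/esym; diag2 (antimul, early) (early).
have TS : T ∘ S = h.
  apply: uniq; first dhom.
  transitivity (m ∘ t' ∘ (T ⊠ h) ∘ D ∘ S); last by diag (Tl, anticounit).
  by apply/esym; diag2 (anticomul, early) (early).
by case: (Sh) (Th) => dS cS [dT cT]; split; rewrite ?dS ?cS ?dT ?cT.
Qed.

End Bialgebra.

Section Hopf.

Variable H : hopf B.
Local Notation h := (idm (carrier H)).
Local Notation S := (antipode H).
Local Notation S' := (inv S).
Local Notation m := (mul H).
Local Notation D := (comul H).
Local Notation u := (one H).
Local Notation e := (counit H).
Local Notation t := (τ (carrier H) (carrier H)).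
Local Notation t' := (inv t).

Lemma antipode_mul : S ∘ m = m ∘ t ∘ (S ⊠ S).
Proof. exact: antimul (antipode_hom H) (antipode_l H) (antipode_r H). Qed.

Lemma antipode_comul : D ∘ S = (S ⊠ S) ∘ t ∘ D.
Proof. exact: anticomul (antipode_hom H) (antipode_l H) (antipode_r H). Qed.

Lemma antipode_one : S ∘ u = u.
Proof. exact: antione (antipode_hom H) (antipode_l H). Qed.

Lemma counit_antipode : e ∘ S = e.
Proof. exact: anticounit (antipode_hom H) (antipode_l H). Qed.

Lemma antipodeK : S' ∘ S = h.
Proof. by have [_ _ + _] := invP (antipode_iso H); rewrite antipode_dom. Qed.

Lemma antipodeVK : S ∘ S' = h.
Proof. by have [_ _ _] := invP (antipode_iso H); rewrite antipode_cod. Qed.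

Lemma inv_antipode_one : S' ∘ u = u.
Proof.
transitivity (S' ∘ S ∘ u); first by apply/esym; diag (antipode_one).
by diag (antipodeK).
Qed.

(** Under the invertible arrow [S], which reverses products, this becomes [antipode_r]. *)
Lemma skew_antipode_l : m ∘ t' ∘ (S' ⊠ h) ∘ D = u ∘ e.
Proof.
transitivity (S' ∘ S ∘ m ∘ t' ∘ (S' ⊠ h) ∘ D); first by apply/esym; diag (antipodeK).
by diag (antipode_mul, late, antipodeVK, antipode_r H, inv_antipode_one).
Qed.

Lemma skew_antipode_r : m ∘ t' ∘ (h ⊠ S') ∘ D = u ∘ e.
Proof.
transitivity (S' ∘ S ∘ m ∘ t' ∘ (h ⊠ S') ∘ D); first by apply/esym; diag (antipodeK).
by diag (antipode_mul, late, antipodeVK, antipode_l H, inv_antipode_one).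
Qed.

End Hopf.

End Antipode.

(** * The centralizer *)

(* The universal property of the centralizer, with an additional parameter [V]
   on the right; parameters on the left are reached through the braiding. *)
Record centralizer (B : smcat) (A Z : ob B) (delta : ob B -> mor B) : Prop :=
  Centralizer {
  cz_hom : forall Y, delta Y ∷ Y ⇒ Y ⊗ A ⊗ Z;
  cz_nat : forall f X Y, f ∷ X ⇒ Y -> (f ⊠ idm (A ⊗ Z)) ∘ delta X = delta Y ∘ f;
  cz_exists : forall V W xi, (forall Y, xi Y ∷ Y ⊗ V ⇒ Y ⊗ A ⊗ W) ->
    (forall f X Y, f ∷ X ⇒ Y -> (f ⊠ idm (A ⊗ W)) ∘ xi X = xi Y ∘ (f ⊠ idm V)) ->
    exists2 r, r ∷ Z ⊗ V ⇒ W &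
      forall Y, (idm (Y ⊗ A) ⊠ r) ∘ (delta Y ⊠ idm V) = xi Y;
  cz_uniq : forall V W r r', r ∷ Z ⊗ V ⇒ W -> r' ∷ Z ⊗ V ⇒ W ->
    (forall Y, (idm (Y ⊗ A) ⊠ r) ∘ (delta Y ⊠ idm V) =
       (idm (Y ⊗ A) ⊠ r') ∘ (delta Y ⊠ idm V)) -> r = r' }.

Section Coend.

Variables (B : brcat) (d : autonomous B) (C : coend d) (A : hopf B).
Local Notation "∨ X" := (ld d X) (at level 30, right associativity).

#[local] Instance coend_in_Hom Y : Hom (coend_in C Y) (∨ Y ⊗ Y) (coend_ob C).
Proof. by case: (coend_in_dinatural C) => /(_ Y). Qed.

Lemma ldual_coev f X Y : f ∷ X ⇒ Y ->
  (f ⊠ idm (∨ X)) ∘ ldcoev d X = (idm Y ⊠ ldual d f) ∘ ldcoev d Y.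
Proof. by move=> fh; rewrite /ldual; case: (fh) => -> ->; apply/esym; diag (ld_zigzag1 d Y). Qed.

Lemma ldual_ev f X Y : f ∷ X ⇒ Y ->
  ldev d X ∘ (ldual d f ⊠ idm X) = ldev d Y ∘ (idm (∨ Y) ⊠ f).
Proof. by move=> fh; rewrite /ldual; case: (fh) => -> ->; diag (ld_zigzag1 d X). Qed.

Lemma ld_tens_coev X Y : (idm (X ⊗ Y) ⊠ ld_tens d X Y) ∘ ldcoev d (X ⊗ Y) =
  (idm X ⊠ ldcoev d Y ⊠ idm (∨ X)) ∘ ldcoev d X.
Proof. by rewrite /ld_tens; diag (ld_zigzag1 d (X ⊗ Y)). Qed.

Lemma coend_in_nat f X Y : f ∷ X ⇒ Y ->
  coend_in C X ∘ (ldual d f ⊠ idm X) = coend_in C Y ∘ (idm (∨ Y) ⊠ f).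
Proof. by case=> dX cY; case: (coend_in_dinatural C) => _ /(_ f); rewrite dX cY. Qed.

(** Splitting the coevaluation of [Y ⊗ A] removes the comparison [ld_tens] of independently chosen
    duals once and for all. *)
Lemma deltaE Y : delta C A Y = (idm (Y ⊗ A ⊗ ∨ A) ⊠ coend_in C Y)
  ∘ (idm Y ⊠ ldcoev d A ⊠ idm (∨ Y ⊗ Y)) ∘ (ldcoev d Y ⊠ idm Y).
Proof.
rewrite /delta /iZ.
have lh : ld_tens d Y A ∷ ∨ (Y ⊗ A) ⇒ ∨ A ⊗ ∨ Y by rewrite /ld_tens; dhom.
by diag (ld_tens_coev Y A).
Qed.

Lemma delta_natural f X Y : f ∷ X ⇒ Y ->
  (f ⊠ idm (A ⊗ ZA C A)) ∘ delta C A X = delta C A Y ∘ f.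
Proof.
move=> fh; rewrite !deltaE /ZA.
have fdh : ldual d f ∷ ∨ Y ⇒ ∨ X.
  by case: (fh) => dX cY; rewrite /ldual dX cY; dhom.
by diag2 (ldual_coev fh, coend_in_nat fh) tt.
Qed.

Lemma centralizer_delta : centralizer A (ZA C A) (delta C A).
Proof.
split.
- by move=> Y; rewrite deltaE /ZA; dhom.
- exact: delta_natural.
- move=> V W xi xih xin.
  (* To reach the form required by the coend, the output [Y] is evaluated against a dual input and
     the parameter [V] is bent into an output [∨ V]. *)
  have [r0 [[r0h r0E] _]] : exists! r, r ∷ C ⇒ A ⊗ W ⊗ ∨ V /\
      (forall Y, r ∘ coend_in C Y = (ldev d Y ⊠ idm (A ⊗ W ⊗ ∨ V))
        ∘ (idm (∨ Y) ⊠ xi Y ⊠ idm (∨ V)) ∘ (idm (∨ Y ⊗ Y) ⊠ ldcoev d V)).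
    apply: coend_universal; split=> [Y|f].
      by have ? := xih Y; dhom.
    have [X [Y fh]] : exists X Y, f ∷ X ⇒ Y by exists (dom f), (cod f).
    case: (fh) => -> ->.
    have fdh : ldual d f ∷ ∨ Y ⇒ ∨ X.
      by case: (fh) => dX cY; rewrite /ldual dX cY; dhom.
    have ? := xih X; have ? := xih Y.
    by diag (ldual_ev fh, xin _ _ _ fh).
  exists ((ldev d A ⊠ idm W ⊠ ldev d V) ∘ (idm (∨ A) ⊠ r0 ⊠ idm V)).
    by rewrite /ZA; dhom.
  move=> Y; have ? := xih Y; rewrite deltaE.
  by diag (ld_zigzag1 d A, r0E Y, ld_zigzag1 d Y, ld_zigzag1 d V).
- move=> V W r r'; rewrite /ZA => rh rh' e.
  (* Bending [∨ A] and [V] is reversible, so it is enough to compare arrows out of [C], where the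
     coend applies. *)
  have E (s : mor B) : s ∷ ∨ A ⊗ C ⊗ V ⇒ W -> s = (ldev d A ⊠ idm W ⊠ ldev d V)
    ∘ (idm (∨ A) ⊠ ((idm A ⊠ s ⊠ idm (∨ V)) ∘ (ldcoev d A ⊠ idm C ⊠ ldcoev d V)) ⊠ idm V).
    by move=> sh; apply/esym; diag (ld_zigzag2 d A, ld_zigzag1 d V).
  rewrite (E r rh) (E r' rh'); congr (_ ∘ (_ ⊠ _ ⊠ _)).
  have F (s : mor B) Y : s ∷ ∨ A ⊗ C ⊗ V ⇒ W ->
    ((idm A ⊠ s ⊠ idm (∨ V)) ∘ (ldcoev d A ⊠ idm C ⊠ ldcoev d V)) ∘ coend_in C Y =
    (ldev d Y ⊠ idm (A ⊗ W ⊗ ∨ V))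
    ∘ (idm (∨ Y) ⊠ ((idm (Y ⊗ A) ⊠ s) ∘ (delta C A Y ⊠ idm V)) ⊠ idm (∨ V))
    ∘ (idm (∨ Y ⊗ Y) ⊠ ldcoev d V).
    by move=> sh; rewrite deltaE; apply/esym; diag (ld_zigzag2 d Y).
  have [r0 [_ u]] : exists! s, s ∷ C ⇒ A ⊗ W ⊗ ∨ V /\ (forall Y, s ∘ coend_in C Y = 
    (ldev d Y ⊠ idm (A ⊗ W ⊗ ∨ V))
    ∘ (idm (∨ Y) ⊠ ((idm (Y ⊗ A) ⊠ r) ∘ (delta C A Y ⊠ idm V)) ⊠ idm (∨ V))
    ∘ (idm (∨ Y ⊗ Y) ⊠ ldcoev d V)).
    apply: coend_universal; split=> [Y|f].
      by rewrite deltaE; dhom.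
    have [X [Y fh]] : exists X Y, f ∷ X ⇒ Y by exists (dom f), (cod f).
    rewrite -!F //; case: (fh) => -> ->.
    have fdh : ldual d f ∷ ∨ Y ⇒ ∨ X.
      by case: (fh) => dX cY; rewrite /ldual dX cY; dhom.
    by diag (coend_in_nat fh).
  rewrite -(u ((idm A ⊠ r ⊠ idm (∨ V)) ∘ (ldcoev d A ⊠ idm C ⊠ ldcoev d V))).
    apply: u; split; first dhom.
    by move=> Y; rewrite F // e.
  by split; [dhom | move=> Y; rewrite F].
Qed.

End Coend.

(** * The Hopf algebra Z(A) *)

Section Universal.

Variables (B : brcat) (A Z : ob B) (delta : ob B -> mor B).
Hypothesis zP : centralizer A Z delta.

Let delta_Hom Y : Hom (delta Y) Y (Y ⊗ A ⊗ Z) := cz_hom zP Y.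
#[local] Existing Instance delta_Hom.


(** The parameter [P] is carried across [Z] by the inverse braiding; there it joins [V] and
    [cz_uniq] applies. *)
Lemma centralizer_uniq P V W r r' : r ∷ P ⊗ Z ⊗ V ⇒ W -> r' ∷ P ⊗ Z ⊗ V ⇒ W ->
  (forall Y, (idm (Y ⊗ A) ⊠ r) ∘ (τ P (Y ⊗ A) ⊠ idm (Z ⊗ V)) ∘ (idm P ⊠ delta Y ⊠ idm V) =
     (idm (Y ⊗ A) ⊠ r') ∘ (τ P (Y ⊗ A) ⊠ idm (Z ⊗ V)) ∘ (idm P ⊠ delta Y ⊠ idm V)) ->
  r = r'.
Proof.
move=> rh rh' e.
have E s : s ∷ P ⊗ Z ⊗ V ⇒ W -> s = (s ∘ (inv (τ P Z) ⊠ idm V)) ∘ (τ P Z ⊠ idm V).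
  by move=> sh; apply/esym; diag (inv_braidK P Z).
rewrite (E r) // (E r') //; congr (_ ∘ _).
apply: (cz_uniq zP (V := P ⊗ V) (W := W)); try dhom.
move=> Y.
have F s : s ∷ P ⊗ Z ⊗ V ⇒ W -> (idm (Y ⊗ A) ⊠ (s ∘ (inv (τ P Z) ⊠ idm V)))
    ∘ (delta Y ⊠ idm (P ⊗ V)) =
  ((idm (Y ⊗ A) ⊠ s) ∘ (τ P (Y ⊗ A) ⊠ idm (Z ⊗ V)) ∘ (idm P ⊠ delta Y ⊠ idm V))
    ∘ (inv (τ P Y) ⊠ idm V).
  by move=> sh; diag2 late (late).
by rewrite !F // e.
Qed.

Lemma centralizer_exists P V W xi : (forall Y, xi Y ∷ P ⊗ Y ⊗ V ⇒ Y ⊗ A ⊗ W) ->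
  (forall f X Y, f ∷ X ⇒ Y ->
     (f ⊠ idm (A ⊗ W)) ∘ xi X = xi Y ∘ (idm P ⊠ f ⊠ idm V)) ->
  exists2 r, r ∷ P ⊗ Z ⊗ V ⇒ W & forall Y,
    (idm (Y ⊗ A) ⊠ r) ∘ (τ P (Y ⊗ A) ⊠ idm (Z ⊗ V)) ∘ (idm P ⊠ delta Y ⊠ idm V) = xi Y.
Proof.
move=> xih xin.
have [Y|f X Y fh|r rh rE] := @cz_exists _ _ _ _ zP (P ⊗ V) W
  (fun Y => xi Y ∘ (inv (τ P Y) ⊠ idm V)).
- by have ? := xih Y; dhom.
- by have ? := xih X; have ? := xih Y; diag2 (xin _ _ _ fh, early) (early).
exists (r ∘ (τ P Z ⊠ idm V)); first dhom.
move=> Y; have ? := xih Y.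
transitivity (xi Y ∘ (inv (τ P Y) ⊠ idm V) ∘ (τ P Y ⊠ idm V)).
  by apply/esym; diag2 (esym (rE Y), early) (early).
by diag early.
Qed.

End Universal.

Section Structure.

Variables (B : brcat) (A : hopf B) (Z : ob B) (delta : ob B -> mor B).
Hypothesis zP : centralizer A Z delta.
Let delta_Hom Y : Hom (delta Y) Y (Y ⊗ A ⊗ Z) := cz_hom zP Y.
#[local] Existing Instance delta_Hom.

Local Notation "'id" := idm (at level 0).
Local Notation T2 X Y := (('id X ⊠ τ Y A ⊠ 'id A) ∘ ('id (X ⊗ Y) ⊠ comul A)).

(** The universal property is used once for each factor [Z]: in [X] for fixed [Y], which gives
    arrows [r Y], and then in [Y], where the naturality of [r] follows from uniqueness in the first
    stage. *)
Lemma centralizer_mul_exists : exists2 m, m ∷ Z ⊗ Z ⇒ Z & forall X Y,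
  ('id (X ⊗ A ⊗ (Y ⊗ A)) ⊠ m) ∘ ('id (X ⊗ A) ⊠ τ Z (Y ⊗ A) ⊠ 'id Z)
      ∘ (delta X ⊠ delta Y) = (T2 X Y ⊠ 'id Z) ∘ delta (X ⊗ Y).
Proof.
have step1 Y : exists r, r ∷ Z ⊗ Y ⇒ Y ⊗ A ⊗ Z /\ forall X,
    ('id (X ⊗ A) ⊠ r) ∘ (delta X ⊠ 'id Y) = (T2 X Y ⊠ 'id Z) ∘ delta (X ⊗ Y).
  have [X|f X X' fh|r rh rE] := @cz_exists _ _ _ _ zP Y (Y ⊗ A ⊗ Z)
    (fun X => (T2 X Y ⊠ 'id Z) ∘ delta (X ⊗ Y)).
  - by dhom.
  - have fYh : f ⊠ 'id Y ∷ X ⊗ Y ⇒ X' ⊗ Y by dhom.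
    by diag (cz_nat zP fYh).
  by exists r.
have [r rP] := choice step1.
have rh Y : r Y ∷ Z ⊗ Y ⇒ Y ⊗ A ⊗ Z by case: (rP Y).
have [Y|f Y Y' fh|m mh mE] := @centralizer_exists _ _ _ _ zP Z tunit Z r.
- by have ? := rh Y; dhom.
- have ? := rh Y; have ? := rh Y'.
  apply: (cz_uniq zP (V := Y) (W := Y' ⊗ A ⊗ Z)); try dhom.
  move=> X; case: (rP Y) (rP Y') => _ /(_ X) e [_ /(_ X) e'].
  have fYh : 'id X ⊠ f ∷ X ⊗ Y ⇒ X ⊗ Y' by dhom.
  by diag2 (e, late, cz_nat zP fYh) (e').
exists m; first by move: mh; rewrite tensx1.
have {}mh : m ∷ Z ⊗ Z ⇒ Z by move: mh; rewrite tensx1.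
move=> X Y; have ? := rh Y; case: (rP Y) => _ /(_ X) <-.
by diag2 tt (esym (mE Y)).
Qed.

Lemma centralizer_comul_exists : exists2 D, D ∷ Z ⇒ Z ⊗ Z & forall X,
  ('id (X ⊗ A) ⊠ D) ∘ delta X =
    ('id X ⊠ mul A ⊠ 'id (Z ⊗ Z)) ∘ (delta (X ⊗ A) ⊠ 'id Z) ∘ delta X.
Proof.
have [X|f X X' fh|r] := @cz_exists _ _ _ _ zP tunit (Z ⊗ Z) (fun X =>
    ('id X ⊠ mul A ⊠ 'id (Z ⊗ Z)) ∘ (delta (X ⊗ A) ⊠ 'id Z) ∘ delta X).
- by dhom.
- have fAh : f ⊠ 'id A ∷ X ⊗ A ⇒ X' ⊗ A by dhom.
  by diag (cz_nat zP fAh, cz_nat zP fh).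
rewrite tensx1 => rh rE; exists r => // X; rewrite -rE; by diag tt.
Qed.

Lemma centralizer_counit_exists : exists2 e, e ∷ Z ⇒ tunit & forall X,
  ('id (X ⊗ A) ⊠ e) ∘ delta X = 'id X ⊠ one A.
Proof.
have [X|f X X' fh|r] := @cz_exists _ _ _ _ zP tunit tunit (fun X => 'id X ⊠ one A).
- by dhom.
- by diag tt.
rewrite tensx1 => rh rE; exists r => // X; rewrite -rE; by diag tt.
Qed.

Variables m u D e : mor B.
Hypothesis mh : m ∷ Z ⊗ Z ⇒ Z.
Hypothesis uh : u ∷ tunit ⇒ Z.
Hypothesis Dh : D ∷ Z ⇒ Z ⊗ Z.
Hypothesis eh : e ∷ Z ⇒ tunit.
Hypothesis mE : forall X Y, ('id (X ⊗ A ⊗ (Y ⊗ A)) ⊠ m)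
  ∘ ('id (X ⊗ A) ⊠ τ Z (Y ⊗ A) ⊠ 'id Z) ∘ (delta X ⊠ delta Y) =
  (T2 X Y ⊠ 'id Z) ∘ delta (X ⊗ Y).
Hypothesis uE : u = (counit A ⊠ 'id Z) ∘ delta tunit.
Hypothesis DE : forall X, ('id (X ⊗ A) ⊠ D) ∘ delta X =
    ('id X ⊠ mul A ⊠ 'id (Z ⊗ Z)) ∘ (delta (X ⊗ A) ⊠ 'id Z) ∘ delta X.
Hypothesis eE : forall X, ('id (X ⊗ A) ⊠ e) ∘ delta X = 'id X ⊠ one A.

(** The three factors [Z] are tested one after the other, the last one first. Both sides become
    [delta (Y1 ⊗ Y2 ⊗ Y3)] followed by a double coproduct of A, and coassociativity remains. *)
Lemma centralizer_mulA : m ∘ ('id Z ⊠ m) = m ∘ (m ⊠ 'id Z).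
Proof.
apply: (centralizer_uniq zP (P := Z ⊗ Z) (V := tunit) (W := Z)); try dhom; move=> Y3.
apply: (centralizer_uniq zP (P := Z) (V := Y3) (W := Y3 ⊗ A ⊗ Z)); try dhom; move=> Y2.
apply: (cz_uniq zP (V := Y2 ⊗ Y3) (W := Y2 ⊗ A ⊗ (Y3 ⊗ A ⊗ Z))); try dhom; move=> Y1.
(* [delta] of an object is an atom for [diag], so the bracketing of that object must agree
   syntactically. *)
have e1 := mE Y1 (Y2 ⊗ Y3); rewrite !tensA in e1.
by diag2 (mE Y2 Y3, e1, late, comulA A) (late, mE Y1 Y2, mE (Y1 ⊗ Y2) Y3, late).
Qed.

Lemma centralizer_mul1 : m ∘ (u ⊠ 'id Z) = 'id Z.
Proof.
apply: (cz_uniq zP (V := tunit) (W := Z)); try dhom; move=> Y.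
have e1 := mE tunit Y; rewrite !tens1x in e1.
by diag (esym (br_natl (Y ⊗ A) uh), uE, e1, late, comul1h A).
Qed.

Lemma centralizer_1mul : m ∘ ('id Z ⊠ u) = 'id Z.
Proof.
apply: (cz_uniq zP (V := tunit) (W := Z)); try dhom; move=> Y.
have e1 := mE Y tunit; rewrite !tensx1 ?tens1x in e1.
by rewrite uE; diag (br_natr Z (counit_hom A), e1, comulh1 A).
Qed.

Lemma centralizer_comulA : ('id Z ⊠ D) ∘ D = (D ⊠ 'id Z) ∘ D.
Proof.
apply: (cz_uniq zP (V := tunit) (W := Z ⊗ Z ⊗ Z)); try dhom; move=> Y.
have mYh : 'id Y ⊠ mul A ∷ Y ⊗ A ⊗ A ⇒ Y ⊗ A by dhom.
have e1 := cz_nat zP mYh.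
by diag2 (DE Y, DE Y, esym e1) (DE Y, DE (Y ⊗ A), mulA A).
Qed.

Lemma centralizer_comul1 : (e ⊠ 'id Z) ∘ D = 'id Z.
Proof.
apply: (cz_uniq zP (V := tunit) (W := Z)); try dhom; move=> Y.
by diag (DE Y, eE (Y ⊗ A), mulh1 A).
Qed.

Lemma centralizer_1comul : ('id Z ⊠ e) ∘ D = 'id Z.
Proof.
apply: (cz_uniq zP (V := tunit) (W := Z)); try dhom; move=> Y.
have uYh : 'id Y ⊠ one A ∷ Y ⇒ Y ⊗ A by dhom.
by diag (DE Y, eE Y, esym (cz_nat zP uYh), mul1h A).
Qed.

Lemma centralizer_comul_mul : D ∘ m = (m ⊠ m) ∘ ('id Z ⊠ τ Z Z ⊠ 'id Z) ∘ (D ⊠ D).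
Proof.
apply: (centralizer_uniq zP (P := Z) (V := tunit) (W := Z ⊗ Z)); try dhom; move=> Y2.
apply: (cz_uniq zP (V := Y2) (W := Y2 ⊗ A ⊗ Z ⊗ Z)); try dhom; move=> Y1.
have T2h : T2 Y1 Y2 ∷ Y1 ⊗ Y2 ⊗ A ⇒ Y1 ⊗ A ⊗ (Y2 ⊗ A) by dhom.
have e1 := mE (Y1 ⊗ A) (Y2 ⊗ A); rewrite !tensA in e1.
have e2 := cz_nat zP T2h; rewrite !tensA in e2.
by diag2 (late, mE Y1 Y2, DE (Y1 ⊗ Y2), late, comul_mul A)
  (late, DE Y2, late, DE Y1, late, mE Y1 Y2, e1, esym e2).
Qed.

Lemma centralizer_comul_one : D ∘ u = u ⊠ u.
Proof.
have T0h : counit A ∷ tunit ⊗ A ⇒ tunit by dhom.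
rewrite uE; have := DE tunit; have := cz_nat zP T0h; rewrite !tens1x => e1 e2.
by diag (e2, counit_mul A, e1).
Qed.

Lemma centralizer_counit_mul : e ∘ m = e ⊠ e.
Proof.
apply: (centralizer_uniq zP (P := Z) (V := tunit) (W := tunit)); try dhom; move=> Y2.
apply: (cz_uniq zP (V := Y2) (W := Y2 ⊗ A)); try dhom; move=> Y1.
by diag2 (late, mE Y1 Y2, eE (Y1 ⊗ Y2), comul_one A, late) (early, eE Y1, eE Y2, late).
Qed.

Lemma centralizer_counit_one : e ∘ u = 'id tunit.
Proof.
rewrite uE; have := eE tunit; rewrite !tens1x => e2.
by diag (e2, counit_one A).
Qed.

End Structure.

(* The equations of [centralizer_structure] on a carrier which need not be
   [ZA C A]. *)
Record centralizer_bialgebra (B : brcat) (A : hopf B) (Z : bialgebra B) (delta : ob B -> mor B) :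
    Prop := CentralizerBialgebra {
  czb_centralizer : centralizer A Z delta;
  czb_mul : forall X Y, (idm (X ⊗ A ⊗ (Y ⊗ A)) ⊠ mul Z)
    ∘ (idm (X ⊗ A) ⊠ τ Z (Y ⊗ A) ⊠ idm Z) ∘ (delta X ⊠ delta Y) =
    (T2 A X Y ⊠ idm Z) ∘ delta (X ⊗ Y);
  czb_one : one Z = (counit A ⊠ idm Z) ∘ delta tunit;
  czb_comul : forall X, (idm (X ⊗ A) ⊠ comul Z) ∘ delta X =
    (idm X ⊠ mul A ⊠ idm (Z ⊗ Z)) ∘ (delta (X ⊗ A) ⊠ idm Z) ∘ delta X;
  czb_counit : forall X, (idm (X ⊗ A) ⊠ counit Z) ∘ delta X = idm X ⊠ one A }.

Lemma centralizer_bialgebra_exists (B : brcat) (A : hopf B) (Z : ob B) delta :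
  centralizer A Z delta -> exists2 H : bialgebra B, carrier H = Z &
    centralizer_bialgebra A H delta.
Proof.
move=> zP; have dh := cz_hom zP.
have [m mh mE] := centralizer_mul_exists zP.
have [D Dh DE] := centralizer_comul_exists zP.
have [e eh eE] := centralizer_counit_exists zP.
pose u := (counit A ⊠ idm Z) ∘ delta tunit.
have uh : u ∷ tunit ⇒ Z.
  by have := dh tunit; rewrite tens1x => ?; rewrite /u; dhom.
exists (Bialgebra mh uh Dh eh (centralizer_mulA zP mh mE)
  (centralizer_mul1 zP mh uh mE erefl) (centralizer_1mul zP mh uh mE erefl)
  (centralizer_comulA zP Dh DE) (centralizer_comul1 zP Dh eh DE eE)
  (centralizer_1comul zP Dh eh DE eE) (centralizer_comul_mul zP mh Dh mE DE)
  (centralizer_comul_one zP Dh erefl DE) (centralizer_counit_mul zP mh eh mE eE)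
  (centralizer_counit_one zP eh erefl eE)) => //.
Qed.

(** * The antipode of Z(A) and its inverse *)

Section Antipode.

Variables (B : brcat) (d : autonomous B) (A : hopf B) (Z : bialgebra B).
Variable delta : ob B -> mor B.
Hypothesis zbP : centralizer_bialgebra A Z delta.
Let zP := czb_centralizer zbP.
Let delta_Hom Y : Hom (delta Y) Y (Y ⊗ A ⊗ Z) := cz_hom zP Y.
#[local] Existing Instance delta_Hom.
Local Notation "'id" := idm (at level 0).
Local Notation "∨ X" := (ld d X) (at level 30, right associativity).
Local Notation S' := (inv (antipode A)).

Let mE X Y : ('id (X ⊗ A ⊗ (Y ⊗ A)) ⊠ mul Z) ∘ ('id (X ⊗ A) ⊠ τ Z (Y ⊗ A) ⊠ 'id Z)
      ∘ (delta X ⊠ delta Y) =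
  (('id X ⊠ τ Y A ⊠ 'id A ⊠ 'id Z) ∘ ('id (X ⊗ Y) ⊠ comul A ⊠ 'id Z)) ∘ delta (X ⊗ Y).
Proof. by rewrite (czb_mul zbP) /T2; diag tt. Qed.

Lemma delta_nat0 c X : c ∷ tunit ⇒ X ->
  delta X ∘ c = (c ⊠ 'id (A ⊗ Z)) ∘ delta tunit.
Proof. by move=> ch; rewrite (cz_nat zP ch). Qed.

(** Coevaluate [Y ⊗ A], apply [delta] to its dual, absorb the new factor [A] into [∨ A] as in the
    left antipode of the Hopf monad, and evaluate [∨ Y] on the given [Y]; what remains is the image
    of the Z-component under the antipode. *)
Definition left_antipode_family (Y : ob B) : mor B :=
  ('id (Y ⊗ A) ⊠ ((ldev d Y ⊠ 'id Z) ∘ ('id (∨ Y) ⊠ τ Z Y)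
      ∘ (ldev d A ⊠ 'id (∨ Y ⊗ Z ⊗ Y)) ∘ ('id (∨ A) ⊠ τ (∨ Y) A ⊠ 'id (Z ⊗ Y))
      ∘ ('id (∨ A ⊗ ∨ Y) ⊠ S' ⊠ 'id (Z ⊗ Y)) ∘ (delta (∨ A ⊗ ∨ Y) ⊠ 'id Y)))
    ∘ (((('id Y ⊠ ldcoev d A ⊠ 'id (∨ Y)) ∘ ldcoev d Y)) ⊠ 'id Y).
Local Notation xi := left_antipode_family.

Lemma left_antipode_exists : exists2 S, S ∷ Z ⇒ Z &
  forall Y, ('id (Y ⊗ A) ⊠ S) ∘ delta Y = xi Y.
Proof.
have [Y|f X Y fh|S Sh SE] := @cz_exists _ _ _ _ zP tunit Z xi.
- by rewrite /xi; dhom.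
- have fdh : ldual d f ∷ ∨ Y ⇒ ∨ X.
    by case: (fh) => dX cY; rewrite /ldual dX cY; dhom.
  have fdAh : 'id (∨ A) ⊠ ldual d f ∷ ∨ A ⊗ ∨ Y ⇒ ∨ A ⊗ ∨ X by dhom.
  rewrite /xi.
  by diag2 (ldual_coev d fh, esym (cz_nat zP fdAh), late, ldual_ev d fh) (late).
exists S; first by move: Sh; rewrite tensx1.
by move=> Y; rewrite -SE tensm1.
Qed.

Variable S : mor B.
Hypothesis Sh : S ∷ Z ⇒ Z.
Hypothesis SE : forall Y, ('id (Y ⊗ A) ⊠ S) ∘ delta Y = xi Y.

(** The product of [Z] produces [delta] on [Y ⊗ A] tensored with its dual; naturality along the
    coevaluation reduces it to [delta tunit], which gives the unit of [Z], while the skew antipode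
    of A removes the coproduct. *)
Lemma centralizer_antipode_r : mul Z ∘ ('id Z ⊠ S) ∘ comul Z = one Z ∘ counit Z.
Proof.
apply: (cz_uniq zP (V := tunit) (W := Z)); try dhom; move=> Y.
have e1 := mE (Y ⊗ A) (∨ A ⊗ ∨ Y).
have cupE : (('id Y ⊠ ldcoev d A ⊠ 'id (∨ Y)) ∘ ldcoev d Y)
  ∷ tunit ⇒ Y ⊗ A ⊗ (∨ A ⊗ ∨ Y) by dhom.
have e2 := SE Y; rewrite /xi in e2.
have e3 := delta_nat0 cupE.
by diag2 (czb_comul zbP Y, e2, br_natr Z (ldev_hom d Y), br_natr Z (ldev_hom d A), e1, e3,
    cup_braid A (ldcoev_hom d A), ld_zigzag1 d A, skew_antipode_r A, esym (czb_one zbP),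
    early, ld_zigzag1 d Y)
  (czb_counit zbP Y).
Qed.

Lemma centralizer_antipode_l : mul Z ∘ (S ⊠ 'id Z) ∘ comul Z = one Z ∘ counit Z.
Proof.
apply: (cz_uniq zP (V := tunit) (W := Z)); try dhom; move=> Y.
(* The left dual of the product [Y ⊗ A ⊗ A ⇒ Y ⊗ A], with the dual of the source already split. It
   carries the product coming from [czb_comul] to the dual side, where [delta] is natural. *)
pose g := (ldev d (Y ⊗ A) ⊠ 'id (∨ A ⊗ ∨ (Y ⊗ A)))
  ∘ ('id (∨ (Y ⊗ A)) ⊠ 'id Y ⊠ mul A ⊠ 'id (∨ A ⊗ ∨ (Y ⊗ A)))
  ∘ ('id (∨ (Y ⊗ A) ⊗ Y ⊗ A) ⊠ ldcoev d A ⊠ 'id (∨ (Y ⊗ A))) ∘ ('id (∨ (Y ⊗ A)) ⊠ ldcoev d (Y ⊗ A)).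
have gh : g ∷ ∨ (Y ⊗ A) ⇒ ∨ A ⊗ ∨ (Y ⊗ A) by rewrite /g; dhom.
have e0 : ('id Y ⊠ mul A ⊠ 'id (∨ A ⊗ ∨ (Y ⊗ A)))
    ∘ ('id (Y ⊗ A) ⊠ ldcoev d A ⊠ 'id (∨ (Y ⊗ A))) ∘ ldcoev d (Y ⊗ A) =
    ('id (Y ⊗ A) ⊠ g) ∘ ldcoev d (Y ⊗ A).
  by apply/esym; rewrite /g; diag (ld_zigzag1 d (Y ⊗ A)).
have e1 := mE (∨ (Y ⊗ A)) Y.
have e2 := SE (Y ⊗ A); rewrite /xi in e2.
(* The two halves of the coproduct meet as a product with one inverse antipode and cancel. What is
   left is an arrow to the unit object, and naturality of [delta] along it yields [one Z]. *)
have phi : ldev d (Y ⊗ A) ∘ (ldev d A ⊠ 'id (∨ (Y ⊗ A) ⊗ Y ⊗ A))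
    ∘ ('id (∨ A) ⊠ τ (∨ (Y ⊗ A)) A ⊠ 'id (Y ⊗ A)) ∘ ('id (∨ A ⊗ ∨ (Y ⊗ A)) ⊠ S' ⊠ 'id (Y ⊗ A))
    ∘ (g ⊠ 'id (A ⊗ Y ⊗ A)) ∘ ('id (∨ (Y ⊗ A)) ⊠ τ Y A ⊠ 'id A) ∘ ('id (∨ (Y ⊗ A) ⊗ Y) ⊠ comul A) =
  ldev d (Y ⊗ A) ∘ ('id (∨ (Y ⊗ A) ⊗ Y) ⊠ one A) ∘ ('id (∨ (Y ⊗ A) ⊗ Y) ⊠ counit A).
  by rewrite /g; diag (cup_braid A (ldcoev_hom d (Y ⊗ A)), ld_zigzag1 d A,
    ld_zigzag1 d (Y ⊗ A), early, skew_antipode_l A).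
have psih : ldev d (Y ⊗ A) ∘ ('id (∨ (Y ⊗ A) ⊗ Y) ⊠ one A) ∷ ∨ (Y ⊗ A) ⊗ Y ⇒ tunit by dhom.
have e3 := cz_nat zP psih.
by diag2 (czb_comul zbP Y, e2, e0, esym (cz_nat zP gh), e1, phi, e3, esym (czb_one zbP),
    ld_zigzag1 d (Y ⊗ A))
  (czb_counit zbP Y).
Qed.


Local Notation "Y ^∨" := (rd d Y) (at level 25, format "Y ^∨").

Definition rdual (f : mor B) : mor B :=
  ('id ((dom f)^∨) ⊠ rdev d (cod f)) ∘ ('id ((dom f)^∨) ⊠ f ⊠ 'id ((cod f)^∨))
    ∘ (rdcoev d (dom f) ⊠ 'id ((cod f)^∨)).

Lemma rdual_coev f X Y : f ∷ X ⇒ Y ->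
  ('id (X^∨) ⊠ f) ∘ rdcoev d X = (rdual f ⊠ 'id Y) ∘ rdcoev d Y.
Proof.
by move=> fh; rewrite /rdual; case: (fh) => -> ->; apply/esym; diag (rd_zigzag1 d Y).
Qed.

Lemma rdual_ev f X Y : f ∷ X ⇒ Y ->
  rdev d X ∘ ('id X ⊠ rdual f) = rdev d Y ∘ (f ⊠ 'id (Y^∨)).
Proof. by move=> fh; rewrite /rdual; case: (fh) => -> ->; diag (rd_zigzag1 d X). Qed.

(** The same construction with right duals and with the antipode of A in place of its inverse. It
    defines the skew antipode required by [antipode_inverse]. *)
Definition right_antipode_family (Y : ob B) : mor B :=
  τ Z (Y ⊗ A) ∘ (rdev d Y ⊠ 'id (Z ⊗ Y ⊗ A))
    ∘ ('id Y ⊠ rdev d A ⊠ 'id (Y^∨ ⊗ Z ⊗ Y ⊗ A))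
    ∘ ('id Y ⊠ τ (A^∨ ⊗ Y^∨) A ⊠ 'id (Z ⊗ Y ⊗ A))
    ∘ ('id (Y ⊗ A^∨ ⊗ Y^∨) ⊠ antipode A ⊠ 'id (Z ⊗ Y ⊗ A))
    ∘ ('id Y ⊠ delta (A^∨ ⊗ Y^∨) ⊠ 'id (Y ⊗ A))
    ∘ ('id Y ⊠ (('id (A^∨) ⊠ rdcoev d Y ⊠ 'id A) ∘ rdcoev d A)).
Local Notation xi' := right_antipode_family.

Lemma right_antipode_exists : exists2 S, S ∷ Z ⇒ Z &
  forall Y, ('id (Y ⊗ A) ⊠ S) ∘ delta Y = xi' Y.
Proof.
have [Y|f X Y fh|Q Qh QE] := @cz_exists _ _ _ _ zP tunit Z xi'.
- by rewrite /xi'; dhom.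
- have fdh : rdual f ∷ Y^∨ ⇒ X^∨.
    by case: (fh) => dX cY; rewrite /rdual dX cY; dhom.
  have fdAh : 'id (A^∨) ⊠ rdual f ∷ A^∨ ⊗ Y^∨ ⇒ A^∨ ⊗ X^∨ by dhom.
  rewrite /xi'.
  by diag2 (early, rdual_coev fh, esym (cz_nat zP fdAh), late, rdual_ev fh) (late).
exists Q; first by move: Qh; rewrite tensx1.
by move=> Y; rewrite -QE tensm1.
Qed.

Variable Q : mor B.
Hypothesis Qh : Q ∷ Z ⇒ Z.
Hypothesis QE : forall Y, ('id (Y ⊗ A) ⊠ Q) ∘ delta Y = xi' Y.

Lemma centralizer_skew_r :
  mul Z ∘ inv (τ Z Z) ∘ ('id Z ⊠ Q) ∘ comul Z = one Z ∘ counit Z.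
Proof.
apply: (cz_uniq zP (V := tunit) (W := Z)); try dhom; move=> Y.
have e1 := mE (A^∨ ⊗ Y^∨) (Y ⊗ A).
have cupE : (('id (A^∨) ⊠ rdcoev d Y ⊠ 'id A) ∘ rdcoev d A)
  ∷ tunit ⇒ A^∨ ⊗ Y^∨ ⊗ (Y ⊗ A) by dhom.
have e2 := QE Y; rewrite /xi' in e2.
have e3 := delta_nat0 cupE.
by diag2 (czb_comul zbP Y, e2, late, e1, e3, cup_braid A (rdcoev_hom d Y),
    cup_braid A (rdcoev_hom d A), early, rd_zigzag1 d A, rd_zigzag1 d Y, antipode_l A,
    esym (czb_one zbP))
  (czb_counit zbP Y).
Qed.

Lemma centralizer_skew_l :
  mul Z ∘ inv (τ Z Z) ∘ (Q ⊠ 'id Z) ∘ comul Z = one Z ∘ counit Z.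
Proof.
apply: (cz_uniq zP (V := tunit) (W := Z)); try dhom; move=> Y.
pose g := ('id (A^∨ ⊗ (Y ⊗ A)^∨) ⊠ rdev d (Y ⊗ A))
  ∘ ('id (A^∨ ⊗ (Y ⊗ A)^∨ ⊗ Y) ⊠ mul A ⊠ 'id ((Y ⊗ A)^∨))
  ∘ ('id (A^∨) ⊠ rdcoev d (Y ⊗ A) ⊠ 'id (A ⊗ (Y ⊗ A)^∨)) ∘ (rdcoev d A ⊠ 'id ((Y ⊗ A)^∨)).
have gh : g ∷ (Y ⊗ A)^∨ ⇒ A^∨ ⊗ (Y ⊗ A)^∨ by rewrite /g; dhom.
have e0 : ('id (A^∨ ⊗ (Y ⊗ A)^∨ ⊗ Y) ⊠ mul A)
  ∘ ('id (A^∨) ⊠ rdcoev d (Y ⊗ A) ⊠ 'id A) ∘ rdcoev d A =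
  (g ⊠ 'id (Y ⊗ A)) ∘ rdcoev d (Y ⊗ A).
  by apply/esym; rewrite /g; diag (rd_zigzag1 d (Y ⊗ A)).
have e1 := mE Y ((Y ⊗ A)^∨).
have e2 := QE (Y ⊗ A); rewrite /xi' in e2.
have phi : rdev d (Y ⊗ A) ∘ ('id (Y ⊗ A) ⊠ rdev d A ⊠ 'id ((Y ⊗ A)^∨))
   ∘ ('id (Y ⊗ A) ⊠ τ (A^∨ ⊗ (Y ⊗ A)^∨) A)
   ∘ ('id (Y ⊗ A ⊗ A^∨ ⊗ (Y ⊗ A)^∨) ⊠ antipode A)
   ∘ ('id (Y ⊗ A) ⊠ g ⊠ 'id A) ∘ ('id Y ⊠ τ ((Y ⊗ A)^∨) A ⊠ 'id A)
   ∘ ('id (Y ⊗ (Y ⊗ A)^∨) ⊠ comul A) =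
  rdev d (Y ⊗ A) ∘ ('id Y ⊠ one A ⊠ 'id ((Y ⊗ A)^∨)) ∘ ('id (Y ⊗ (Y ⊗ A)^∨) ⊠ counit A).
  have e : rdev d (Y ⊗ A) ∘ ('id (Y ⊗ A) ⊠ rdev d A ⊠ 'id ((Y ⊗ A)^∨))
      ∘ ('id (Y ⊗ A ⊗ A) ⊠ g) =
    rdev d (Y ⊗ A) ∘ ('id Y ⊠ mul A ⊠ 'id ((Y ⊗ A)^∨)).
    by rewrite /g; diag (rd_zigzag1 d A, rd_zigzag1 d (Y ⊗ A)).
  by diag (early, e, late, antipode_r A).
have psih : rdev d (Y ⊗ A) ∘ ('id Y ⊠ one A ⊠ 'id ((Y ⊗ A)^∨)) ∷ Y ⊗ (Y ⊗ A)^∨ ⇒ tunit by dhom.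
have e3 := cz_nat zP psih.
have ch := rdcoev_hom d (Y ⊗ A).
by diag2 (czb_comul zbP Y, e2, late, e0, esym (cz_nat zP gh), esym (br_natr Z ch), e1,
    phi, e3, esym (czb_one zbP), early, rd_zigzag1 d (Y ⊗ A))
  (czb_counit zbP Y).
Qed.

End Antipode.

Lemma centralizer_hopf (B : brcat) (d : autonomous B) (A : hopf B) (Z : bialgebra B) delta :
  centralizer_bialgebra A Z delta -> exists H : hopf B, hopf_bialgebra H = Z.
Proof.
move=> zbP.
have [S Sh SE] := left_antipode_exists d zbP.
have [Q Qh QE] := right_antipode_exists d zbP.
have Sl := centralizer_antipode_l zbP Sh SE.
have Sr := centralizer_antipode_r zbP Sh SE.
have Si : is_iso S.
  exists Q; apply: (antipode_inverse Sh Sl Sr Qh).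
    exact (centralizer_skew_l zbP Qh QE).
  exact (centralizer_skew_r zbP Qh QE).
by exists (Hopf Sh Sl Sr Si).
Qed.

(** * The canonical distributive law *)

Section Fusion.

Variables (B : brcat) (A : hopf B).
Local Notation "'id" := idm (at level 0).
Local Notation S' := (inv (antipode A)).

(* In a symmetric category [p ⊗ h ⊗ v] goes to [f (p, h_2, v)], whose component
   in [A] is multiplied on the right by [h_1]. *)
Definition fusion (P Q V W : ob B) (f : mor B) : mor B :=
  ('id Q ⊠ mul A ⊠ 'id W) ∘ (inv (τ (Q ⊗ A) A) ⊠ 'id W) ∘ ('id A ⊠ f)
    ∘ (τ P A ⊠ 'id (A ⊗ V)) ∘ ('id P ⊠ comul A ⊠ 'id V).
Definition unfusion (P Q V W : ob B) (f : mor B) : mor B :=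
  ('id Q ⊠ mul A ⊠ 'id W) ∘ (inv (τ (Q ⊗ A) A) ⊠ 'id W) ∘ (S' ⊠ f)
    ∘ (τ P A ⊠ 'id (A ⊗ V)) ∘ ('id P ⊠ comul A ⊠ 'id V).

Variables (P Q V W : ob B) (f : mor B).
Hypothesis fh : f ∷ P ⊗ A ⊗ V ⇒ Q ⊗ A ⊗ W.

(** After coassociativity and associativity the extra factor is [h_2] times the inverse antipode of
    [h_1], which is the counit by the skew antipode axiom. *)
Lemma fusionK : unfusion P Q V W (fusion P Q V W f) = f.
Proof.
rewrite /unfusion /fusion; diag (comulA A, late, esym (mulA A), skew_antipode_l A, early,
  mulh1 A, comul1h A).
Qed.

Lemma unfusionK : fusion P Q V W (unfusion P Q V W f) = f.
Proof.
rewrite /unfusion /fusion; diag (comulA A, late, esym (mulA A), skew_antipode_r A, early,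
  mulh1 A, comul1h A).
Qed.

End Fusion.

Section DistributiveLaw.

Variables (B : brcat) (A : hopf B) (Z : ob B) (delta : ob B -> mor B).
Hypothesis zP : centralizer A Z delta.
Let delta_Hom Y : Hom (delta Y) Y (Y ⊗ A ⊗ Z) := cz_hom zP Y.
#[local] Existing Instance delta_Hom.
Local Notation "'id" := idm (at level 0).

(* [y ⊗ h ↦ y ⊗ h_2 a ⊗ h_1 ⊗ z], where [delta (y) = y ⊗ a ⊗ z]. *)
Definition exchange (Y : ob B) : mor B :=
  ('id Y ⊠ mul A ⊠ 'id (A ⊗ Z)) ∘ (τ A (Y ⊗ A ⊗ A) ⊠ 'id Z) ∘ ('id A ⊠ delta (Y ⊗ A))
    ∘ (τ Y A ⊠ 'id A) ∘ ('id Y ⊠ comul A).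

Lemma exchange_hom Y : exchange Y ∷ Y ⊗ A ⇒ Y ⊗ A ⊗ A ⊗ Z.
Proof. by rewrite /exchange; dhom. Qed.
#[local] Instance exchange_Hom Y : Hom (exchange Y) (Y ⊗ A) (Y ⊗ A ⊗ A ⊗ Z) :=
  exchange_hom Y.

(* [a h_1 ⊗ Omega (z ⊗ h_2) = h_2 a ⊗ h_1 ⊗ z] *)
Definition exchange_law (Omega : mor B) : Prop := forall Y,
  ('id Y ⊠ mul A ⊠ Omega) ∘ ('id (Y ⊗ A) ⊠ τ Z A ⊠ 'id A) ∘ (delta Y ⊠ comul A) =
  exchange Y.

Lemma fusion_delta Omega Y : Omega ∷ Z ⊗ A ⇒ A ⊗ Z ->
  fusion A Y Y tunit (A ⊗ Z) (('id (Y ⊗ A) ⊠ Omega) ∘ (delta Y ⊠ 'id A)) =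
  ('id Y ⊠ mul A ⊠ Omega) ∘ ('id (Y ⊗ A) ⊠ τ Z A ⊠ 'id A) ∘ (delta Y ⊠ comul A).
Proof. by move=> Oh; rewrite /fusion; diag2 late (late). Qed.

(** The exchange law prescribes only the fusion of the family belonging to [Omega]. Inverting the
    fusion makes the family explicit, and the universal property then applies. *)
Lemma exchange_law_unfusion Omega : Omega ∷ Z ⊗ A ⇒ A ⊗ Z ->
  exchange_law Omega <-> forall Y, ('id (Y ⊗ A) ⊠ Omega) ∘ (delta Y ⊠ 'id A) =
    unfusion A Y Y tunit (A ⊗ Z) (exchange Y).
Proof.
move=> Oh; split=> E Y.
  rewrite -E -fusion_delta // fusionK //; dhom.
by rewrite -fusion_delta // E unfusionK //; dhom.
Qed.

Lemma exchange_law_exists : exists2 Omega, Omega ∷ Z ⊗ A ⇒ A ⊗ Z & exchange_law Omega.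
Proof.
have [Y|f X Y fh|Om Oh OE] := @cz_exists _ _ _ _ zP A (A ⊗ Z)
  (fun Y => unfusion A Y Y tunit (A ⊗ Z) (exchange Y)).
- by rewrite /unfusion; dhom.
- rewrite /unfusion /exchange.
  have fAh : f ⊠ 'id A ∷ X ⊗ A ⇒ Y ⊗ A by dhom.
  by diag2 late (late, esym (cz_nat zP fAh), late).
by exists Om => //; apply/exchange_law_unfusion.
Qed.

End DistributiveLaw.

Section CanonicalLaw.

Variables (B : brcat) (d : autonomous B) (C : coend d) (A : hopf B).
Local Notation "'id" := idm (at level 0).
Local Notation "∨ X" := (ld d X) (at level 30, right associativity).
Local Notation Z := (ZA C A).
Local Notation delta := (delta C A).
Let zP := centralizer_delta C A.
Let delta_Hom Y : Hom (delta Y) Y (Y ⊗ A ⊗ Z) := cz_hom zP Y.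
#[local] Existing Instance delta_Hom.
#[local] Instance ld_tens_Hom X Y : Hom (ld_tens d X Y) (∨ (X ⊗ Y)) (∨ Y ⊗ ∨ X).
Proof. by rewrite /Hom /ld_tens; dhom. Qed.
Let Tmuh Y : Tmu A Y ∷ Y ⊗ A ⊗ A ⇒ Y ⊗ A.
Proof. by rewrite /Tmu; dhom. Qed.
#[local] Instance ldual_Hom Y : Hom (ldual d (Tmu A Y)) (∨ (Y ⊗ A)) (∨ (Y ⊗ A ⊗ A)).
Proof. by rewrite /Hom /ldual; case: (Tmuh Y) => -> ->; rewrite /Tmu; dhom. Qed.

(** The input [∨ (Y ⊗ A)] of the canonical law becomes an output, so that both of its sides turn
    into families of the type handled by the centralizer. *)
Definition bend (X Y : ob B) (f : mor B) : mor B :=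
  ('id (Y ⊗ A) ⊠ f) ∘ (ldcoev d (Y ⊗ A) ⊠ 'id (X ⊗ Y ⊗ A)).

Lemma bend_inj X Y W f g : f ∷ ∨ (Y ⊗ A) ⊗ X ⊗ Y ⊗ A ⇒ W -> g ∷ ∨ (Y ⊗ A) ⊗ X ⊗ Y ⊗ A ⇒ W ->
  bend X Y f = bend X Y g -> f = g.
Proof.
move=> fh gh e.
have E s : s ∷ ∨ (Y ⊗ A) ⊗ X ⊗ Y ⊗ A ⇒ W -> 
   s = (ldev d (Y ⊗ A) ⊠ 'id W) ∘ ('id (∨ (Y ⊗ A)) ⊠ bend X Y s).
  by move=> sh; apply/esym; rewrite /bend; diag (ld_zigzag2 d (Y ⊗ A)).
by rewrite (E f) // (E g) // e.
Qed.

Definition dl_lhs (Omega : mor B) X Y : mor B := ('id X ⊠ Omega) ∘ Tm A (jay C A X Y).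

Definition dl_rhs X Y : mor B := jay C A (T A X) (T A Y)
  ∘ ((ldual d (Tmu A Y) ∘ sl d A (T A Y) ∘ Tm A (ldual d (Tmu A Y)))
         ⊠ 'id (T A X ⊗ T A Y))
  ∘ T3 A (∨ (T A Y)) X Y.

Lemma bend_dl_lhs Omega X Y : Omega ∷ Z ⊗ A ⇒ A ⊗ Z -> bend X Y (dl_lhs Omega X Y) =
  (τ X (Y ⊗ A) ⊠ 'id (A ⊗ Z)) ∘ ('id X ⊠ (('id (Y ⊗ A) ⊠ Omega) ∘ (delta Y ⊠ 'id A))).
Proof.
move=> Oh; rewrite /bend /dl_lhs /Tm /jay /partial /T.
by diag (ld_zigzag1 d (Y ⊗ A)).
Qed.

(** The two dualized products slide through a coevaluation and an evaluation and become the two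
    products of A, one in [exchange] and one in [unfusion]; the inverse antipode is that of [sl]. *)
Lemma bend_dl_rhs X Y : bend X Y (dl_rhs X Y) =
  (τ X (Y ⊗ A) ⊠ 'id (A ⊗ Z)) ∘ ('id X ⊠ unfusion A Y Y tunit (A ⊗ Z) (exchange A Z delta Y)).
Proof.
rewrite /bend /dl_rhs /Tm /jay /partial /sl /T3 /T2 /T /unfusion /exchange.
have e1 : ('id (Y ⊗ A) ⊠ ldual d (Tmu A Y)) ∘ ldcoev d (Y ⊗ A) =
    ('id Y ⊠ mul A ⊠ 'id (∨ (Y ⊗ A ⊗ A))) ∘ ldcoev d (Y ⊗ A ⊗ A).
  by rewrite -(ldual_coev d (Tmuh Y)).
have e2 : ldev d (Y ⊗ A ⊗ A) ∘ (ldual d (Tmu A Y) ⊠ 'id (Y ⊗ A ⊗ A)) =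
    ldev d (Y ⊗ A) ∘ ('id (∨ (Y ⊗ A)) ⊠ 'id Y ⊠ mul A).
  by rewrite (ldual_ev d (Tmuh Y)) /Tmu tensmA.
have e3 := ld_tens_coev d (Y ⊗ A) A.
diag2 (e1, e3, e2, cup_braid A (ldcoev_hom d (Y ⊗ A)), ld_zigzag1 d A,
  ld_zigzag1 d (Y ⊗ A), late) (late).
Qed.

Lemma distributive_lawE Omega : distributive_law C A Omega <->
  Omega ∷ Z ⊗ A ⇒ A ⊗ Z /\ exchange_law A Z delta Omega.
Proof.
have lhs_hom X Y : Omega ∷ Z ⊗ A ⇒ A ⊗ Z ->
    dl_lhs Omega X Y ∷ ∨ (Y ⊗ A) ⊗ X ⊗ Y ⊗ A ⇒ X ⊗ A ⊗ Z.
  by move=> Oh; rewrite /dl_lhs /Tm /jay /partial /T; dhom.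
have rhs_hom X Y : dl_rhs X Y ∷ ∨ (Y ⊗ A) ⊗ X ⊗ Y ⊗ A ⇒ X ⊗ A ⊗ Z.
  by rewrite /dl_rhs /Tm /jay /partial /sl /T3 /T2 /T; dhom.
split.
- move=> [Oh OE]; split=> //; apply/(exchange_law_unfusion zP Oh) => Y.
  (* After bending, [X] enters both sides only through a common crossing, so its value at the unit
     object carries all the information. *)
  have := congr1 (bend tunit Y) (OE tunit Y).
  rewrite bend_dl_lhs // bend_dl_rhs br_1x !tens1m tens_id.
  have h1 : ('id (Y ⊗ A) ⊠ Omega) ∘ (delta Y ⊠ 'id A) ∷ Y ⊗ A ⇒ Y ⊗ A ⊗ (A ⊗ Z) by dhom.
  have h2 : unfusion A Y Y tunit (A ⊗ Z) (exchange A Z delta Y) ∷ Y ⊗ A ⇒ Y ⊗ A ⊗ (A ⊗ Z).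
    by rewrite /unfusion /exchange; dhom.
  by rewrite (comp_idl (proj2 h1)) (comp_idl (proj2 h2)).
- move=> [Oh /(exchange_law_unfusion zP Oh) OE]; split=> // X Y.
  apply: (bend_inj (lhs_hom X Y Oh) (rhs_hom X Y)).
  by rewrite bend_dl_lhs // bend_dl_rhs OE.
Qed.

End CanonicalLaw.

(** * Compatibility of the distributive law with both Hopf structures *)

Section DistributiveLawAxioms.

Variables (B : brcat) (A : hopf B) (Z : bialgebra B) (delta : ob B -> mor B).
Hypothesis zbP : centralizer_bialgebra A Z delta.
Let zP := czb_centralizer zbP.
Let delta_Hom Y : Hom (delta Y) Y (Y ⊗ A ⊗ Z) := cz_hom zP Y.
#[local] Existing Instance delta_Hom.
Local Notation "'id" := idm (at level 0).
Variable Om : mor B.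
Hypothesis Oh : Om ∷ Z ⊗ A ⇒ A ⊗ Z.
Hypothesis OE : exchange_law A Z delta Om.

Let mE X Y : ('id (X ⊗ A ⊗ (Y ⊗ A)) ⊠ mul Z) ∘ ('id (X ⊗ A) ⊠ τ Z (Y ⊗ A) ⊠ 'id Z)
      ∘ (delta X ⊠ delta Y) =
  (('id X ⊠ τ Y A ⊠ 'id A ⊠ 'id Z) ∘ ('id (X ⊗ Y) ⊠ comul A ⊠ 'id Z)) ∘ delta (X ⊗ Y).
Proof. by rewrite (czb_mul zbP) /T2; diag tt. Qed.

Let LE Y : ('id Y ⊠ mul A ⊠ Om) ∘ ('id (Y ⊗ A) ⊠ τ Z A ⊠ 'id A) ∘ (delta Y ⊠ comul A) =
  ('id Y ⊠ mul A ⊠ 'id (A ⊗ Z)) ∘ (τ A (Y ⊗ A ⊗ A) ⊠ 'id Z) ∘ ('id A ⊠ delta (Y ⊗ A))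
    ∘ (τ Y A ⊠ 'id A) ∘ ('id Y ⊠ comul A).
Proof. exact: OE. Qed.

Lemma fusion_inj P Q V W f g : f ∷ P ⊗ A ⊗ V ⇒ Q ⊗ A ⊗ W -> g ∷ P ⊗ A ⊗ V ⇒ Q ⊗ A ⊗ W ->
  fusion A P Q V W f = fusion A P Q V W g -> f = g.
Proof. by move=> fh gh e; rewrite -(fusionK fh) e fusionK. Qed.

Lemma distr_one : Om ∘ ('id Z ⊠ one A) = one A ⊠ 'id Z.
Proof.
apply: (cz_uniq zP (V := tunit) (W := A ⊗ Z)); try dhom; move=> Y.
(* The exchange law at [h = 1], where no fusion has to be undone. *)
transitivity (('id Y ⊠ mul A ⊠ Om) ∘ ('id (Y ⊗ A) ⊠ τ Z A ⊠ 'id A) ∘ (delta Y ⊠ comul A)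
  ∘ ('id Y ⊠ one A)).
  by apply/esym; diag (comul_one A, early, mulh1 A).
have uYh : 'id Y ⊠ one A ∷ Y ⇒ Y ⊗ A by dhom.
by diag (LE Y, comul_one A, early, esym (cz_nat zP uYh), mul1h A).
Qed.

Lemma distr_one_l : Om ∘ (one Z ⊠ 'id A) = 'id A ⊠ one Z.
Proof.
have := LE tunit; have := cz_hom zP tunit; have := czb_one zbP; rewrite !tens1x => uE dh e1.
have eAh : counit A ∷ A ⇒ tunit by dhom.
have e2 := cz_nat zP eAh.
(* The exchange law at the unit object with the first output killed by the counit, which turns
   [delta tunit] into [one Z]. *)
transitivity ((counit A ⊠ 'id (A ⊗ Z)) ∘ (mul A ⊠ Om) ∘ ('id A ⊠ τ Z A ⊠ 'id A)
  ∘ (delta tunit ⊠ comul A)).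
  apply/esym; diag (counit_mul A, late, comul1h A, esym uE).
by diag (e1, counit_mul A, e2, esym uE, late, comulh1 A).
Qed.

Lemma distr_counit : (counit A ⊠ counit Z) ∘ Om = counit Z ⊠ counit A.
Proof.
apply: (cz_uniq zP (V := A) (W := tunit)); try dhom; move=> Y.
apply: (@fusion_inj Y Y tunit tunit); try dhom; rewrite /fusion.
by diag2 (late, LE Y, czb_counit zbP (Y ⊗ A), late, mulh1 A, comul1h A)
  (late, czb_counit zbP Y, mul1h A, comulh1 A).
Qed.

Lemma distr_comul : ('id A ⊠ τ A Z ⊠ 'id Z) ∘ (comul A ⊠ comul Z) ∘ Om =
  (Om ⊠ Om) ∘ ('id Z ⊠ τ Z A ⊠ 'id A) ∘ (comul Z ⊠ comul A).
Proof.
apply: (cz_uniq zP (V := A) (W := A ⊗ Z ⊗ A ⊗ Z)); try dhom; move=> Y.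
apply: (@fusion_inj Y Y tunit (A ⊗ Z ⊗ A ⊗ Z)); try dhom; rewrite /fusion.
have mYh : 'id Y ⊠ mul A ∷ Y ⊗ A ⊗ A ⇒ Y ⊗ A by dhom.
by diag2 (late, LE Y, late, czb_comul zbP (Y ⊗ A), late, esym (comulA A), mulA A)
  (late, czb_comul zbP Y, esym (mulA A), comulA A, LE (Y ⊗ A),
     mulA A, cz_nat zP mYh, esym (comulA A), LE Y, late, esym (cz_nat zP mYh)).
Qed.

(** The source contains two factors A, and each needs its own fusion before the exchange law can be
    recognized. *)
Lemma distr_mul : Om ∘ ('id Z ⊠ mul A) = (mul A ⊠ 'id Z) ∘ ('id A ⊠ Om) ∘ (Om ⊠ 'id A).
Proof.
apply: (cz_uniq zP (V := A ⊗ A) (W := A ⊗ Z)); try dhom; move=> Y.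
apply: (@fusion_inj Y Y A (A ⊗ Z)); try dhom.
apply: (@fusion_inj (Y ⊗ A) Y tunit (A ⊗ Z)); try (rewrite /fusion; dhom); rewrite /fusion.
have mYh : 'id Y ⊠ mul A ∷ Y ⊗ A ⊗ A ⇒ Y ⊗ A by dhom.
by diag2 (early, esym (mulA A), esym (comul_mul A), LE Y, comul_mul A, late)
  (late, LE Y, early, esym (mulA A), LE (Y ⊗ A), mulA A, cz_nat zP mYh, late).
Qed.

(** Testing both factors [Z] creates two outputs A, next to [Y2] and to [Y1]; a fusion is made into
    each, one for each occurrence of [Om] on the right. *)
Lemma distr_mul_l : Om ∘ (mul Z ⊠ 'id A) = ('id A ⊠ mul Z) ∘ (Om ⊠ 'id Z) ∘ ('id Z ⊠ Om).
Proof.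
apply: (centralizer_uniq zP (P := Z) (V := A) (W := A ⊗ Z)); try dhom; move=> Y2.
apply: (cz_uniq zP (V := Y2 ⊗ A) (W := Y2 ⊗ A ⊗ (A ⊗ Z))); try dhom; move=> Y1.
apply: (@fusion_inj (Y1 ⊗ Y2) (Y1 ⊗ A ⊗ Y2) tunit (A ⊗ Z)); try dhom.
apply: (@fusion_inj (Y1 ⊗ Y2) Y1 tunit (Y2 ⊗ A ⊗ (A ⊗ Z))); try (rewrite /fusion; dhom).
rewrite /fusion.
have T2h : ('id Y1 ⊠ τ Y2 A ⊠ 'id A) ∘ ('id (Y1 ⊗ Y2) ⊠ comul A) ∷
  Y1 ⊗ Y2 ⊗ A ⇒ Y1 ⊗ A ⊗ (Y2 ⊗ A) by dhom.
have e1 := mE (Y1 ⊗ A) (Y2 ⊗ A); rewrite !tensA in e1.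
have e2 := cz_nat zP T2h; rewrite !tensA in e2.
by diag2 (late, mE Y1 Y2, early, comulA A, late, esym (comul_mul A),
  LE (Y1 ⊗ Y2), comul_mul A, late)
  (late, LE Y2, comulA A, late, LE Y1, early, e1, early, esym (comulA A), esym e2, late).
Qed.

End DistributiveLawAxioms.

(** * The double *)

Section TwistedTensor.

Variables (B : brcat) (A Z : bialgebra B) (Om : mor B).
Local Notation "'id" := idm (at level 0).
Hypothesis Oh : Om ∷ Z ⊗ A ⇒ A ⊗ Z.
Hypothesis O1r : Om ∘ ('id Z ⊠ one A) = one A ⊠ 'id Z.
Hypothesis O1l : Om ∘ (one Z ⊠ 'id A) = 'id A ⊠ one Z.
Hypothesis Oe : (counit A ⊠ counit Z) ∘ Om = counit Z ⊠ counit A.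
Hypothesis OD : ('id A ⊠ τ A Z ⊠ 'id Z) ∘ (comul A ⊠ comul Z) ∘ Om =
  (Om ⊠ Om) ∘ ('id Z ⊠ τ Z A ⊠ 'id A) ∘ (comul Z ⊠ comul A).
Hypothesis Omr : Om ∘ ('id Z ⊠ mul A) = (mul A ⊠ 'id Z) ∘ ('id A ⊠ Om) ∘ (Om ⊠ 'id A).
Hypothesis Oml : Om ∘ (mul Z ⊠ 'id A) = ('id A ⊠ mul Z) ∘ (Om ⊠ 'id Z) ∘ ('id Z ⊠ Om).

(** Kept transparent because its structure arrows are later compared by conversion. *)
Definition twisted_bialgebra : bialgebra B.
Proof.
refine (@Bialgebra B (A ⊗ Z) ((mul A ⊠ mul Z) ∘ ('id A ⊠ Om ⊠ 'id Z)) (one A ⊠ one Z)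
  (('id A ⊠ τ A Z ⊠ 'id Z) ∘ (comul A ⊠ comul Z)) (counit A ⊠ counit Z)
  _ _ _ _ _ _ _ _ _ _ _ _ _ _); try dhom.
- by diag2 (Omr, mulA A, mulA Z) (Oml).
- by diag (O1l, mul1h A, mul1h Z).
- by diag (O1r, mulh1 A, mulh1 Z).
- by diag2 (comulA A, comulA Z, late) (late).
- by diag (late, comul1h A, comul1h Z).
- by diag (late, comulh1 A, comulh1 Z).
- by diag2 (comul_mul A, comul_mul Z, OD) (late).
- by diag (comul_one A, comul_one Z, late).
- by diag (counit_mul A, counit_mul Z, Oe).
- by diag (counit_one A, counit_one Z).
Defined.

End TwistedTensor.

Section TwistedHopf.

Variables (B : brcat) (A Z : hopf B) (Om : mor B).
Local Notation "'id" := idm (at level 0).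
Hypothesis Oh : Om ∷ Z ⊗ A ⇒ A ⊗ Z.
Hypothesis O1r : Om ∘ ('id Z ⊠ one A) = one A ⊠ 'id Z.
Hypothesis O1l : Om ∘ (one Z ⊠ 'id A) = 'id A ⊠ one Z.
Hypothesis Oe : (counit A ⊠ counit Z) ∘ Om = counit Z ⊠ counit A.
Hypothesis OD : ('id A ⊠ τ A Z ⊠ 'id Z) ∘ (comul A ⊠ comul Z) ∘ Om =
  (Om ⊠ Om) ∘ ('id Z ⊠ τ Z A ⊠ 'id A) ∘ (comul Z ⊠ comul A).
Hypothesis Omr : Om ∘ ('id Z ⊠ mul A) = (mul A ⊠ 'id Z) ∘ ('id A ⊠ Om) ∘ (Om ⊠ 'id A).
Hypothesis Oml : Om ∘ (mul Z ⊠ 'id A) = ('id A ⊠ mul Z) ∘ (Om ⊠ 'id Z) ∘ ('id Z ⊠ Om).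

Let D : bialgebra B := twisted_bialgebra Oh O1r O1l Oe OD Omr Oml.

(** An element [a ⊗ z] is the product of [a] and [z], so an antipode must send it to the reversed
    product of the two antipodes, which [Om] brings back to normal form. Reversing with the inverse
    braiding and the inverse antipodes gives the skew antipode [T]. *)
Lemma twisted_hopf : exists H : hopf B, hopf_bialgebra H = D.
Proof.
pose S := Om ∘ (antipode Z ⊠ antipode A) ∘ τ A Z.
pose T := Om ∘ (inv (antipode Z) ⊠ inv (antipode A)) ∘ inv (τ Z A).
have Sh : S ∷ A ⊗ Z ⇒ A ⊗ Z by rewrite /S; dhom.
have Th : T ∷ A ⊗ Z ⇒ A ⊗ Z by rewrite /T; dhom.
have Sl : mul D ∘ (S ⊠ 'id D) ∘ comul D = one D ∘ counit D.
  by rewrite /= /S; diag (esym Omr, late, antipode_l A, late, O1r, antipode_l Z).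
have Sr : mul D ∘ ('id D ⊠ S) ∘ comul D = one D ∘ counit D.
  by rewrite /= /S; diag (esym Oml, early, antipode_r Z, late, O1l, antipode_r A).
suff ST : inverse S T by exists (@Hopf B D S Sh Sl Sr (ex_intro _ T ST)).
apply: (antipode_inverse (H := D) Sh Sl Sr Th).
  by rewrite /= /T; diag (early, esym Oml, late, skew_antipode_l Z, late, O1l, skew_antipode_l A).
by rewrite /= /T; diag (early, esym Omr, late, skew_antipode_r A, late, O1r, skew_antipode_r Z).
Qed.

End TwistedHopf.

(** * Half braidings and modules over the double *)

#[export] Instance ract_Hom (B : brcat) (H : bialgebra B) (x : rmodule H) :
  Hom (ract x) (rm_ob x ⊗ carrier H) (rm_ob x) := ract_hom x.

Section HalfBraiding.

Variables (B : brcat) (A Z : hopf B) (delta : ob B -> mor B).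
Hypothesis zbP : centralizer_bialgebra A Z delta.
Let zP := czb_centralizer zbP.
Let delta_Hom Y : Hom (delta Y) Y (Y ⊗ A ⊗ Z) := cz_hom zP Y.
#[local] Existing Instance delta_Hom.
Local Notation "'id" := idm (at level 0).
Variable Om : mor B.
Hypothesis Oh : Om ∷ Z ⊗ A ⇒ A ⊗ Z.
Hypothesis OE : exchange_law A Z delta Om.

Let mE X Y : ('id (X ⊗ A ⊗ (Y ⊗ A)) ⊠ mul Z) ∘ ('id (X ⊗ A) ⊠ τ Z (Y ⊗ A) ⊠ 'id Z)
      ∘ (delta X ⊠ delta Y) =
  (('id X ⊠ τ Y A ⊠ 'id A ⊠ 'id Z) ∘ ('id (X ⊗ Y) ⊠ comul A ⊠ 'id Z)) ∘ delta (X ⊗ Y).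
Proof. by rewrite (czb_mul zbP) /T2; diag tt. Qed.

Let LE Y : ('id Y ⊠ mul A ⊠ Om) ∘ ('id (Y ⊗ A) ⊠ τ Z A ⊠ 'id A) ∘ (delta Y ⊠ comul A) =
  ('id Y ⊠ mul A ⊠ 'id (A ⊗ Z)) ∘ (τ A (Y ⊗ A ⊗ A) ⊠ 'id Z) ∘ ('id A ⊠ delta (Y ⊗ A))
    ∘ (τ Y A ⊠ 'id A) ∘ ('id Y ⊠ comul A).
Proof. exact: OE. Qed.

(* The actions of [Z] on [x] which together with the action of [A] define an
   action of the double. *)
Record zaction (x : rmodule A) (rho : mor B) : Prop := ZAction {
  za_hom : rho ∷ rm_ob x ⊗ Z ⇒ rm_ob x;
  za_mul : rho ∘ (rho ⊠ 'id Z) = rho ∘ ('id (rm_ob x) ⊠ mul Z);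
  za_one : rho ∘ ('id (rm_ob x) ⊠ one Z) = 'id (rm_ob x);
  za_law : ract x ∘ (rho ⊠ 'id A) = rho ∘ (ract x ⊠ 'id Z) ∘ ('id (rm_ob x) ⊠ Om) }.

Definition half_braid (x : rmodule A) (rho : mor B) (y : rmodule A) : mor B :=
  (ract y ⊠ rho) ∘ (τ (rm_ob x) (rm_ob y ⊗ A) ⊠ 'id Z) ∘ ('id (rm_ob x) ⊠ delta (rm_ob y)).

Section Action.

Variables (x : rmodule A) (rho : mor B).
Hypothesis zx : zaction x rho.
Let rho_Hom : Hom rho (rm_ob x ⊗ Z) (rm_ob x) := za_hom zx.
#[local] Existing Instance rho_Hom.

Lemma half_braid_hom y : half_braid x rho y ∷ rm_ob x ⊗ rm_ob y ⇒ rm_ob y ⊗ rm_ob x.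
Proof. by rewrite /half_braid; dhom. Qed.

(** Moving the action of A past [rho] by [za_law] creates [Om], and what remains on the module side
    is exactly the exchange law. *)
Lemma half_braid_linear y :
  half_braid x rho y ∘ ract_tens x y = ract_tens y x ∘ (half_braid x rho y ⊠ 'id A).
Proof.
rewrite /half_braid /ract_tens.
by diag2 (esym (cz_nat zP (ract_hom y)), late, ractA y) (late, ractA y, za_law zx, LE (rm_ob y)).
Qed.

Lemma half_braid_tens y z : half_braid x rho (rmodule_tens y z) =
  ('id (rm_ob y) ⊠ half_braid x rho z) ∘ (half_braid x rho y ⊠ 'id (rm_ob z)).
Proof.
rewrite /half_braid /= /ract_tens.
by diag2 (late) (late, za_mul zx, mE (rm_ob y) (rm_ob z)).
Qed.

Lemma half_braid_unit : half_braid x rho (rmodule_unit A) = 'id (rm_ob x).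
Proof.
rewrite /half_braid /= tens1x.
have := czb_one zbP; have := cz_hom zP tunit; rewrite !tens1x => dh uE.
by diag (late, esym uE, za_one zx).
Qed.

Lemma half_braid_nat y z f : f ∷ rm_ob y ⇒ rm_ob z -> f ∘ ract y = ract z ∘ (f ⊠ 'id A) ->
  (f ⊠ 'id (rm_ob x)) ∘ half_braid x rho y = half_braid x rho z ∘ ('id (rm_ob x) ⊠ f).
Proof.
move=> fh fP; rewrite /half_braid.
by diag2 (fP, early) (esym (cz_nat zP fh), early).
Qed.

(** As with an R-matrix, the inverse arises by inserting the inverse antipode in the second leg,
    that of [Z]. *)
Definition half_braid_inv (y : rmodule A) : mor B :=
  (rho ⊠ ract y) ∘ inv (τ (rm_ob x ⊗ Z) (rm_ob y ⊗ A))
    ∘ ('id (rm_ob y ⊗ A) ⊠ inv (τ (rm_ob x) Z))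
    ∘ ('id (rm_ob y ⊗ A) ⊠ inv (antipode Z) ⊠ 'id (rm_ob x)) ∘ (delta (rm_ob y) ⊠ 'id (rm_ob x)).

Lemma half_braidK y : half_braid x rho y ∘ half_braid_inv y = 'id (rm_ob y ⊗ rm_ob x).
Proof.
rewrite /half_braid /half_braid_inv.
by diag (esym (cz_nat zP (ract_hom y)), late, ractA y, esym (czb_comul zbP (rm_ob y)), early,
  za_mul zx, skew_antipode_r Z, czb_counit zbP (rm_ob y), early, za_one zx, ract1 y).
Qed.

Lemma half_braidVK y : half_braid_inv y ∘ half_braid x rho y = 'id (rm_ob x ⊗ rm_ob y).
Proof.
rewrite /half_braid /half_braid_inv.
by diag (esym (cz_nat zP (ract_hom y)), late, ractA y, early, za_mul zx,
  late, esym (czb_comul zbP (rm_ob y)), late, skew_antipode_l Z, czb_counit zbP (rm_ob y), early,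
  za_one zx, ract1 y).
Qed.

End Action.

Definition free_rmodule (Y : ob B) : rmodule A.
Proof.
refine (@RModule _ A (Y ⊗ A) ('id Y ⊠ mul A) _ _ _); first by dhom.
- by diag (esym (mulA A)).
- by diag (mulh1 A).
Defined.

Section Converse.

Variables (x : rmodule A) (sig : rmodule A -> mor B).
Hypothesis sig_hom : forall y, sig y ∷ rm_ob x ⊗ rm_ob y ⇒ rm_ob y ⊗ rm_ob x.
Hypothesis sig_linear : forall y,
  sig y ∘ ract_tens x y = ract_tens y x ∘ (sig y ⊠ 'id A).
Hypothesis sig_nat : forall y z f, f ∷ rm_ob y ⇒ rm_ob z ->
  f ∘ ract y = ract z ∘ (f ⊠ 'id A) ->
  (f ⊠ 'id (rm_ob x)) ∘ sig y = sig z ∘ ('id (rm_ob x) ⊠ f).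
Hypothesis sig_tens : forall y z, sig (rmodule_tens y z) =
  ('id (rm_ob y) ⊠ sig z) ∘ (sig y ⊠ 'id (rm_ob z)).
Hypothesis sig_unit : sig (rmodule_unit A) = 'id (rm_ob x).
Local Notation M := (rm_ob x).

Lemma half_braid_exists : exists2 rho, zaction x rho & forall y, sig y = half_braid x rho y.
Proof.
have sh Y : sig (free_rmodule Y) ∷ M ⊗ (Y ⊗ A) ⇒ Y ⊗ A ⊗ M := sig_hom (free_rmodule Y).
have [Y|f Y Y' fh|rho] := @centralizer_exists _ _ _ _ zP M tunit M
  (fun Y => sig (free_rmodule Y) ∘ ('id M ⊠ 'id Y ⊠ one A)).
- by have ? := sh Y; dhom.
- have ? := sh Y; have ? := sh Y'.
  have fAh : f ⊠ 'id A ∷ rm_ob (free_rmodule Y) ⇒ rm_ob (free_rmodule Y') by rewrite /=; dhom.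
  have fAP : (f ⊠ 'id A) ∘ ract (free_rmodule Y) =
      ract (free_rmodule Y') ∘ (f ⊠ 'id A ⊠ 'id A) by rewrite /=; diag tt.
  by have e := sig_nat fAh fAP; diag (e).
rewrite tensx1 => rh rE.
have sE y : sig y = half_braid x rho y.
  (* The action of [y] is a linear map from the free module onto [y], split by the unit of A;
     naturality along it determines [sig y] from the free case. *)
  have yh := sig_hom y; have ? := sh (rm_ob y).
  have aP : ract y ∘ ract (free_rmodule (rm_ob y)) = ract y ∘ (ract y ⊠ 'id A).
    by rewrite ractA.
  have ah : ract y ∷ rm_ob (free_rmodule (rm_ob y)) ⇒ rm_ob y by rewrite /=; dhom.
  have e := sig_nat ah aP; rewrite /half_braid.
  have e' := rE (rm_ob y).
  by apply/esym; diag (e', e, ract1 y).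
exists rho => //; split=> //.
- apply: (centralizer_uniq zP (P := M ⊗ Z) (V := tunit) (W := M)); try dhom; move=> Y2.
  apply: (centralizer_uniq zP (P := M) (V := Y2) (W := Y2 ⊗ A ⊗ M)); try dhom; move=> Y1.
  have := sig_tens (free_rmodule Y1) (free_rmodule Y2).
  rewrite !sE /half_braid /= /ract_tens /= => e.
  have uuh : 'id Y1 ⊠ one A ⊠ 'id Y2 ⊠ one A ∷ Y1 ⊗ Y2 ⇒ Y1 ⊗ A ⊗ (Y2 ⊗ A) by dhom.
  have e1 := cz_nat zP uuh.
  (* Restricting to the generators of the free modules turns the actions into plain occurrences of
     [delta], to which uniqueness applies. *)
  have /(congr1 (fun f => f ∘ ('id M ⊠ ('id Y1 ⊠ one A ⊠ 'id Y2 ⊠ one A)))) {}e := e.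
  have uh Y : 'id Y ⊠ one A ∷ Y ⇒ Y ⊗ A by dhom.
  have e2 Y := cz_nat zP (uh Y).
  apply: (etrans _ (etrans (esym e) _)).
    by diag2 tt (esym (e2 Y1), esym (e2 Y2), mul1h A, mul1h A).
  by diag2 (esym e1, late, mul1h A, mul1h A) (late, mE Y1 Y2).
- have := sig_unit; rewrite sE /half_braid /= tens1x => e; rewrite -[RHS]e.
  have := czb_one zbP; have := cz_hom zP tunit; rewrite !tens1x => dh uE.
  by apply/esym; diag (late, esym uE).
- apply: (centralizer_uniq zP (P := M) (V := A) (W := M)); try dhom; move=> Y.
  have := sig_linear (free_rmodule Y); rewrite sE /half_braid /= /ract_tens /= => e.
  have /(congr1 (fun f => f ∘ ('id M ⊠ ('id Y ⊠ one A) ⊠ 'id A))) {}e := e.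
  have uh : 'id Y ⊠ one A ∷ Y ⇒ Y ⊗ A by dhom.
  have e2 := cz_nat zP uh.
  have F f : f ∷ M ⊗ Z ⊗ A ⇒ M ->
    fusion A (M ⊗ Y) Y tunit M (('id (Y ⊗ A) ⊠ f) ∘ (τ M (Y ⊗ A) ⊠ 'id (Z ⊗ A))
      ∘ ('id M ⊠ delta Y ⊠ 'id A)) =
    ('id Y ⊠ mul A ⊠ f) ∘ ('id (Y ⊗ A) ⊠ τ (M ⊗ Z) A ⊠ 'id A)
      ∘ (τ M (Y ⊗ A) ⊠ 'id (Z ⊗ A ⊗ A)) ∘ ('id M ⊠ delta Y ⊠ comul A).
    by move=> fh; rewrite /fusion; diag2 late (late).
  (* Linearity gives the required identity only with [h_1] multiplied into the output A, that is,
     after fusion. *)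
  rewrite -(fusionK (A := A) (P := M ⊗ Y) (Q := Y) (V := tunit) (W := M)
    (f := ('id (Y ⊗ A) ⊠ (ract x ∘ (rho ⊠ 'id A))) ∘ (τ M (Y ⊗ A) ⊠ 'id (Z ⊗ A))
      ∘ ('id M ⊠ delta Y ⊠ 'id A))); last dhom.
  rewrite -[RHS](fusionK (A := A) (P := M ⊗ Y) (Q := Y) (V := tunit) (W := M)); last dhom.
  congr unfusion; rewrite !F; try dhom.
  apply: (etrans _ (etrans (esym e) _)).
    by diag2 tt (esym e2, mul1h A).
  by diag2 (early, mul1h A, late) (late, LE Y, late).
Qed.

End Converse.

End HalfBraiding.

(** * Modules over the double as A-modules with an action of Z *)

Section DoubleModules.

Variables (B : brcat) (A Z D : hopf B) (Om : mor B).
Local Notation "'id" := idm (at level 0).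
Hypothesis Oh : Om ∷ Z ⊗ A ⇒ A ⊗ Z.
Hypothesis O1r : Om ∘ ('id Z ⊠ one A) = one A ⊠ 'id Z.
Hypothesis O1l : Om ∘ (one Z ⊠ 'id A) = 'id A ⊠ one Z.
Hypothesis Dob : carrier D = A ⊗ Z.
Hypothesis Dmul : mul D = (mul A ⊠ mul Z) ∘ ('id A ⊠ Om ⊠ 'id Z).
Hypothesis Done : one D = one A ⊠ one Z.
Hypothesis Dcomul : comul D = ('id A ⊠ τ A Z ⊠ 'id Z) ∘ (comul A ⊠ comul Z).
Hypothesis Dcounit : counit D = counit A ⊠ counit Z.

Section Restriction.

Variable y : rmodule D.
Local Notation M := (rm_ob y).
Local Notation t := (ract y).

#[local] Instance dact_Hom : Hom t (M ⊗ (A ⊗ Z)) M.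
Proof. by have := ract_hom y; rewrite Dob. Qed.

Lemma dactA : t ∘ (t ⊠ 'id A ⊠ 'id Z) = t ∘ ('id M ⊠ ((mul A ⊠ mul Z) ∘ ('id A ⊠ Om ⊠ 'id Z))).
Proof. by rewrite -Dmul -ractA Dob -tens_id tensmA. Qed.

Lemma dact1 : t ∘ ('id M ⊠ one A ⊠ one Z) = 'id M.
Proof. by rewrite -tensmA -Done ract1. Qed.

Definition dmod_A : rmodule A.
Proof.
refine (@RModule _ A M (t ∘ ('id (M ⊗ A) ⊠ one Z)) _ _ _); first by dhom.
- transitivity (t ∘ (t ⊠ 'id A ⊠ 'id Z) ∘ ('id (M ⊗ A) ⊠ one Z ⊠ 'id A ⊠ one Z)).
    by diag tt.
  by diag (dactA, O1l, mul1h Z).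
- by diag (dact1).
Defined.

Definition dmod_Z : mor B := t ∘ ('id M ⊠ one A ⊠ 'id Z).

(** In the double [a ⊗ z] is the product of [a ⊗ 1] and [1 ⊗ z], so the two restrictions determine
    the action. *)
Lemma dmod_act : dmod_Z ∘ (ract dmod_A ⊠ 'id Z) = t.
Proof.
rewrite /dmod_Z /=.
transitivity (t ∘ (t ⊠ 'id A ⊠ 'id Z) ∘ ('id (M ⊗ A) ⊠ one Z ⊠ one A ⊠ 'id Z)).
  by diag tt.
by diag (dactA, O1l, mulh1 A, mul1h Z).
Qed.

Lemma dmod_zaction : zaction Z Om dmod_A dmod_Z.
Proof.
split; rewrite /dmod_Z /=.
- by dhom.
- transitivity (t ∘ (t ⊠ 'id A ⊠ 'id Z) ∘ ('id M ⊠ one A ⊠ 'id Z ⊠ one A ⊠ 'id Z)).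
    by diag tt.
  by diag (dactA, O1r, mul1h A).
- by diag (dact1).
- transitivity (t ∘ (t ⊠ 'id A ⊠ 'id Z) ∘ ('id M ⊠ one A ⊠ 'id (Z ⊗ A) ⊠ one Z)).
    by diag tt.
  transitivity (t ∘ (t ⊠ 'id A ⊠ 'id Z) ∘ ('id (M ⊗ A) ⊠ one Z ⊠ one A ⊠ 'id Z)
     ∘ ('id M ⊠ Om)).
    by diag2 (dactA, mulh1 Z, mul1h A) (dactA, O1r, mulh1 A, mul1h Z).
  by diag tt.
Qed.

End Restriction.

Section Extension.

Variables (x : rmodule A) (rho : mor B).
Hypothesis zx : zaction Z Om x rho.
Let rho_Hom : Hom rho (rm_ob x ⊗ Z) (rm_ob x) := za_hom zx.
#[local] Existing Instance rho_Hom.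

Definition dmod : rmodule D.
Proof.
refine (@RModule _ D (rm_ob x) (rho ∘ (ract x ⊠ 'id Z)) _ _ _).
- by rewrite Dob; dhom.
- by rewrite Dob Dmul; diag2 (za_law zx, ractA x, za_mul zx) tt.
- by rewrite Done; diag (ract1 x, za_one zx).
Defined.

Lemma dmodK_A : dmod_A dmod = x.
Proof. by apply: rmodule_eq => //=; diag (za_one zx). Qed.

Lemma dmodK_Z : dmod_Z dmod = rho.
Proof. by rewrite /dmod_Z /=; diag (ract1 x). Qed.

End Extension.

#[local] Instance dmod_A_Hom y : Hom (ract (dmod_A y)) (rm_ob y ⊗ A) (rm_ob y) :=
  ract_hom (dmod_A y).
#[local] Instance dmod_Z_Hom y : Hom (dmod_Z y) (rm_ob y ⊗ Z) (rm_ob y) :=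
  za_hom (dmod_zaction y).

Lemma dmod_linear (y z : rmodule D) f : f ∷ rm_ob y ⇒ rm_ob z ->
  f ∘ ract y = ract z ∘ (f ⊠ 'id D) <->
  f ∘ ract (dmod_A y) = ract (dmod_A z) ∘ (f ⊠ 'id A) /\
  f ∘ dmod_Z y = dmod_Z z ∘ (f ⊠ 'id Z).
Proof.
move=> fh; have hy := dact_Hom y; have hz := dact_Hom z.
have -> : f ⊠ 'id D = f ⊠ 'id (A ⊗ Z) by rewrite Dob.
split=> [e|[eA eZ]].
  by split; rewrite /= /dmod_Z; diag (e).
by rewrite -(dmod_act y) -(dmod_act z); diag (eZ, eA).
Qed.

Lemma dmod_tens_A y z : dmod_A (rmodule_tens y z) = rmodule_tens (dmod_A y) (dmod_A z).
Proof.
apply: rmodule_eq => //=; rewrite /ract_tens /= Dcomul Dob.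
have hy := dact_Hom y; have hz := dact_Hom z.
by diag (comul_one Z, late).
Qed.

Lemma dmod_tens_Z y z : dmod_Z (rmodule_tens y z) =
  (dmod_Z y ⊠ dmod_Z z) ∘ ('id (rm_ob y) ⊠ τ (rm_ob z) Z ⊠ 'id Z)
    ∘ ('id (rm_ob y ⊗ rm_ob z) ⊠ comul Z).
Proof.
rewrite /dmod_Z /= /ract_tens /= Dcomul Dob.
have hy := dact_Hom y; have hz := dact_Hom z.
by diag (comul_one A, late).
Qed.

Lemma dmod_unit_A : dmod_A (rmodule_unit D) = rmodule_unit A.
Proof. by apply: rmodule_eq => //=; rewrite Dcounit; diag (counit_one Z). Qed.

Lemma dmod_unit_Z : dmod_Z (rmodule_unit D) = counit Z.
Proof. by rewrite /dmod_Z /= Dcounit; diag (counit_one A). Qed.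

End DoubleModules.

Section HalfBraidTens.

Variables (B : brcat) (A Z : hopf B) (delta : ob B -> mor B).
Hypothesis zbP : centralizer_bialgebra A Z delta.
Let zP := czb_centralizer zbP.
Let delta_Hom Y : Hom (delta Y) Y (Y ⊗ A ⊗ Z) := cz_hom zP Y.
#[local] Existing Instance delta_Hom.
Local Notation "'id" := idm (at level 0).

Lemma half_braid_tensl (x y w : rmodule A) rx ry :
  rx ∷ rm_ob x ⊗ Z ⇒ rm_ob x -> ry ∷ rm_ob y ⊗ Z ⇒ rm_ob y ->
  half_braid Z delta (rmodule_tens x y)
    ((rx ⊠ ry) ∘ ('id (rm_ob x) ⊠ τ (rm_ob y) Z ⊠ 'id Z)
      ∘ ('id (rm_ob x ⊗ rm_ob y) ⊠ comul Z)) w =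
  (half_braid Z delta x rx w ⊠ 'id (rm_ob y)) ∘ ('id (rm_ob x) ⊠ half_braid Z delta y ry w).
Proof.
move=> hx hy; rewrite /half_braid /=.
diag2 (late, czb_comul zbP (rm_ob w)) (late, esym (cz_nat zP (ract_hom w)), ractA w).
Qed.

Lemma half_braid_1l (w : rmodule A) :
  half_braid Z delta (rmodule_unit A) (counit Z) w = 'id (rm_ob w).
Proof. by rewrite /half_braid /=; diag (czb_counit zbP (rm_ob w), ract1 w). Qed.

Lemma half_braid_morph (x y w : rmodule A) rx ry f :
  rx ∷ rm_ob x ⊗ Z ⇒ rm_ob x -> ry ∷ rm_ob y ⊗ Z ⇒ rm_ob y -> f ∷ rm_ob x ⇒ rm_ob y ->
  f ∘ rx = ry ∘ (f ⊠ 'id Z) ->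
  ('id (rm_ob w) ⊠ f) ∘ half_braid Z delta x rx w = half_braid Z delta y ry w ∘ (f ⊠ 'id (rm_ob w)).
Proof. by move=> hx hy fh e; rewrite /half_braid; diag2 (e) (late). Qed.

(** Free modules already detect the action of [Z]: evaluated on their generators, the half braidings
    are the families of the universal property. *)
Lemma half_braid_inj (x y : rmodule A) rx ry f :
  rx ∷ rm_ob x ⊗ Z ⇒ rm_ob x -> ry ∷ rm_ob y ⊗ Z ⇒ rm_ob y -> f ∷ rm_ob x ⇒ rm_ob y ->
  (forall w : rmodule A, ('id (rm_ob w) ⊠ f) ∘ half_braid Z delta x rx w =
      half_braid Z delta y ry w ∘ (f ⊠ 'id (rm_ob w))) ->
  f ∘ rx = ry ∘ (f ⊠ 'id Z).
Proof.
move=> hx hy fh e.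
apply: (centralizer_uniq zP (P := rm_ob x) (V := tunit) (W := rm_ob y)); try dhom; move=> Y.
have := e (free_rmodule A Y); rewrite /half_braid /= => {}e.
have uh : 'id Y ⊠ one A ∷ Y ⇒ Y ⊗ A by dhom.
have e2 := cz_nat zP uh.
have /(congr1 (fun f => f ∘ ('id (rm_ob x) ⊠ ('id Y ⊠ one A)))) {}e := e.
apply: (etrans _ (etrans e _)).
  by diag2 tt (esym e2, mul1h A).
by diag2 (esym e2, mul1h A) late.
Qed.

End HalfBraidTens.

(** * Strict isomorphisms *)

Lemma inj_surj_bijective (T U : Type) (f : T -> U) :
  injective f -> (forall u, exists t, f t = u) -> bijective f.
Proof.
move=> fI fS; have [g gP] := choice fS.
by exists g => x; [apply: fI; rewrite gP | rewrite gP].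
Qed.

(** Modules and half braidings are equal as soon as their data are, so the comparison functors
    preserve tensor products on the nose and their coherence arrows are identities. *)
Record strict_iso (C D : brcat) (F : ob C -> ob D) (G : mor C -> mor D) : Prop :=
  StrictIso {
  si_dom : forall f, dom (G f) = F (dom f);
  si_cod : forall f, cod (G f) = F (cod f);
  si_id : forall X, G (idm X) = idm (F X);
  si_comp : forall g f, dom g = cod f -> G (g ∘ f) = G g ∘ G f;
  si_tens : forall X Y, F (X ⊗ Y) = F X ⊗ F Y;
  si_unit : F tunit = tunit;
  si_tensm : forall f g, G (f ⊠ g) = G f ⊠ G g;
  si_br : forall X Y, G (τ X Y) = τ (F X) (F Y);
  si_ob_bij : bijective F;
  si_mor_bij : bijective G }.

Lemma strict_iso_braided (C D : brcat) F G : @strict_iso C D F G -> braided_isomorphic C D.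
Proof.
move=> P.
have id_hom X Y : idm (F (X ⊗ Y)) ∷ F X ⊗ F Y ⇒ F (X ⊗ Y).
  by rewrite -(si_tens P); split; rewrite ?dom_id ?cod_id.
have id0_hom : idm tunit ∷ tunit ⇒ F tunit.
  by rewrite (si_unit P); split; rewrite ?dom_id ?cod_id.
unshelve eexists (@StrongFunctor C D F G _ (si_id P) (si_comp P)
  (fun X Y => idm (F (X ⊗ Y))) (idm tunit) id_hom id0_hom _ _ _ _ _ _).
- by move=> f; split; [exact: si_dom P f | exact: si_cod P f].
- by move=> X Y; exact: is_iso_id.
- exact: is_iso_id.
- move=> f g; rewrite comp_idr ?comp_idl //.
  + exact: si_tensm P f g.
  + by rewrite ?cod_tens ?(si_dom P) ?(si_cod P) ?dom_tens ?(si_tens P).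
  + by rewrite ?cod_tens ?(si_dom P) ?(si_cod P) ?dom_tens ?(si_tens P).
- by move=> X Y Z /=; rewrite !(si_tens P) !tens_id tensA.
- by move=> X /=; rewrite tens_id !tens1x comp_idl // cod_id.
- by move=> X /=; rewrite tens_id !tensx1 comp_idl // cod_id.
- split; [|exact: si_ob_bij P|exact: si_mor_bij P].
  move=> X Y /=; rewrite (si_br P).
  rewrite comp_idr ?comp_idl //.
  + by rewrite ?br_cod ?br_dom (si_tens P).
  + by rewrite ?br_cod ?br_dom (si_tens P).
Qed.

Lemma strict_iso_sym (C D : brcat) F G : @strict_iso C D F G ->
  exists F' G', @strict_iso D C F' G'.
Proof.
move=> P; have [F' FK FK'] := si_ob_bij P; have [G' GK GK'] := si_mor_bij P.
have FI := can_inj FK; have GI := can_inj GK.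
exists F', G'; split.
- by move=> f; apply: FI; rewrite -(si_dom P) GK' FK'.
- by move=> f; apply: FI; rewrite -(si_cod P) GK' FK'.
- by move=> X; apply: GI; rewrite (si_id P) GK' FK'.
- move=> g f gf; apply: GI; rewrite (si_comp P) ?GK' //.
  by apply: FI; rewrite -(si_dom P) -(si_cod P) !GK'.
- by move=> X Y; apply: FI; rewrite (si_tens P) !FK'.
- by apply: FI; rewrite (si_unit P) FK'.
- by move=> f g; apply: GI; rewrite (si_tensm P) !GK'.
- by move=> X Y; apply: GI; rewrite (si_br P) GK' !FK'.
- by exists F.
- by exists G.
Qed.

Section StructuredArrows.

Variables (C : smcat) (S : structured C).

Lemma arr_comp (g f : mor (structured_smcat S)) : dom g = cod f ->
  arr (g ∘ f : sarr S) = arr (g : sarr S) ∘ arr (f : sarr S).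
Proof. by move=> gf; case: (@scompE _ S g f gf). Qed.

Lemma smor_eq (f g : mor (structured_smcat S)) : dom f = dom g -> cod f = cod g ->
  arr (f : sarr S) = arr (g : sarr S) -> f = g.
Proof. exact: sarr_eq. Qed.

End StructuredArrows.

(** * Centers of categories of structured objects *)

Section StructuredIso.

Variables (C : smcat) (S : structured C).

Lemma arr_is_iso (f : mor (structured_smcat S)) : is_iso f -> is_iso (arr (f : sarr S)).
Proof.
move=> [g [dg cg gf fg]]; exists (arr (g : sarr S)).
split; rewrite ?sdom_arr ?scod_arr.
- exact: congr1 dg.
- exact: congr1 cg.
- by have := congr1 (@arr _ _) gf; rewrite arr_comp.
- by have := congr1 (@arr _ _) fg; rewrite arr_comp.
Qed.

Hypothesis smor_inv : forall x y f g, f ∷ under x ⇒ under y -> inverse f g ->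
  smor (s := S) x y f -> smor (s := S) y x g.

Lemma sarr_is_iso (f : sarr S) : is_iso (arr f) -> is_iso (f : mor (structured_smcat S)).
Proof.
by move=> [g gP]; apply: (structured_iso gP); exact: smor_inv (sarr_hom f) gP (sarr_smor f).
Qed.

Section HalfBraided.

Variables (M : sob S) (sig : sob S -> mor C).
Hypothesis sig_hom : forall y, sig y ∷ under M ⊗ under y ⇒ under y ⊗ under M.
Hypothesis sig_iso : forall y, is_iso (sig y).
Hypothesis sig_smor : forall y, smor (stens M y) (stens y M) (sig y).
Hypothesis sig_nat : forall y z f, f ∷ under y ⇒ under z -> smor y z f ->
  (f ⊠ idm (under M)) ∘ sig y = sig z ∘ (idm (under M) ⊠ f).
Hypothesis sig_tens : forall y z, sig (stens y z) =
  (idm (under y) ⊠ sig z) ∘ (sig y ⊠ idm (under z)).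
Hypothesis sig_unit : sig (sunit S) = idm (under M).

Let sig_shom y : sig y ∷ under (stens M y) ⇒ under (stens y M).
Proof. by rewrite !under_tens. Qed.

Definition structured_half_braided : half_braided (structured_smcat S).
Proof.
refine (@HalfBraided (structured_smcat S) M
  (fun y => SArr (sig_shom y) (sig_smor y)) _ _ _ _ _).
- by [].
- by move=> y; apply: sarr_is_iso; exact: sig_iso.
- move=> f; apply: smor_eq; rewrite ?dom_comp ?cod_comp ?arr_comp //=.
  exact: sig_nat (sarr_hom f) (sarr_smor f).
- by move=> y z; apply: smor_eq; rewrite ?dom_comp ?cod_comp ?arr_comp //= stensA.
- by apply: smor_eq; rewrite /= ?stens1x ?stensx1.
Defined.

End HalfBraided.

Section HalfBraided'.

Variables (M : sob S) (sig : sob S -> mor C).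
Hypothesis sig_hom : forall y, sig y ∷ under y ⊗ under M ⇒ under M ⊗ under y.
Hypothesis sig_iso : forall y, is_iso (sig y).
Hypothesis sig_smor : forall y, smor (stens y M) (stens M y) (sig y).
Hypothesis sig_nat : forall y z f, f ∷ under y ⇒ under z -> smor y z f ->
  (idm (under M) ⊠ f) ∘ sig y = sig z ∘ (f ⊠ idm (under M)).
Hypothesis sig_tens : forall y z, sig (stens y z) =
  (sig y ⊠ idm (under z)) ∘ (idm (under y) ⊠ sig z).
Hypothesis sig_unit : sig (sunit S) = idm (under M).

Let sig_shom y : sig y ∷ under (stens y M) ⇒ under (stens M y).
Proof. by rewrite !under_tens. Qed.

Definition structured_half_braided' : half_braided' (structured_smcat S).
Proof.
refine (@HalfBraided' (structured_smcat S) M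
  (fun y => SArr (sig_shom y) (sig_smor y)) _ _ _ _ _).
- by [].
- by move=> y; apply: sarr_is_iso; exact: sig_iso.
- move=> f; apply: smor_eq; rewrite ?dom_comp ?cod_comp ?arr_comp //=.
  exact: sig_nat (sarr_hom f) (sarr_smor f).
- by move=> y z; apply: smor_eq; rewrite ?dom_comp ?cod_comp ?arr_comp //= stensA.
- by apply: smor_eq; rewrite /= ?stens1x ?stensx1.
Defined.

End HalfBraided'.

End StructuredIso.

Section HalfBraidedArrows.

Variables (C : smcat) (S : structured C).
Notation hbarr s y := (arr (hb s y : sarr S)).
Notation hb'arr s y := (arr (hb' s y : sarr S)).

Section Unprimed.

Variable s : half_braided (structured_smcat S).
Local Notation M := (hb_ob s : sob S).

Lemma hb_sdom y : sdom (hb s y : sarr S) = stens M y.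
Proof. exact (hb_dom s y). Qed.

Lemma hb_scod y : scod (hb s y : sarr S) = stens y M.
Proof. exact (hb_cod s y). Qed.

Lemma hb_arr_hom (y : sob S) : hbarr s y ∷ under M ⊗ under y ⇒ under y ⊗ under M.
Proof. by have := sarr_hom (hb s y : sarr S); rewrite hb_sdom hb_scod !under_tens. Qed.

Lemma hb_arr_smor (y : sob S) : smor (stens M y) (stens y M) (hbarr s y).
Proof. by have := sarr_smor (hb s y : sarr S); rewrite hb_sdom hb_scod. Qed.

Lemma hb_arr_nat (y z : sob S) f : f ∷ under y ⇒ under z -> smor y z f ->
  (f ⊠ idm (under M)) ∘ hbarr s y = hbarr s z ∘ (idm (under M) ⊠ f).
Proof.
move=> fh fP; have := congr1 (@arr _ _) (hb_nat s (SArr fh fP)).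
by rewrite !arr_comp //= ?hb_sdom ?hb_scod.
Qed.

Lemma hb_arr_tens (y z : sob S) : hbarr s (stens y z) =
  (idm (under y) ⊠ hbarr s z) ∘ (hbarr s y ⊠ idm (under z)).
Proof.
have := congr1 (@arr _ _) (hb_tens s y z).
by rewrite arr_comp //= ?hb_sdom ?hb_scod ?stensA.
Qed.

Lemma hb_arr_unit : hbarr s (sunit S) = idm (under M).
Proof. exact (congr1 (@arr _ _) (hb_unit s)). Qed.

End Unprimed.

Section Primed.

Variable s : half_braided' (structured_smcat S).
Local Notation M := (hb'_ob s : sob S).

Lemma hb'_sdom y : sdom (hb' s y : sarr S) = stens y M.
Proof. exact (hb'_dom s y). Qed.

Lemma hb'_scod y : scod (hb' s y : sarr S) = stens M y.
Proof. exact (hb'_cod s y). Qed.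

Lemma hb'_arr_hom (y : sob S) : hb'arr s y ∷ under y ⊗ under M ⇒ under M ⊗ under y.
Proof. by have := sarr_hom (hb' s y : sarr S); rewrite hb'_sdom hb'_scod !under_tens. Qed.

Lemma hb'_arr_smor (y : sob S) : smor (stens y M) (stens M y) (hb'arr s y).
Proof. by have := sarr_smor (hb' s y : sarr S); rewrite hb'_sdom hb'_scod. Qed.

Lemma hb'_arr_nat (y z : sob S) f : f ∷ under y ⇒ under z -> smor y z f ->
  (idm (under M) ⊠ f) ∘ hb'arr s y = hb'arr s z ∘ (f ⊠ idm (under M)).
Proof.
move=> fh fP; have := congr1 (@arr _ _) (hb'_nat s (SArr fh fP)).
by rewrite !arr_comp //= ?hb'_sdom ?hb'_scod.
Qed.

Lemma hb'_arr_tens (y z : sob S) : hb'arr s (stens y z) =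
  (hb'arr s y ⊠ idm (under z)) ∘ (idm (under y) ⊠ hb'arr s z).
Proof.
have := congr1 (@arr _ _) (hb'_tens s y z).
by rewrite arr_comp //= ?hb'_sdom ?hb'_scod ?stensA.
Qed.

Lemma hb'_arr_unit : hb'arr s (sunit S) = idm (under M).
Proof. exact (congr1 (@arr _ _) (hb'_unit s)). Qed.

End Primed.

Lemma half_braided_arr_eq (s t : half_braided (structured_smcat S)) :
  hb_ob s = hb_ob t -> (forall y, hbarr s y = hbarr t y) -> s = t.
Proof.
move=> e eP; apply: half_braided_eq => // y; apply: smor_eq => //.
- by rewrite !hb_dom e.
- by rewrite !hb_cod e.
Qed.

Lemma half_braided'_arr_eq (s t : half_braided' (structured_smcat S)) :
  hb'_ob s = hb'_ob t -> (forall y, hb'arr s y = hb'arr t y) -> s = t.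
Proof.
move=> e eP; apply: half_braided'_eq => // y; apply: smor_eq => //.
- by rewrite !hb'_dom e.
- by rewrite !hb'_cod e.
Qed.

Lemma hb_tens_arr (s t : half_braided (structured_smcat S)) y :
  hbarr (half_braided_tens s t) y =
  (hbarr s y ⊠ idm (under (hb_ob t : sob S))) ∘ (idm (under (hb_ob s : sob S)) ⊠ hbarr t y).
Proof. by rewrite /= arr_comp //= ?hb_sdom ?hb_scod ?stensA. Qed.

Lemma hb'_tens_arr (s t : half_braided' (structured_smcat S)) y :
  hb'arr (half_braided'_tens s t) y =
  (idm (under (hb'_ob s : sob S)) ⊠ hb'arr t y) ∘ (hb'arr s y ⊠ idm (under (hb'_ob t : sob S))).
Proof. by rewrite /= arr_comp //= ?hb'_sdom ?hb'_scod ?stensA. Qed.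

End HalfBraidedArrows.

(** * The center of the category of right modules *)

Record double_data (B : brcat) (A Z D : hopf B) (delta : ob B -> mor B) (Om : mor B) :
    Prop := DoubleData {
  dd_centralizer : centralizer_bialgebra A Z delta;
  dd_hom : Om ∷ Z ⊗ A ⇒ A ⊗ Z;
  dd_law : exchange_law A Z delta Om;
  dd_ob : carrier D = A ⊗ Z;
  dd_mul : mul D = (mul A ⊠ mul Z) ∘ (idm A ⊠ Om ⊠ idm Z);
  dd_one : one D = one A ⊠ one Z;
  dd_comul : comul D = (idm A ⊠ τ A Z ⊠ idm Z) ∘ (comul A ⊠ comul Z);
  dd_counit : counit D = counit A ⊠ counit Z }.

Lemma rmod_inverse (B : brcat) (H : bialgebra B) (x y : rmodule H) f g :
  f ∷ rm_ob x ⇒ rm_ob y -> inverse f g -> smor (s := rmod_structured H) x y f ->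
  smor (s := rmod_structured H) y x g.
Proof.
move=> fh [dg cg gf fg] /= e; case: (fh) => df cf.
have gh : g ∷ rm_ob y ⇒ rm_ob x by split; rewrite ?dg ?cg ?df ?cf.
rewrite df in gf; rewrite cf in fg.
transitivity (g ∘ ract y ∘ ((f ∘ g) ⊠ idm H)); first by rewrite fg; diag tt.
transitivity (g ∘ (f ∘ ract x) ∘ (g ⊠ idm H)); first by rewrite e; diag tt.
by diag (gf).
Qed.

Section DoubleCenter.

Variables (B : brcat) (A Z D : hopf B) (delta : ob B -> mor B) (Om : mor B).
Hypothesis P : double_data A Z D delta Om.
Let zbP := dd_centralizer P.
Let Oh := dd_hom P.
Let OE := dd_law P.
Let O1r := distr_one zbP Oh OE.
Let O1l := distr_one_l zbP Oh OE.

Definition restrict_A (y : rmodule D) : rmodule A :=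
  dmod_A Oh O1l (dd_ob P) (dd_mul P) (dd_one P) y.
Definition restrict_Z (y : rmodule D) : mor B := dmod_Z A Z y.
Local Notation resA := restrict_A.
Local Notation resZ := restrict_Z.
Local Notation sigma y w := (half_braid Z delta (resA y) (resZ y) w).

Lemma restrict_zaction y : zaction Z Om (resA y) (resZ y).
Proof. exact: dmod_zaction Oh O1r O1l (dd_ob P) (dd_mul P) (dd_one P) y. Qed.
Local Notation zx := restrict_zaction.

Lemma restrict_A_tens y y' : resA (rmodule_tens y y') = rmodule_tens (resA y) (resA y').
Proof. exact: dmod_tens_A (dd_comul P) y y'. Qed.

Lemma restrict_Z_tens y y' : resZ (rmodule_tens y y') =
  (resZ y ⊠ resZ y') ∘ (idm (rm_ob y) ⊠ τ (rm_ob y') Z ⊠ idm Z)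
    ∘ (idm (rm_ob y ⊗ rm_ob y') ⊠ comul Z).
Proof. exact: dmod_tens_Z (dd_ob P) (dd_comul P) y y'. Qed.

Lemma restrict_A_unit : resA (rmodule_unit D) = rmodule_unit A.
Proof. exact: dmod_unit_A (dd_counit P). Qed.

Lemma restrict_Z_unit : resZ (rmodule_unit D) = counit Z.
Proof. exact: dmod_unit_Z (dd_counit P). Qed.

Lemma restrict_linear y z f : f ∷ rm_ob y ⇒ rm_ob z ->
  f ∘ ract y = ract z ∘ (f ⊠ idm D) <->
  f ∘ ract (resA y) = ract (resA z) ∘ (f ⊠ idm A) /\ f ∘ resZ y = resZ z ∘ (f ⊠ idm Z).
Proof. exact: dmod_linear. Qed.

Lemma sigma_hom y w : sigma y w ∷ rm_ob (resA y) ⊗ rm_ob w ⇒ rm_ob w ⊗ rm_ob (resA y).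
Proof. exact (half_braid_hom zbP (zx y) w). Qed.

Lemma sigma_inverse y w : inverse (sigma y w) (half_braid_inv Z delta (resA y) (resZ y) w).
Proof.
have [sd sc] := sigma_hom y w.
have gh : half_braid_inv Z delta (resA y) (resZ y) w
    ∷ rm_ob w ⊗ rm_ob (resA y) ⇒ rm_ob (resA y) ⊗ rm_ob w.
  have dh := cz_hom (czb_centralizer zbP) (rm_ob w); have rh := za_hom (zx y).
  by rewrite /half_braid_inv; dhom.
case: (gh) => gd gc; split; rewrite ?gd ?gc ?sd ?sc //.
- exact (half_braidVK zbP (zx y) w).
- exact (half_braidK zbP (zx y) w).
Qed.

Local Notation RA := (rmod_structured A).

Let sigma_iso y w : is_iso (sigma y w).
Proof. by eexists; exact: sigma_inverse. Qed.

Definition dmod_center (y : rmodule D) : half_braided (rmod A) :=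
  @structured_half_braided B RA (@rmod_inverse B A) (resA y) (fun w => sigma y w)
    (sigma_hom y) (sigma_iso y) (half_braid_linear zbP Oh OE (zx y))
    (half_braid_nat zbP (zx y)) (half_braid_tens zbP (zx y)) (half_braid_unit zbP (zx y)).

(** [stensA] with [stens] unfolded, the form that simplified goals present for rewriting. *)
Let tA : forall a b c : rmodule A,
  rmodule_tens a (rmodule_tens b c) = rmodule_tens (rmodule_tens a b) c := stensA (s := RA).
Lemma dmod_center_tens y y' :
  dmod_center (rmodule_tens y y') = half_braided_tens (dmod_center y) (dmod_center y').
Proof.
apply: half_braided_arr_eq => [|w]; first exact: restrict_A_tens.
rewrite hb_tens_arr /= restrict_A_tens restrict_Z_tens.
exact (half_braid_tensl zbP w (za_hom (zx y)) (za_hom (zx y'))).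
Qed.

Lemma dmod_center_unit : dmod_center (rmodule_unit D) = half_braided_unit (rmod A).
Proof.
apply: half_braided_arr_eq => [|w]; first exact: restrict_A_unit.
by rewrite /= restrict_A_unit restrict_Z_unit; exact (half_braid_1l zbP w).
Qed.

Lemma restrict_inj y y' : resA y = resA y' -> resZ y = resZ y' -> y = y'.
Proof.
move=> eA eZ; apply: rmodule_eq; first exact (congr1 (@rm_ob _ _) eA).
rewrite -(dmod_act Oh O1l (dd_ob P) (dd_mul P) (dd_one P) y).
by rewrite -(dmod_act Oh O1l (dd_ob P) (dd_mul P) (dd_one P) y') -/(resA y) -/(resA y') eA
  -/(resZ y) -/(resZ y') eZ.
Qed.

Lemma sigma_inj y y' f : f ∷ rm_ob (resA y) ⇒ rm_ob (resA y') ->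
  (forall w : rmodule A, (idm (rm_ob w) ⊠ f) ∘ sigma y w = sigma y' w ∘ (f ⊠ idm (rm_ob w))) ->
  f ∘ resZ y = resZ y' ∘ (f ⊠ idm Z).
Proof. by move=> fh; exact (half_braid_inj zbP (za_hom (zx y)) (za_hom (zx y')) fh). Qed.

Lemma dmod_center_inj : injective dmod_center.
Proof.
move=> y y' e; have eA : resA y = resA y' := congr1 (@hb_ob _) e.
apply: (restrict_inj eA).
(* Equality of the two actions of [Z] is linearity of the identity, and this follows from the
   equality of the half braidings. *)
have idh : idm (rm_ob (resA y)) ∷ rm_ob (resA y) ⇒ rm_ob (resA y').
  by split; rewrite ?dom_id ?cod_id ?eA.
have zh := za_hom (zx y); have zh' := za_hom (zx y'); rewrite -eA in zh'.
have := sigma_inj (y := y) (y' := y') idh; rewrite tens_id.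
have -> : idm (rm_ob (resA y)) ∘ resZ y = resZ y by apply: comp_idl; case: zh.
have -> : resZ y' ∘ idm (rm_ob (resA y) ⊗ Z) = resZ y' by apply: comp_idr; case: zh'.
apply=> w; rewrite !tens_id.
have [d c] := sigma_hom y w; have [d' c'] := sigma_hom y' w.
rewrite comp_idl // comp_idr; last by rewrite d' eA.
by have /(congr1 (fun s : half_braided (rmod A) => arr (hb s w : sarr RA))) := e.
Qed.

Lemma dmod_center_surj (s : half_braided (rmod A)) : exists y, dmod_center y = s.
Proof.
have [rho rhoP rhoE] := half_braid_exists zbP Oh OE (hb_arr_hom s) (hb_arr_smor s)
  (@hb_arr_nat _ _ s) (hb_arr_tens s) (hb_arr_unit s).
pose y := dmod Oh (dd_ob P) (dd_mul P) (dd_one P) rhoP.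
have eA : resA y = hb_ob s by exact (dmodK_A _ _ _ _ _ rhoP).
have eZ : resZ y = rho by exact (dmodK_Z _ _ _ _ rhoP).
by exists y; apply: half_braided_arr_eq => //= w; rewrite rhoE eA eZ.
Qed.

Local Notation RD := (rmod_structured D).
Local Notation ZR := (center_structured (rmod A)).

Lemma restrict_arr_smor (f : sarr RD) :
  f ∘ ract (resA (sdom f)) = ract (resA (scod f)) ∘ (f ⊠ idm A) :> mor B.
Proof. exact (proj1 (proj1 (restrict_linear (sarr_hom f)) (sarr_smor f))). Qed.

Definition restrict_arr (f : sarr RD) : sarr RA :=
  @SArr B RA (resA (sdom f)) (resA (scod f)) f (sarr_hom f) (restrict_arr_smor f).

Lemma center_arr_smor (f : sarr RD) :
  smor (s := ZR) (dmod_center (sdom f)) (dmod_center (scod f)) (restrict_arr f).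
Proof.
move=> w; apply: smor_eq; rewrite ?dom_comp ?cod_comp ?arr_comp //=.
have [_ e] := proj1 (restrict_linear (sarr_hom f)) (sarr_smor f).
exact (half_braid_morph zbP w (za_hom (zx (sdom f))) (za_hom (zx (scod f))) (sarr_hom f) e).
Qed.

Lemma center_arr_hom (f : sarr RD) : (restrict_arr f : mor (rmod A)) ∷
  under (s := ZR) (dmod_center (sdom f)) ⇒ under (s := ZR) (dmod_center (scod f)).
Proof. by []. Qed.

Definition center_arr (f : sarr RD) : sarr ZR :=
  SArr (center_arr_hom f) (center_arr_smor f).

Lemma center_arr_inj : injective center_arr.
Proof.
move=> f g e; apply: sarr_eq.
- exact (dmod_center_inj (congr1 (@sdom _ _) e)).
- exact (dmod_center_inj (congr1 (@scod _ _) e)).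
- exact (congr1 (fun h : sarr ZR => arr (arr h : sarr RA)) e).
Qed.

Lemma center_arr_surj (g : sarr ZR) : exists f, center_arr f = g.
Proof.
case: g => x x' g; have [y <-] := dmod_center_surj x; have [y' <-] := dmod_center_surj x'.
move=> gh gs; case: (gh) => /= ed ec.
have gh0 : arr (g : sarr RA) ∷ rm_ob y ⇒ rm_ob y'.
  by have := sarr_hom (g : sarr RA); rewrite [sdom _]ed [scod _]ec.
have fP : arr (g : sarr RA) ∘ ract y = ract y' ∘ (arr (g : sarr RA) ⊠ idm D).
  apply/(restrict_linear gh0); split.
    by have := sarr_smor (g : sarr RA); rewrite [sdom _]ed [scod _]ec.
  apply: sigma_inj => // w; have := congr1 (@arr _ _) (gs w).
  by rewrite !arr_comp //= ?[sdom _]ed ?[scod _]ec.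
exists (@SArr B RD y y' (arr (g : sarr RA)) gh0 fP).
by apply: sarr_eq => //=; apply: sarr_eq.
Qed.

(** No identity for an R-matrix in the double is verified directly: linearity, naturality and the
    hexagons all come from the half braidings. *)
Lemma rbraiding_exists : exists c : braiding (rmod D),
  forall x y : rmodule D, arr (c x y : sarr RD) = sigma x (resA y).
Proof.
have smorP (x y : rmodule D) : smor (s := RD) (rmodule_tens x y) (rmodule_tens y x)
    (sigma x (resA y)).
  apply/(restrict_linear (y := rmodule_tens x y) (z := rmodule_tens y x)).
    exact (sigma_hom x (resA y)).
  split.
    by rewrite !restrict_A_tens; exact (half_braid_linear zbP Oh OE (zx x) (resA y)).
  (* Linearity over [Z] is commutation with all half braidings, which holds because the braiding of
     the center is an arrow of the center. *)
  apply: (sigma_inj (y := rmodule_tens x y) (y' := rmodule_tens y x)).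
    exact (sigma_hom x (resA y)).
  move=> w.
  have := congr1 (@arr _ _) (center_br_smor (dmod_center x) (dmod_center y) w).
  rewrite !arr_comp ?dom_comp ?cod_comp /= ?tA //.
  rewrite !restrict_A_tens !restrict_Z_tens.
  rewrite (half_braid_tensl zbP w (za_hom (zx x)) (za_hom (zx y))).
  by rewrite (half_braid_tensl zbP w (za_hom (zx y)) (za_hom (zx x))).
unshelve eexists (@structured_braiding B RD (fun x y => sigma x (resA y))
  (fun x y => sigma_hom x (resA y)) smorP _ _ _ _); last by [].
- move=> x y; eexists; first exact (sigma_inverse x (resA y)).
  exact (@rmod_inverse _ _ (rmodule_tens x y) (rmodule_tens y x) _ _
    (sigma_hom x (resA y)) (sigma_inverse x (resA y)) (smorP x y)).
- move=> x y x' y' f g fh gh fP gP.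
  have [fA fZ] := proj1 (restrict_linear fh) fP.
  have [gA _] := proj1 (restrict_linear gh) gP.
  have e1 : (idm (rm_ob y) ⊠ f) ∘ sigma x (resA y) = sigma x' (resA y) ∘ (f ⊠ idm (rm_ob y)).
    exact (half_braid_morph zbP (resA y) (za_hom (zx x)) (za_hom (zx x')) fh fZ).
  have e2 : (g ⊠ idm (rm_ob x')) ∘ sigma x' (resA y) = sigma x' (resA y') ∘ (idm (rm_ob x') ⊠ g).
    exact (half_braid_nat zbP (zx x') (y := resA y) (z := resA y') gh gA).
  (* [rm_ob (resA a)] is convertible to [rm_ob a] but is another atom for [diag]. *)
  have h (a b : rmodule D) : sigma a (resA b) ∷ rm_ob a ⊗ rm_ob b ⇒ rm_ob b ⊗ rm_ob a.
    exact (sigma_hom a (resA b)).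
  have h1 := h x y; have h2 := h x' y'; have h3 := h x' y.
  have fh' : f ∷ rm_ob x ⇒ rm_ob x' by []; have gh' : g ∷ rm_ob y ⇒ rm_ob y' by [].
  clear fh gh; move: h1 h2 h3 e1 e2.
  move: (sigma x (resA y)) (sigma x' (resA y)) (sigma x' (resA y')) => s1 s2 s3 h1 h2 h3 e1 e2.
  by diag (esym e2, esym e1).
- move=> x y z /=; rewrite restrict_A_tens.
  exact (half_braid_tens zbP (zx x) (resA y) (resA z)).
- move=> x y z /=; rewrite restrict_A_tens restrict_Z_tens.
  exact (half_braid_tensl zbP (resA z) (za_hom (zx x)) (za_hom (zx y))).
Qed.

Section RightBraiding.

Variable c : braiding (rmod D).
Hypothesis cE : forall x y : rmodule D, arr (c x y : sarr RD) = sigma x (resA y).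

Lemma center_strict_iso : @strict_iso (BrCat c) (center (rmod A)) dmod_center center_arr.
Proof.
split.
- by [].
- by [].
- move=> y; apply: sarr_eq => //=; exact: sarr_eq.
- move=> g f gf.
  have ed : sdom (g ∘ f : sarr RD) = sdom (f : sarr RD) := dom_comp gf.
  have ec : scod (g ∘ f : sarr RD) = scod (g : sarr RD) := cod_comp gf.
  have gfA : dom (restrict_arr g : mor (rmod A)) = cod (restrict_arr f : mor (rmod A)) :=
    congr1 resA gf.
  have gfZ : dom (center_arr g : mor (center (rmod A))) =
    cod (center_arr f : mor (center (rmod A))) := congr1 dmod_center gf.
  apply: smor_eq; first by rewrite (dom_comp gfZ) /= ed.
    by rewrite (cod_comp gfZ) /= ec.
  rewrite (arr_comp gfZ) /=; apply: smor_eq.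
  + by rewrite (dom_comp gfA) /= ed.
  + by rewrite (cod_comp gfA) /= ec.
  + by rewrite (arr_comp gfA) /= (arr_comp gf).
- exact: dmod_center_tens.
- exact: dmod_center_unit.
- move=> f g; apply: sarr_eq; rewrite /= ?dmod_center_tens //.
  by apply: sarr_eq; rewrite /= ?restrict_A_tens.
- move=> x y.
  have ed : sdom (c x y : sarr RD) = rmodule_tens x y := proj1 (br_hom c x y).
  have ec : scod (c x y : sarr RD) = rmodule_tens y x := proj2 (br_hom c x y).
  apply: sarr_eq; rewrite /= ?ed ?ec ?dmod_center_tens //.
  by apply: sarr_eq; rewrite /= ?ed ?ec ?cE ?restrict_A_tens.
- exact (inj_surj_bijective dmod_center_inj dmod_center_surj).
- exact (inj_surj_bijective center_arr_inj center_arr_surj).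
Qed.

End RightBraiding.

End DoubleCenter.

(** * Left and right modules *)

#[export] Instance lact_Hom (B : brcat) (H : bialgebra B) (x : lmodule H) :
  Hom (lact x) (carrier H ⊗ lm_ob x) (lm_ob x) := lact_hom x.

Section Flip.

Variables (B : brcat) (H : hopf B).
Local Notation h := (idm (carrier H)).
Local Notation S := (antipode H).
Local Notation S' := (inv (antipode H)).

Lemma inv_antipode_mul : S' ∘ mul H = mul H ∘ inv (τ H H) ∘ (S' ⊠ S').
Proof.
transitivity (S' ∘ mul H ∘ τ H H ∘ (S ⊠ S) ∘ inv (τ H H) ∘ (S' ⊠ S')).
  by apply/esym; diag (late, antipodeVK H, antipodeVK H).
by diag (esym (antipode_mul H), antipodeK H).
Qed.

Definition to_right (x : lmodule H) : rmodule H.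
Proof.
refine (@RModule _ H (lm_ob x) (lact x ∘ τ (lm_ob x) H ∘ (idm (lm_ob x) ⊠ S)) _ _ _).
- by dhom.
- by diag2 (late, lactA x) (antipode_mul H, late).
- by diag (antipode_one H, early, lact1 x).
Defined.

Definition to_left (y : rmodule H) : lmodule H.
Proof.
refine (@LModule _ H (rm_ob y) (ract y ∘ (idm (rm_ob y) ⊠ S') ∘ inv (τ (rm_ob y) H)) _ _ _).
- by dhom.
- by diag2 (late, ractA y) (late, inv_antipode_mul, late).
- by diag (late, inv_antipode_one H, ract1 y).
Defined.

Lemma to_rightK : cancel to_right to_left.
Proof. by move=> x; apply: lmodule_eq => //=; diag (antipodeVK H, early). Qed.

Lemma to_leftK : cancel to_left to_right.
Proof. by move=> y; apply: rmodule_eq => //=; diag (late, antipodeK H). Qed.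

Lemma to_right_linear (x x' : lmodule H) f : f ∷ lm_ob x ⇒ lm_ob x' ->
  f ∘ lact x = lact x' ∘ (h ⊠ f) <->
  f ∘ ract (to_right x) = ract (to_right x') ∘ (f ⊠ h).
Proof.
move=> fh; split=> /= e; first by diag2 (e) (late).
transitivity (f ∘ lact x ∘ τ (lm_ob x) H ∘ (idm (lm_ob x) ⊠ S) ∘ (idm (lm_ob x) ⊠ S')
    ∘ inv (τ (lm_ob x) H)).
  by apply/esym; diag (antipodeVK H, early).
by diag (e, antipodeVK H, late).
Qed.

(** The antipode reverses the coproduct up to τ, so the passage to right modules reverses tensor
    products up to the isomorphism τ. *)
Lemma to_right_tens (x y : lmodule H) :
  τ (lm_ob y) (lm_ob x) ∘ ract_tens (to_right y) (to_right x) =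
  ract (to_right (lmodule_tens x y)) ∘ (τ (lm_ob y) (lm_ob x) ⊠ h).
Proof.
rewrite /= /ract_tens /lact_tens /=.
by diag2 (early) (antipode_comul H, early).
Qed.

Lemma to_right_unit : to_right (lmodule_unit H) = rmodule_unit H.
Proof. by apply: rmodule_eq => //=; rewrite br_1x; diag (counit_antipode H). Qed.

End Flip.

Section StructuredBraiding.

Variables (C : smcat) (S : structured C) (c : braiding (structured_smcat S)).
Implicit Types x y z : sob S.

Lemma br_sdom x y : sdom (c x y : sarr S) = stens x y.
Proof. exact: proj1 (br_hom c x y). Qed.

Lemma br_scod x y : scod (c x y : sarr S) = stens y x.
Proof. exact: proj2 (br_hom c x y). Qed.

Lemma br_arr_hom x y : arr (c x y : sarr S) ∷ under x ⊗ under y ⇒ under y ⊗ under x.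
Proof. by have := sarr_hom (c x y : sarr S); rewrite br_sdom br_scod !under_tens. Qed.

Lemma br_arr_smor x y : smor (stens x y) (stens y x) (arr (c x y : sarr S)).
Proof. by have := sarr_smor (c x y : sarr S); rewrite br_sdom br_scod. Qed.

Lemma br_arr_nat x y x' y' f g : f ∷ under x ⇒ under x' -> g ∷ under y ⇒ under y' ->
  smor x x' f -> smor y y' g ->
  arr (c x' y' : sarr S) ∘ (f ⊠ g) = (g ⊠ f) ∘ arr (c x y : sarr S).
Proof.
move=> fh gh fP gP; have := br_nat c (SArr fh fP) (SArr gh gP).
by move/(congr1 (@arr _ _)); rewrite !arr_comp //= ?br_sdom ?br_scod.
Qed.

Lemma br_arr_tensr x y z : arr (c x (stens y z) : sarr S) =
  (idm (under y) ⊠ arr (c x z : sarr S)) ∘ (arr (c x y : sarr S) ⊠ idm (under z)).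
Proof.
by have /(congr1 (@arr _ _)) := br_tensr c x y z; rewrite arr_comp //= br_sdom br_scod stensA.
Qed.

Lemma br_arr_tensl x y z : arr (c (stens x y) z : sarr S) =
  (arr (c x z : sarr S) ⊠ idm (under y)) ∘ (idm (under x) ⊠ arr (c y z : sarr S)).
Proof.
by have /(congr1 (@arr _ _)) := br_tensl c x y z; rewrite arr_comp //= br_sdom br_scod stensA.
Qed.

Lemma br_arr_1x x : arr (c (sunit S) x : sarr S) = idm (under x).
Proof. exact (congr1 (@arr _ _) (@br_1x (BrCat c) x)). Qed.

Lemma br_arr_x1 x : arr (c x (sunit S) : sarr S) = idm (under x).
Proof. exact (congr1 (@arr _ _) (@br_x1 (BrCat c) x)). Qed.

Lemma br_arr_iso x y : is_iso (arr (c x y : sarr S)).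
Proof. exact (arr_is_iso (br_iso c x y)). Qed.

End StructuredBraiding.

Section FlipTensor.

Variables (B : brcat) (H : hopf B).
Local Notation RH := (rmod_structured H).
Local Notation LH := (lmod_structured H).
Local Notation F := to_right.

Lemma flip_tau_hom (x y : lmodule H) : τ (lm_ob y) (lm_ob x) ∷
  rm_ob (rmodule_tens (F y) (F x)) ⇒ rm_ob (F (lmodule_tens x y)).
Proof. exact: br_hom. Qed.

Lemma flip_tau_linear (x y : lmodule H) :
  smor (s := RH) (rmodule_tens (F y) (F x)) (F (lmodule_tens x y)) (τ (lm_ob y) (lm_ob x)).
Proof. exact: to_right_tens. Qed.

Lemma flip_tau_inv_linear (x y : lmodule H) :
  smor (s := RH) (F (lmodule_tens x y)) (rmodule_tens (F y) (F x)) (inv (τ (lm_ob y) (lm_ob x))).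
Proof. exact (rmod_inverse (flip_tau_hom x y) (inv_br _ _) (flip_tau_linear x y)). Qed.

Lemma flip_linear (x y : lmodule H) f :
  f ∷ lm_ob y ⊗ lm_ob x ⇒ lm_ob x ⊗ lm_ob y ->
  smor (s := LH) (lmodule_tens x y) (lmodule_tens y x)
    (τ (lm_ob x) (lm_ob y) ∘ f ∘ inv (τ (lm_ob y) (lm_ob x))) <->
  smor (s := RH) (rmodule_tens (F y) (F x)) (rmodule_tens (F x) (F y)) f.
Proof.
move=> fh; set g := τ (lm_ob x) (lm_ob y) ∘ _.
have gh : g ∷ lm_ob x ⊗ lm_ob y ⇒ lm_ob y ⊗ lm_ob x by rewrite /g; dhom.
have th (x' y' : lmodule H) : τ (lm_ob x') (lm_ob y') ∷ lm_ob x' ⊗ lm_ob y' ⇒ lm_ob y' ⊗ lm_ob x'.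
  by dhom.
have ih (x' y' : lmodule H) : inv (τ (lm_ob x') (lm_ob y')) ∷
    lm_ob y' ⊗ lm_ob x' ⇒ lm_ob x' ⊗ lm_ob y'.
  by dhom.
apply: (iff_trans (to_right_linear (x := lmodule_tens x y) (x' := lmodule_tens y x) gh)).
have t1 := flip_tau_linear x y; have t2 := flip_tau_linear y x.
have i1 := flip_tau_inv_linear x y; have i2 := flip_tau_inv_linear y x.
pose xy := F (lmodule_tens x y); pose yx := F (lmodule_tens y x).
pose x_y := rmodule_tens (F x) (F y); pose y_x := rmodule_tens (F y) (F x).
split=> P.
- have -> : f = inv (τ (lm_ob x) (lm_ob y)) ∘ (g ∘ τ (lm_ob y) (lm_ob x)).
    by apply/esym; rewrite /g; diag early.
  have gt : g ∘ τ (lm_ob y) (lm_ob x) ∷ lm_ob y ⊗ lm_ob x ⇒ lm_ob y ⊗ lm_ob x by dhom.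
  exact (smor_comp (s := RH) (x := y_x) (y := yx) (z := x_y) gt (ih x y)
    (smor_comp (s := RH) (x := y_x) (y := xy) (z := yx) (th y x) gh t1 P) i2).
- have fi : f ∘ inv (τ (lm_ob y) (lm_ob x)) ∷ lm_ob x ⊗ lm_ob y ⇒ lm_ob x ⊗ lm_ob y by dhom.
  exact (smor_comp (s := RH) (x := xy) (y := x_y) (z := yx) fi (th x y)
    (smor_comp (s := RH) (x := xy) (y := y_x) (z := x_y) (ih y x) fh i1 P) t2).
Qed.

End FlipTensor.

Section FlippedBraiding.

Variables (B : brcat) (H : hopf B).
Local Notation RH := (rmod_structured H).
Local Notation LH := (lmod_structured H).
Variable c : braiding (structured_smcat RH).
Local Notation rarr x y := (arr (c x y : sarr RH)).
Local Notation F := to_right.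
Local Notation G := to_left.

Let ch x y : rarr x y ∷ rm_ob x ⊗ rm_ob y ⇒ rm_ob y ⊗ rm_ob x := br_arr_hom c x y.
Let cf (x y : lmodule H) : rarr (F x) (F y) ∷ lm_ob x ⊗ lm_ob y ⇒ lm_ob y ⊗ lm_ob x :=
  ch (F x) (F y).

Definition flip_braiding (x y : lmodule H) : mor B :=
  τ (lm_ob x) (lm_ob y) ∘ rarr (F y) (F x) ∘ inv (τ (lm_ob y) (lm_ob x)).

Lemma flip_braiding_hom x y : flip_braiding x y ∷ lm_ob x ⊗ lm_ob y ⇒ lm_ob y ⊗ lm_ob x.
Proof. by have ? := cf y x; rewrite /flip_braiding; dhom. Qed.

Lemma flip_braiding_linear (x y : lmodule H) :
  smor (s := LH) (lmodule_tens x y) (lmodule_tens y x) (flip_braiding x y).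
Proof. by apply/(flip_linear (cf y x)); exact: br_arr_smor. Qed.

Lemma flip_braiding_nat x y x' y' f g : f ∷ lm_ob x ⇒ lm_ob x' -> g ∷ lm_ob y ⇒ lm_ob y' ->
  smor (s := LH) x x' f -> smor (s := LH) y y' g ->
  flip_braiding x' y' ∘ (f ⊠ g) = (g ⊠ f) ∘ flip_braiding x y.
Proof.
move=> fh gh /(to_right_linear fh) fP /(to_right_linear gh) gP.
have e := br_arr_nat c (x := F y) (y := F x) (x' := F y') (y' := F x') gh fh gP fP.
have ? := cf y x; have ? := cf y' x'.
by rewrite /flip_braiding; diag2 (early, e) tt.
Qed.

Lemma flip_braiding_tensr x y z : flip_braiding x (lmodule_tens y z) =
  (idm (lm_ob y) ⊠ flip_braiding x z) ∘ (flip_braiding x y ⊠ idm (lm_ob z)).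
Proof.
have ih : idm (lm_ob x) ∷ lm_ob x ⇒ lm_ob x by split; rewrite ?dom_id ?cod_id.
have := br_arr_nat c (x := rmodule_tens (F z) (F y)) (x' := F (lmodule_tens y z))
  (y := F x) (y' := F x) (flip_tau_hom y z) ih (flip_tau_linear y z) (smor_id (s := RH) (F x)).
rewrite (br_arr_tensl c (F z) (F y) (F x)) /= => e.
have ? := cf y x; have ? := cf z x; have /= ? := cf (lmodule_tens y z) x.
(* Naturality of [c] along the linear isomorphism τ moves from the flipped product to the reversed
   product of the flips, where the hexagon applies. *)
have e' : rarr (F (lmodule_tens y z)) (F x) = (idm (lm_ob x) ⊠ τ (lm_ob z) (lm_ob y))
    ∘ (rarr (F z) (F x) ⊠ idm (lm_ob y)) ∘ (idm (lm_ob z) ⊠ rarr (F y) (F x))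
    ∘ (inv (τ (lm_ob z) (lm_ob y)) ⊠ idm (lm_ob x)).
  by apply/esym; diag (esym e, early).
by rewrite /flip_braiding /=; diag2 (e', late) late.
Qed.

Lemma flip_braiding_tensl x y z : flip_braiding (lmodule_tens x y) z =
  (flip_braiding x z ⊠ idm (lm_ob y)) ∘ (idm (lm_ob x) ⊠ flip_braiding y z).
Proof.
have ih : idm (lm_ob z) ∷ lm_ob z ⇒ lm_ob z by split; rewrite ?dom_id ?cod_id.
have := br_arr_nat c (x := F z) (x' := F z) (y := rmodule_tens (F y) (F x))
  (y' := F (lmodule_tens x y)) ih (flip_tau_hom x y) (smor_id (s := RH) (F z))
  (flip_tau_linear x y).
rewrite (br_arr_tensr c (F z) (F y) (F x)) /= => e.
have ? := cf z x; have ? := cf z y; have /= ? := cf z (lmodule_tens x y).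
have e' : rarr (F z) (F (lmodule_tens x y)) = (τ (lm_ob y) (lm_ob x) ⊠ idm (lm_ob z))
    ∘ (idm (lm_ob y) ⊠ rarr (F z) (F x)) ∘ (rarr (F z) (F y) ⊠ idm (lm_ob x))
    ∘ (idm (lm_ob z) ⊠ inv (τ (lm_ob y) (lm_ob x))).
  by apply/esym; diag (esym e, early).
by rewrite /flip_braiding /=; diag2 (e', late) late.
Qed.

Lemma lmod_inverse (x y : lmodule H) f g : f ∷ lm_ob x ⇒ lm_ob y -> inverse f g ->
  smor (s := LH) x y f -> smor (s := LH) y x g.
Proof.
move=> fh fg /(to_right_linear fh) fP.
have gh : g ∷ lm_ob y ⇒ lm_ob x by case: fg fh => dg cg _ _ [df ef]; split; rewrite ?dg ?cg.
by apply/(to_right_linear gh); exact: (rmod_inverse (x := F x) (y := F y) fh fg fP).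
Qed.

Lemma flip_braiding_iso x y : is_iso (flip_braiding x y).
Proof.
have ? := cf y x; have [d c'] := cf y x; rewrite /flip_braiding.
apply: is_iso_comp; last exact: br_iso.
  by rewrite br_dom !cod_comp ?c' ?d ?inv_br_cod.
apply: is_iso_comp; [by rewrite d inv_br_cod | | exact: br_arr_iso].
by exists (τ (lm_ob y) (lm_ob x)); apply: inverse_sym; exact: inv_br.
Qed.

Lemma lbraiding_exists : exists c' : braiding (lmod H),
  forall x y, arr (c' x y : sarr LH) = flip_braiding x y.
Proof.
unshelve eexists (@structured_braiding B LH flip_braiding
  flip_braiding_hom flip_braiding_linear _ _ _ _); last by [].
- move=> x y; have [g gP] := flip_braiding_iso x y; exists g => //.
  exact: (lmod_inverse (x := lmodule_tens x y) (y := lmodule_tens y x)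
    (flip_braiding_hom x y) gP (flip_braiding_linear x y)).
- exact: flip_braiding_nat.
- exact: flip_braiding_tensr.
- exact: flip_braiding_tensl.
Qed.

Section Functor.

Variable c' : braiding (structured_smcat LH).
Hypothesis c'E : forall x y, arr (c' x y : sarr LH) = flip_braiding x y.

Lemma to_left_linear (x y : rmodule H) f : f ∷ rm_ob x ⇒ rm_ob y ->
  smor (s := RH) x y f -> smor (s := LH) (G x) (G y) f.
Proof.
by move=> fh fP; apply/(to_right_linear (x := G x) (x' := G y) fh); rewrite !to_leftK.
Qed.

Definition to_left_arr (f : sarr RH) : sarr LH :=
  @SArr B LH (G (sdom f)) (G (scod f)) f (sarr_hom f)
    (to_left_linear (sarr_hom f) (sarr_smor f)).

(** The inverse braiding of the base category lands in the image of [y ⊗ x]; the braiding [c] of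
    modules puts the factors back in order. *)
Definition to_left_2 (x y : rmodule H) : mor B :=
  rarr y x ∘ inv (τ (rm_ob y) (rm_ob x)).

Lemma to_left_2_hom x y : to_left_2 x y ∷
  lm_ob (lmodule_tens (G x) (G y)) ⇒ lm_ob (G (rmodule_tens x y)).
Proof. by have ? := ch y x; rewrite /to_left_2 /=; dhom. Qed.

Lemma to_left_2_linear x y : smor (s := LH) (lmodule_tens (G x) (G y))
  (G (rmodule_tens x y)) (to_left_2 x y).
Proof.
apply/(to_right_linear (to_left_2_hom x y)); rewrite !to_leftK.
have := flip_tau_inv_linear (G x) (G y); rewrite !to_leftK => e1.
have ih : inv (τ (rm_ob y) (rm_ob x)) ∷ rm_ob x ⊗ rm_ob y ⇒ rm_ob y ⊗ rm_ob x by dhom.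
exact (smor_comp (s := RH) (x := F (lmodule_tens (G x) (G y))) (y := rmodule_tens y x)
  (z := rmodule_tens x y) ih (ch y x) e1 (br_arr_smor c y x)).
Qed.

Definition to_left_2_arr (x y : rmodule H) : sarr LH :=
  @SArr B LH (lmodule_tens (G x) (G y)) (G (rmodule_tens x y)) (to_left_2 x y)
    (to_left_2_hom x y) (to_left_2_linear x y).

Lemma to_left_unit : G (rmodule_unit H) = lmodule_unit H.
Proof. by rewrite -(to_right_unit H) to_rightK. Qed.

Lemma to_left_2_iso x y : is_iso (to_left_2_arr x y : mor (lmod H)).
Proof.
have [g gP] : is_iso (to_left_2 x y).
  apply: is_iso_comp; last exact: br_arr_iso.
    by have [d _] := ch y x; rewrite d inv_br_cod.
  by exists (τ (rm_ob y) (rm_ob x)); apply: inverse_sym; exact: inv_br.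
apply: (@structured_iso B LH (to_left_2_arr x y) g gP).
exact: (lmod_inverse (x := lmodule_tens (G x) (G y)) (y := G (rmodule_tens x y))
  (to_left_2_hom x y) gP (to_left_2_linear x y)).
Qed.

Let tAl : forall a b d : lmodule H,
  lmodule_tens a (lmodule_tens b d) = lmodule_tens (lmodule_tens a b) d := stensA (s := LH).
Let t1l : forall a : lmodule H, lmodule_tens (lmodule_unit H) a = a := stens1x (s := LH).
Let tl1 : forall a : lmodule H, lmodule_tens a (lmodule_unit H) = a := stensx1 (s := LH).
Let tAr : forall a b d : rmodule H,
  rmodule_tens a (rmodule_tens b d) = rmodule_tens (rmodule_tens a b) d := stensA (s := RH).
Let t1r : forall a : rmodule H, rmodule_tens (rmodule_unit H) a = a := stens1x (s := RH).
Let tr1 : forall a : rmodule H, rmodule_tens a (rmodule_unit H) = a := stensx1 (s := RH).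

Lemma to_left_0_hom : (idm (tunit : ob (lmod H)) : mor (lmod H)) ∷ tunit ⇒ G (rmodule_unit H).
Proof. by rewrite to_left_unit. Qed.

Definition to_left_functor : strong_functor (rmod H) (lmod H).
Proof.
refine (@StrongFunctor (rmod H) (lmod H) (@to_left B H) to_left_arr _ _ _
  to_left_2_arr (idm (tunit : ob (lmod H))) _ to_left_0_hom to_left_2_iso (is_iso_id _) _ _ _ _).
- by [].
- by move=> x; apply: smor_eq.
- move=> g f gf.
  have gfL : dom (to_left_arr g : mor (lmod H)) = cod (to_left_arr f : mor (lmod H)) :=
    congr1 (@to_left B H) gf.
  apply: smor_eq.
  + by rewrite (dom_comp gfL); exact (congr1 (@to_left B H) (dom_comp gf)).
  + by rewrite (cod_comp gfL); exact (congr1 (@to_left B H) (cod_comp gf)).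
  + by rewrite (arr_comp gfL) /=; exact (arr_comp gf).
- by [].
- move=> f g; apply: smor_eq; rewrite ?dom_comp ?cod_comp ?arr_comp //=.
  have e := br_arr_nat c (sarr_hom (g : sarr RH)) (sarr_hom (f : sarr RH))
    (sarr_smor (g : sarr RH)) (sarr_smor (f : sarr RH)).
  have : arr (f : sarr RH) ∷ rm_ob (sdom (f : sarr RH)) ⇒ rm_ob (scod (f : sarr RH)) := sarr_hom _.
  have : arr (g : sarr RH) ∷ rm_ob (sdom (g : sarr RH)) ⇒ rm_ob (scod (g : sarr RH)) := sarr_hom _.
  move: e; rewrite /to_left_2.
  have := ch (sdom (g : sarr RH)) (sdom (f : sarr RH)).
  have := ch (scod (g : sarr RH)) (scod (f : sarr RH)).
  move: (arr (f : sarr RH)) (arr (g : sarr RH)) => f' g' ? ? e gh fh.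
  by diag2 (esym e) early.
- move=> x y z; apply: smor_eq; rewrite ?dom_comp ?cod_comp ?arr_comp //= ?tAl ?tAr //.
  rewrite /to_left_2 /=.
  have ? := ch y x; have ? := ch z y; have ? := ch z x.
  (* Naturality of [c] in its own component [c z y], that is, the Yang-Baxter equation, is what
     makes the monoidal structure associative. *)
  have := br_arr_nat c (x := rmodule_tens z y) (x' := rmodule_tens y z) (y := x) (y' := x)
    (ch z y) (sid_hom (S := RH) x) (br_arr_smor c z y) (smor_id (s := RH) x).
  rewrite !(br_arr_tensl c z y x) !(br_arr_tensl c y z x) (br_arr_tensr c z x y) /= => e.
  by diag2 (early) (e, early).
- move=> x; apply: smor_eq;
    rewrite ?dom_comp ?cod_comp ?arr_comp /= ?to_left_unit ?t1l ?t1r //.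
  by rewrite /to_left_2 (br_arr_x1 c x) /=; diag early.
- move=> x; apply: smor_eq;
    rewrite ?dom_comp ?cod_comp ?arr_comp /= ?to_left_unit ?tl1 ?tr1 //.
  by rewrite /to_left_2 (br_arr_1x c x) /=; diag early.
Defined.

Lemma to_left_braided : braided (C := BrCat c) (D := BrCat c') to_left_functor.
Proof.
move=> x y.
have e1 : dom (to_left_arr (c x y) : mor (structured_smcat LH)) =
  cod (to_left_2_arr x y : mor (structured_smcat LH)) := congr1 (@to_left B H) (br_sdom c x y).
have e2 : dom (to_left_2_arr y x : mor (structured_smcat LH)) =
  cod (c' (G x) (G y)) := esym (br_scod c' (G x) (G y)).
change ((to_left_arr (c x y) : mor (structured_smcat LH)) ∘ to_left_2_arr x y =
  (to_left_2_arr y x : mor (structured_smcat LH)) ∘ c' (G x) (G y)).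
apply: smor_eq; rewrite ?(dom_comp e1) ?(cod_comp e1) ?(dom_comp e2) ?(cod_comp e2)
  ?(arr_comp e1) ?(arr_comp e2).
- exact (esym (br_sdom c' (G x) (G y))).
- exact (congr1 (@to_left B H) (br_scod c x y)).
have ? := ch x y; have ? := ch y x.
rewrite c'E /= /to_left_2 /flip_braiding !to_leftK /=.
by diag2 tt (early).
Qed.

Lemma flip_isomorphic : braided_isomorphic (BrCat c) (BrCat c').
Proof.
exists to_left_functor; split; first exact: to_left_braided.
- by exists (@to_right B H); [exact (@to_leftK B H) | exact (@to_rightK B H)].
- apply: inj_surj_bijective.
  + move=> f g e; apply: sarr_eq.
    * exact (can_inj (@to_leftK B H) (congr1 (@sdom _ _) e)).
    * exact (can_inj (@to_leftK B H) (congr1 (@scod _ _) e)).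
    * exact (congr1 (@arr _ _) e).
  + case=> x y f; rewrite -(to_rightK x) -(to_rightK y) => fh fP.
    have fP' : smor (s := RH) (F x) (F y) f.
      by have /(to_right_linear (x := G (F x)) (x' := G (F y)) fh) := fP; rewrite !to_rightK.
    by exists (@SArr B RH (F x) (F y) f fh fP'); apply: sarr_eq.
Qed.

End Functor.

End FlippedBraiding.

(** * Flipping half braidings between right and left modules *)

Section FlipCenter.

Variables (B : brcat) (A : hopf B).
Local Notation RA := (rmod_structured A).
Local Notation LA := (lmod_structured A).
Local Notation F := (@to_right B A).
Local Notation G := (@to_left B A).
Local Notation hbarr s y := (arr (hb s y : sarr RA)).
Local Notation hb'arr s y := (arr (hb' s y : sarr LA)).

Section Flip.

Variable s : half_braided (structured_smcat RA).
Local Notation M := (hb_ob s : rmodule A).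
Local Notation N := (rm_ob M).

Let sh (y : lmodule A) : hbarr s (F y) ∷ N ⊗ lm_ob y ⇒ lm_ob y ⊗ N := hb_arr_hom s (F y).

Definition flip_sig (y : lmodule A) : mor B :=
  τ (lm_ob y) N ∘ hbarr s (F y) ∘ inv (τ N (lm_ob y)).

Lemma flip_sig_hom (y : lmodule A) : flip_sig y ∷ lm_ob y ⊗ N ⇒ N ⊗ lm_ob y.
Proof. by have ? := sh y; rewrite /flip_sig; dhom. Qed.

Lemma flip_sig_iso y : is_iso (flip_sig y).
Proof.
have [d c] := sh y; apply: is_iso_comp; last exact: br_iso.
  by rewrite br_dom cod_comp ?d ?inv_br_cod.
apply: is_iso_comp; first by rewrite d inv_br_cod.
  by exists (τ N (lm_ob y)); apply: inverse_sym; exact: inv_br.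
exact (arr_is_iso (hb_iso s (F y))).
Qed.

Lemma flip_sig_linear y :
  smor (s := LA) (lmodule_tens y (G M)) (lmodule_tens (G M) y) (flip_sig y).
Proof. by apply/(flip_linear (y := G M) (sh y)); rewrite to_leftK; exact: hb_arr_smor. Qed.

Lemma flip_sig_nat (y z : lmodule A) f : f ∷ lm_ob y ⇒ lm_ob z -> smor (s := LA) y z f ->
  (idm N ⊠ f) ∘ flip_sig y = flip_sig z ∘ (f ⊠ idm N).
Proof.
move=> fh /(to_right_linear fh) fP.
have e := hb_arr_nat s (y := F y) (z := F z) fh fP; rewrite /= in e.
have ? := sh y; have ? := sh z.
by rewrite /flip_sig; diag2 (early, e) early.
Qed.

Lemma flip_sig_tens (y z : lmodule A) : flip_sig (lmodule_tens y z) =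
  (flip_sig y ⊠ idm (lm_ob z)) ∘ (idm (lm_ob y) ⊠ flip_sig z).
Proof.
have e := hb_arr_nat s (y := rmodule_tens (F z) (F y)) (z := F (lmodule_tens y z))
  (flip_tau_hom y z) (flip_tau_linear y z).
rewrite (hb_arr_tens s (F z) (F y)) /= in e.
have /= ? := sh (lmodule_tens y z); have ? := sh y; have ? := sh z.
have e' : hbarr s (F (lmodule_tens y z)) = (τ (lm_ob z) (lm_ob y) ⊠ idm N)
    ∘ (idm (lm_ob z) ⊠ hbarr s (F y)) ∘ (hbarr s (F z) ⊠ idm (lm_ob y))
    ∘ (idm N ⊠ inv (τ (lm_ob z) (lm_ob y))).
  by apply/esym; diag (e, early).
by rewrite /flip_sig /=; diag2 (e', late) late.
Qed.

Lemma flip_sig_unit : flip_sig (lmodule_unit A) = idm N.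
Proof.
rewrite /flip_sig to_right_unit (hb_arr_unit s) /=.
by diag early.
Qed.

Definition flip_hb : half_braided' (structured_smcat LA) :=
  @structured_half_braided' B LA (@lmod_inverse B A) (G M) flip_sig flip_sig_hom flip_sig_iso
    flip_sig_linear flip_sig_nat flip_sig_tens flip_sig_unit.

End Flip.

Section Unflip.

Variable s : half_braided' (structured_smcat LA).
Local Notation M := (hb'_ob s : lmodule A).
Local Notation N := (lm_ob M).

Let sh (y : rmodule A) : hb'arr s (G y) ∷ rm_ob y ⊗ N ⇒ N ⊗ rm_ob y := hb'_arr_hom s (G y).

Definition unflip_sig (y : rmodule A) : mor B :=
  inv (τ (rm_ob y) N) ∘ hb'arr s (G y) ∘ τ N (rm_ob y).

Lemma unflip_sig_hom (y : rmodule A) : unflip_sig y ∷ N ⊗ rm_ob y ⇒ rm_ob y ⊗ N.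
Proof. by have ? := sh y; rewrite /unflip_sig; dhom. Qed.

Lemma unflip_sigK (y : rmodule A) :
  τ (rm_ob y) N ∘ unflip_sig y ∘ inv (τ N (rm_ob y)) = hb'arr s (G y).
Proof. by have ? := sh y; rewrite /unflip_sig; diag early. Qed.

Lemma unflip_sig_iso y : is_iso (unflip_sig y).
Proof.
have [d c] := sh y; apply: is_iso_comp.
- by rewrite inv_br_dom cod_comp ?c ?d ?br_cod.
- by apply: is_iso_comp; [rewrite d br_cod | exact: br_iso | exact (arr_is_iso (hb'_iso s (G y)))].
- by exists (τ (rm_ob y) N); apply: inverse_sym; exact: inv_br.
Qed.

Lemma unflip_sig_linear y :
  smor (s := RA) (rmodule_tens (F M) y) (rmodule_tens y (F M)) (unflip_sig y).
Proof.
have := flip_linear (x := G y) (y := M) (unflip_sig_hom y); rewrite to_leftK => <-.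
by rewrite unflip_sigK; exact: (hb'_arr_smor s (G y)).
Qed.

Lemma unflip_sig_nat (y z : rmodule A) f : f ∷ rm_ob y ⇒ rm_ob z -> smor (s := RA) y z f ->
  (f ⊠ idm N) ∘ unflip_sig y = unflip_sig z ∘ (idm N ⊠ f).
Proof.
move=> fh fP; have e := hb'_arr_nat s (y := G y) (z := G z) fh (to_left_linear fh fP).
rewrite /= in e; have ? := sh y; have ? := sh z.
by rewrite /unflip_sig; diag2 (early, e) early.
Qed.

Lemma to_left_tau_linear (y z : rmodule A) :
  smor (s := LA) (G (rmodule_tens y z)) (lmodule_tens (G z) (G y)) (τ (rm_ob y) (rm_ob z)).
Proof.
have := flip_tau_linear (G z) (G y); rewrite !to_leftK /= => e.
have th : τ (rm_ob y) (rm_ob z) ∷ rm_ob (rmodule_tens y z) ⇒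
    rm_ob (F (lmodule_tens (G z) (G y))) by exact: br_hom.
by have := to_left_linear th e; rewrite to_rightK.
Qed.

Lemma unflip_sig_tens (y z : rmodule A) : unflip_sig (rmodule_tens y z) =
  (idm (rm_ob y) ⊠ unflip_sig z) ∘ (unflip_sig y ⊠ idm (rm_ob z)).
Proof.
have th : τ (rm_ob y) (rm_ob z) ∷ lm_ob (G (rmodule_tens y z)) ⇒
    lm_ob (lmodule_tens (G z) (G y)) by exact: br_hom.
have e := hb'_arr_nat s (y := G (rmodule_tens y z)) (z := lmodule_tens (G z) (G y))
  th (to_left_tau_linear y z).
rewrite (hb'_arr_tens s (G z) (G y)) /= in e.
have /= ? := sh (rmodule_tens y z); have ? := sh y; have ? := sh z.
have e' : hb'arr s (G (rmodule_tens y z)) = (idm N ⊠ inv (τ (rm_ob y) (rm_ob z)))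
    ∘ (hb'arr s (G z) ⊠ idm (rm_ob y)) ∘ (idm (rm_ob z) ⊠ hb'arr s (G y))
    ∘ (τ (rm_ob y) (rm_ob z) ⊠ idm N).
  by apply/esym; diag (esym e, early).
by rewrite /unflip_sig /=; diag2 (e', late) late.
Qed.

Lemma unflip_sig_unit : unflip_sig (rmodule_unit A) = idm N.
Proof.
rewrite /unflip_sig to_left_unit (hb'_arr_unit s) /=.
by diag early.
Qed.

Definition unflip_hb : half_braided (structured_smcat RA) :=
  @structured_half_braided B RA (@rmod_inverse B A) (F M) unflip_sig unflip_sig_hom unflip_sig_iso
    unflip_sig_linear unflip_sig_nat unflip_sig_tens unflip_sig_unit.

End Unflip.

Lemma flip_hbK : cancel flip_hb unflip_hb.
Proof.
move=> s; apply: half_braided_arr_eq => [|y]; first exact: to_leftK.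
have := hb_arr_hom s y; rewrite /= /unflip_sig /= /flip_sig /= to_leftK => ?.
by diag early.
Qed.

Lemma unflip_hbK : cancel unflip_hb flip_hb.
Proof.
move=> s; apply: half_braided'_arr_eq => [|y]; first exact: to_rightK.
have := hb'_arr_hom s y; rewrite /= /flip_sig /= /unflip_sig /= to_rightK => ?.
by diag early.
Qed.

End FlipCenter.

(** * The primed center of the category of left modules *)

(** Both actions are the one of [x] transported along [f]. This yields equalities of modules without
    comparing long formulas for actions. *)
Lemma rmodule_transport (B : brcat) (H : bialgebra B) (x y y' : rmodule H) f :
  is_iso f -> f ∷ rm_ob x ⇒ rm_ob y -> rm_ob y = rm_ob y' ->
  smor (s := rmod_structured H) x y f -> smor (s := rmod_structured H) x y' f -> y = y'.
Proof.
move=> /invP[dg cg gf fg] fh ey /= e e'; apply: rmodule_eq => //.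
have [df cf] := fh; rewrite cf in fg.
have gh : inv f ∷ rm_ob y ⇒ rm_ob x by split; rewrite ?dg ?cg ?df ?cf.
have h' := ract_hom y'; rewrite -ey in h'.
transitivity (f ∘ ract x ∘ (inv f ⊠ idm H)).
  by move: (inv f) gh fg => g gh fg; apply/esym; diag (e, fg).
by move: (inv f) (ract y') h' e' gh fg => g r' h' e' gh fg; diag (e', fg).
Qed.

Section LeftCenter.

Variables (B : brcat) (A Z D : hopf B) (delta : ob B -> mor B) (Om : mor B).
Hypothesis P : double_data A Z D delta Om.
Let zbP := dd_centralizer P.
Local Notation LA := (lmod_structured A).
Local Notation RD := (rmod_structured D).
Local Notation LD := (lmod_structured D).
Local Notation ZL := (center'_structured (lmod A)).
Local Notation resA := (restrict_A P).
Local Notation resZ := (@restrict_Z B A Z D).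
Local Notation sigma y w := (half_braid Z delta (resA y) (resZ y) w).
Local Notation F := to_right.
Local Notation G := to_left.
Let zh y : resZ y ∷ rm_ob y ⊗ Z ⇒ rm_ob y := za_hom (restrict_zaction P y).
Let sh y w : sigma y w ∷ rm_ob y ⊗ rm_ob w ⇒ rm_ob w ⊗ rm_ob y := sigma_hom P y w.

(** [F] and [flip_hb] each reverse tensor products up to τ; in the composite these crossings cancel,
    so it is strict although neither step is. *)
Definition left_center (x : lmodule D) : half_braided' (lmod A) :=
  flip_hb (dmod_center P (F x)).

Lemma left_center_bij : bijective left_center.
Proof.
have bF : bijective (@to_right B D).
  by exists (@to_left B D); [exact (@to_rightK B D) | exact (@to_leftK B D)].
have bc := inj_surj_bijective (@dmod_center_inj _ _ _ _ _ _ P) (@dmod_center_surj _ _ _ _ _ _ P).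
have bf : bijective (@flip_hb B A).
  by exists (@unflip_hb B A); [exact (@flip_hbK B A) | exact (@unflip_hbK B A)].
exact (bij_comp bf (bij_comp bc bF)).
Qed.

Lemma sigma_nat y z w f : f ∷ rm_ob y ⇒ rm_ob z -> smor (s := RD) y z f ->
  (idm (rm_ob w) ⊠ f) ∘ sigma y w = sigma z w ∘ (f ⊠ idm (rm_ob w)).
Proof.
move=> fh fP; have [_ e] := proj1 (restrict_linear P fh) fP.
exact (half_braid_morph zbP (x := resA y) (y := resA z) w (zh y) (zh z) fh e).
Qed.

Lemma left_restrict_tens (x y : lmodule D) : resA (F (lmodule_tens x y)) =
  F (lmodule_tens (G (resA (F x))) (G (resA (F y)))).
Proof.
apply: (@rmodule_transport _ _ (rmodule_tens (resA (F y)) (resA (F x))) _ _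
  (τ (lm_ob y) (lm_ob x))).
- exact: br_iso.
- exact: br_hom.
- by [].
- rewrite -restrict_A_tens.
  exact (proj1 (proj1 (restrict_linear P (y := rmodule_tens (F y) (F x)) (flip_tau_hom x y))
    (flip_tau_linear x y))).
- by have := flip_tau_linear (G (resA (F x))) (G (resA (F y))); rewrite !to_leftK.
Qed.

Lemma left_center_tens x y :
  left_center (lmodule_tens x y) = half_braided'_tens (left_center x) (left_center y).
Proof.
apply: half_braided'_arr_eq => [|w].
  by rewrite /= left_restrict_tens to_rightK.
rewrite hb'_tens_arr /= /flip_sig /=.
have := sigma_nat (F w) (flip_tau_hom x y) (flip_tau_linear x y).
rewrite restrict_A_tens (restrict_Z_tens P).
rewrite (half_braid_tensl zbP (x := resA (F y)) (y := resA (F x)) (F w) (zh (F y)) (zh (F x))) /=.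
have /= := sh (F (lmodule_tens x y)) (F w); have /= := sh (F y) (F w); have /= := sh (F x) (F w).
move: (sigma (F x) (F w)) (sigma (F y) (F w)) (sigma (F (lmodule_tens x y)) (F w)).
move=> s1 s2 s3 h1 h2 h3 e.
have e' : s3 = (idm (lm_ob w) ⊠ τ (lm_ob y) (lm_ob x)) ∘ (s2 ⊠ idm (lm_ob x))
    ∘ (idm (lm_ob y) ⊠ s1) ∘ (inv (τ (lm_ob y) (lm_ob x)) ⊠ idm (lm_ob w)).
  by apply/esym; diag (e, early).
by diag2 (e', late) late.
Qed.

Lemma left_center_unit : left_center (lmodule_unit D) = half_braided'_unit (lmod A).
Proof.
rewrite /left_center to_right_unit dmod_center_unit.
apply: half_braided'_arr_eq => [|w]; first exact: to_left_unit.
by rewrite /= /flip_sig /=; diag early.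
Qed.

Lemma left_arr_smor (f : sarr LD) :
  smor (s := LA) (G (resA (F (sdom f)))) (G (resA (F (scod f)))) f.
Proof.
apply: to_left_linear; first exact: sarr_hom f.
have fP := proj1 (to_right_linear (sarr_hom f)) (sarr_smor f).
exact (proj1 (proj1 (restrict_linear P (y := F (sdom f)) (z := F (scod f)) (sarr_hom f)) fP)).
Qed.

Definition left_arr (f : sarr LD) : sarr LA :=
  @SArr B LA (G (resA (F (sdom f)))) (G (resA (F (scod f)))) f (sarr_hom f) (left_arr_smor f).

Lemma left_center_smor (x y : lmodule D) f : f ∷ lm_ob x ⇒ lm_ob y ->
  (forall w : rmodule A,
    (idm (rm_ob w) ⊠ f) ∘ sigma (F x) w = sigma (F y) w ∘ (f ⊠ idm (rm_ob w))) <->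
  (forall w : lmodule A,
    (f ⊠ idm (lm_ob w)) ∘ arr (hb' (left_center x) w : sarr LA) =
    arr (hb' (left_center y) w : sarr LA) ∘ (idm (lm_ob w) ⊠ f)).
Proof.
move=> fh; split=> e w.
- rewrite /= /flip_sig /=; have /= := e (F w).
  have /= := sh (F x) (F w); have /= := sh (F y) (F w).
  move: (sigma (F x) (F w)) (sigma (F y) (F w)) => s1 s2 h1 h2 {}e.
  by diag2 (early, e) early.
- have := e (G w); rewrite /= /flip_sig /= !to_leftK.
  have /= := sh (F x) w; have /= := sh (F y) w.
  move: (sigma (F x) w) (sigma (F y) w) => s1 s2 h1 h2 {}e.
  transitivity (inv (τ (rm_ob w) (lm_ob y)) ∘ (f ⊠ idm (rm_ob w)) ∘ τ (rm_ob w) (lm_ob x) ∘ s1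
     ∘ inv (τ (lm_ob x) (rm_ob w)) ∘ τ (lm_ob x) (rm_ob w)).
    by diag2 early early.
  by diag2 (e, early) early.
Qed.

Lemma left_center_arr_smor (f : sarr LD) :
  smor (s := ZL) (left_center (sdom f)) (left_center (scod f)) (left_arr f).
Proof.
move=> w; apply: smor_eq; rewrite ?dom_comp ?cod_comp ?arr_comp //=.
move: w; apply/(left_center_smor (sarr_hom f)) => w.
exact (sigma_nat (y := F (sdom f)) (z := F (scod f)) w (sarr_hom f)
  (proj1 (to_right_linear (sarr_hom f)) (sarr_smor f))).
Qed.

Lemma left_center_arr_hom (f : sarr LD) : (left_arr f : mor (lmod A)) ∷
  under (s := ZL) (left_center (sdom f)) ⇒ under (s := ZL) (left_center (scod f)).
Proof. by []. Qed.

Definition left_center_arr (f : sarr LD) : sarr ZL :=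
  SArr (left_center_arr_hom f) (left_center_arr_smor f).

Lemma left_center_arr_bij : bijective left_center_arr.
Proof.
have [K LK KL] := left_center_bij.
apply: inj_surj_bijective => [f g e|].
  apply: sarr_eq.
  - exact (can_inj LK (congr1 (@sdom _ _) e)).
  - exact (can_inj LK (congr1 (@scod _ _) e)).
  - exact (congr1 (fun h : sarr ZL => arr (arr h : sarr LA)) e).
case=> x x' g; rewrite -(KL x) -(KL x'); move: (K x) (K x') => {}x {}x' gh gs.
have [/= ed ec] := gh.
have fh : arr (g : sarr LA) ∷ lm_ob x ⇒ lm_ob x'.
  by have := sarr_hom (g : sarr LA); rewrite [sdom _]ed [scod _]ec.
have fP : smor (s := LD) x x' (arr (g : sarr LA)).
  apply/(to_right_linear fh)/(restrict_linear P (y := F x) (z := F x') fh); split.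
    have := sarr_smor (g : sarr LA); rewrite [sdom _]ed [scod _]ec.
    move/(to_right_linear (x := G (resA (F x))) (x' := G (resA (F x'))) fh).
    by rewrite !to_leftK.
  apply: (sigma_inj (P := P) (y := F x) (y' := F x') fh); apply/(left_center_smor fh) => w.
  have := congr1 (@arr _ _) (gs w).
  by rewrite !arr_comp //= ?[sdom _]ed ?[scod _]ec.
exists (@SArr B LD x x' (arr (g : sarr LA)) fh fP).
by apply: sarr_eq => //=; apply: sarr_eq.
Qed.

Section LeftBraiding.

Variables (c : braiding (structured_smcat RD)) (c' : braiding (structured_smcat LD)).
Hypothesis cE : forall x y : rmodule D, arr (c x y : sarr RD) = sigma x (resA y).
Hypothesis c'E : forall x y, arr (c' x y : sarr LD) = flip_braiding c x y.

Lemma left_center_strict_iso :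
  @strict_iso (BrCat c') (center' (lmod A)) left_center left_center_arr.
Proof.
split.
- by [].
- by [].
- move=> y; apply: sarr_eq => //=; exact: sarr_eq.
- move=> g f gf.
  have ed : sdom (g ∘ f : sarr LD) = sdom (f : sarr LD) := dom_comp gf.
  have ec : scod (g ∘ f : sarr LD) = scod (g : sarr LD) := cod_comp gf.
  have gfA : dom (left_arr g : mor (lmod A)) = cod (left_arr f : mor (lmod A)) :=
    congr1 (fun x => G (resA (F x))) gf.
  have gfZ : dom (left_center_arr g : mor (center' (lmod A))) =
    cod (left_center_arr f : mor (center' (lmod A))) := congr1 left_center gf.
  apply: smor_eq; first by rewrite (dom_comp gfZ) /= ed.
    by rewrite (cod_comp gfZ) /= ec.
  rewrite (arr_comp gfZ) /=; apply: smor_eq.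
  + by rewrite (dom_comp gfA) /= ed.
  + by rewrite (cod_comp gfA) /= ec.
  + by rewrite (arr_comp gfA) /= (arr_comp gf).
- exact: left_center_tens.
- exact: left_center_unit.
- move=> f g; apply: sarr_eq; rewrite /= ?left_center_tens //.
  by apply: sarr_eq; rewrite /= ?left_restrict_tens ?to_rightK.
- move=> x y; have ed := br_sdom c' x y; have ec := br_scod c' x y.
  apply: sarr_eq; rewrite /= ?[sdom _]ed ?[scod _]ec ?left_center_tens //.
  apply: sarr_eq; rewrite /= ?[sdom _]ed ?[scod _]ec ?left_restrict_tens ?to_rightK //.
  by rewrite c'E /flip_braiding cE /flip_sig /= to_leftK.
- exact: left_center_bij.
- exact: left_center_arr_bij.
Qed.

End LeftBraiding.

End LeftCenter.

(** * The mirror of the center *)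

Section Inverses.

Variable C : smcat.
Implicit Types (f g : mor C) (X Y : ob C).

Lemma is_iso_inv f : is_iso f -> is_iso (inv f).
Proof. by move=> /invP fP; exists f; exact: inverse_sym. Qed.

Lemma invK f : is_iso f -> inv (inv f) = f.
Proof. by move=> /invP fP; apply: inv_eq; exact: inverse_sym. Qed.

Lemma inv_hom f X Y : is_iso f -> f ∷ X ⇒ Y -> inv f ∷ Y ⇒ X.
Proof. by move=> /invP[d c _ _] [<- <-]. Qed.

Lemma inv_idm X : inv (idm X) = idm X.
Proof. exact (inv_eq (inverse_id X)). Qed.

Lemma inv_comp f g : dom g = cod f -> is_iso f -> is_iso g -> inv (g ∘ f) = inv f ∘ inv g.
Proof. by move=> gf /invP fP /invP gP; apply: inv_eq; exact: inverse_comp. Qed.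

Lemma inv_tens f g : is_iso f -> is_iso g -> inv (f ⊠ g) = inv f ⊠ inv g.
Proof. by move=> /invP fP /invP gP; apply: inv_eq; exact: inverse_tens. Qed.

Lemma inv_square f g s t : is_iso s -> is_iso t -> dom g = cod s -> dom t = cod f ->
  dom f = dom s -> cod t = cod g -> g ∘ s = t ∘ f -> f ∘ inv s = inv t ∘ g.
Proof.
move=> /invP[sd sc s1 s2] /invP[td tc t1 t2] gs tf fs tg e.
rewrite -[RHS](@comp_idr _ _ (cod s)); last by rewrite dom_comp // td.
rewrite -s2 -compA ?td //; last by rewrite cod_comp.
rewrite [g ∘ _]compA // e -compA ?dom_comp ?sc //.
rewrite [inv t ∘ _]compA ?cod_comp ?td // ?sc // t1 comp_idl // cod_comp ?sc //.
Qed.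

End Inverses.

Lemma arr_inv (C : smcat) (S : structured C) (f : mor (structured_smcat S)) : is_iso f ->
  arr (inv f : sarr S) = inv (arr (f : sarr S)).
Proof.
move=> /invP[dg cg gf fg]; apply/esym/inv_eq; split; rewrite ?sdom_arr ?scod_arr.
- exact: congr1 dg.
- exact: congr1 cg.
- by have := congr1 (@arr _ _) gf; rewrite arr_comp.
- by have := congr1 (@arr _ _) fg; rewrite arr_comp.
Qed.

Section MirrorCenter.

Variable C : smcat.

Definition unprime (x : half_braided' C) : half_braided C.
Proof.
refine (@HalfBraided C (hb'_ob x) (fun Y => inv (hb' x Y)) _ _ _ _ _).
- by move=> Y; exact: inv_hom (hb'_iso x Y) (hb'_hom x Y).
- by move=> Y; exact: is_iso_inv (hb'_iso x Y).
- move=> f; apply: inv_square (hb'_iso x _) (hb'_iso x _) _ _ _ _ _; try typ; exact: hb'_nat.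
- move=> Y Z; rewrite hb'_tens inv_comp; try typ.
  + by rewrite !inv_tens ?inv_idm //; (exact: is_iso_id || exact: hb'_iso).
  + by apply: is_iso_tens; (exact: is_iso_id || exact: hb'_iso).
  + by apply: is_iso_tens; (exact: is_iso_id || exact: hb'_iso).
- by rewrite hb'_unit inv_idm.
Defined.

Definition prime (x : half_braided C) : half_braided' C.
Proof.
refine (@HalfBraided' C (hb_ob x) (fun Y => inv (hb x Y)) _ _ _ _ _).
- by move=> Y; exact: inv_hom (hb_iso x Y) (hb_hom x Y).
- by move=> Y; exact: is_iso_inv (hb_iso x Y).
- move=> f; apply: inv_square (hb_iso x _) (hb_iso x _) _ _ _ _ _; try typ; exact: hb_nat.
- move=> Y Z; rewrite hb_tens inv_comp; try typ.
  + by rewrite !inv_tens ?inv_idm //; (exact: is_iso_id || exact: hb_iso).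
  + by apply: is_iso_tens; (exact: is_iso_id || exact: hb_iso).
  + by apply: is_iso_tens; (exact: is_iso_id || exact: hb_iso).
- by rewrite hb_unit inv_idm.
Defined.

Lemma unprimeK : cancel unprime prime.
Proof. by move=> x; apply: half_braided'_eq => //= Y; rewrite invK //; exact: hb'_iso. Qed.

Lemma primeK : cancel prime unprime.
Proof. by move=> x; apply: half_braided_eq => //= Y; rewrite invK //; exact: hb_iso. Qed.

Lemma unprime_tens x y :
  unprime (half_braided'_tens x y) = half_braided_tens (unprime x) (unprime y).
Proof.
apply: half_braided_eq => //= Y; rewrite inv_comp; try typ.
- by rewrite !inv_tens ?inv_idm //; (exact: is_iso_id || exact: hb'_iso).
- by apply: is_iso_tens; [exact: hb'_iso | exact: is_iso_id].
- by apply: is_iso_tens; [exact: is_iso_id | exact: hb'_iso].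
Qed.

Lemma unprime_unit : unprime (half_braided'_unit C) = half_braided_unit C.
Proof. by apply: half_braided_eq => //= Y; rewrite inv_idm. Qed.

Local Notation S := (center_structured C).
Local Notation S' := (center'_structured C).

Lemma unprime_smor (x y : half_braided' C) f : f ∷ hb'_ob x ⇒ hb'_ob y ->
  smor (s := S') x y f <-> smor (s := S) (unprime x) (unprime y) f.
Proof.
move=> [df cf]; split=> /= fP Y.
- by apply: inv_square; first [exact: hb'_iso | exact: fP | typ].
- have := fP Y => e; apply/esym.
  rewrite -{1}(invK (hb'_iso x Y)) -{1}(invK (hb'_iso y Y)).
  have [dx cx] := inv_hom (hb'_iso x Y) (hb'_hom x Y).
  have [dy cy] := inv_hom (hb'_iso y Y) (hb'_hom y Y).
  apply/esym; apply: inv_square; rewrite ?dx ?dy ?cx ?cy; try typ.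
  + exact: is_iso_inv (hb'_iso x Y).
  + exact: is_iso_inv (hb'_iso y Y).
Qed.

Lemma unprime_arr_hom (f : sarr S') :
  f ∷ hb_ob (unprime (sdom f)) ⇒ hb_ob (unprime (scod f)).
Proof. exact: sarr_hom f. Qed.

Definition unprime_arr (f : sarr S') : sarr S :=
  @SArr C S (unprime (sdom f)) (unprime (scod f)) f (unprime_arr_hom f)
    (proj1 (unprime_smor (sarr_hom f)) (sarr_smor f)).

Lemma mirror_strict_iso : @strict_iso (center' C) (mirror (center C)) unprime unprime_arr.
Proof.
split.
- by [].
- by [].
- by move=> x; apply: sarr_eq.
- move=> g f gf.
  have gf' : dom (unprime_arr g : mor (center C)) = cod (unprime_arr f : mor (center C)) :=
    congr1 unprime gf.
  apply: smor_eq.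
  + by rewrite (dom_comp gf'); exact (congr1 unprime (dom_comp gf)).
  + by rewrite (cod_comp gf'); exact (congr1 unprime (cod_comp gf)).
  + by rewrite (arr_comp gf') /=; exact (arr_comp gf).
- exact: unprime_tens.
- exact: unprime_unit.
- by move=> f g; apply: sarr_eq; rewrite /= ?unprime_tens.
- move=> x y.
  (* The mirror braiding inverts the inverse of [hb' y], and so is [hb' y] again. *)
  have ci := br_iso (center_braiding C) (unprime y) (unprime x).
  have [d c _ _] := invP ci.
  apply: smor_eq.
  + by rewrite [RHS]d (proj2 (br_hom _ _ _)); exact: unprime_tens.
  + by rewrite [RHS]c (proj1 (br_hom _ _ _)); exact: unprime_tens.
  + by rewrite [RHS](arr_inv ci) /= invK //; exact: hb'_iso.
- by exists prime; [exact: unprimeK | exact: primeK].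
- apply: inj_surj_bijective.
  + move=> f g e; apply: sarr_eq.
    * exact (can_inj unprimeK (congr1 (@sdom _ _) e)).
    * exact (can_inj unprimeK (congr1 (@scod _ _) e)).
    * exact (congr1 (@arr _ _) e).
  + case=> x y f; rewrite -(primeK x) -(primeK y) => fh fP.
    have fP' : smor (s := S') (prime x) (prime y) f.
      exact (proj2 (unprime_smor (x := prime x) (y := prime y) fh) fP).
    by exists (@SArr C S' (prime x) (prime y) f fh fP'); apply: sarr_eq.
Qed.

End MirrorCenter.

(** * The four isomorphisms *)

Section TheDouble.

Variables (B : brcat) (d : autonomous B) (C : coend d) (A : hopf B).
Local Notation delta := (delta C A).

(** The carrier of [Z] is only propositionally equal to [ZA C A], so the theory is developed over an
    arbitrary carrier and linked to the definitions here. *)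
Lemma centralizer_structureE (Z : hopf B) : centralizer_structure C A Z <->
  carrier Z = ZA C A /\ centralizer_bialgebra A Z delta.
Proof.
split.
- case=> eZ; rewrite /T -!eZ => hm h1 hD he; split=> //; split=> //.
  by rewrite eZ; exact: centralizer_delta.
- by case=> eZ [_ hm h1 hD he]; split; rewrite /T -?eZ.
Qed.

Lemma double_dataE (Z D : hopf B) (Om : mor B) : carrier Z = ZA C A ->
  double_data A Z D delta Om <->
  [/\ centralizer_structure C A Z, distributive_law C A Om & double_structure C A Z Om D].
Proof.
move=> eZ; split.
- case=> zbP Oh OE Dob Dm D1 DD De; split.
  + exact/centralizer_structureE.
  + by apply/distributive_lawE; rewrite -eZ.
  + by split; rewrite -?eZ.
- case=> /centralizer_structureE[_ zbP] /distributive_lawE.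
  by rewrite -eZ => -[Oh OE] []; rewrite -eZ.
Qed.

Lemma R_braidE (Z D : hopf B) (Om : mor B) (P : double_data A Z D delta Om) (x y : rmodule D) :
  carrier Z = ZA C A ->
  R_braid C A Z (rm_ob x) (ract x) (rm_ob y) (ract y) =
  half_braid Z delta (restrict_A P x) (restrict_Z A Z x) (restrict_A P y).
Proof.
move=> eZ; rewrite /R_braid /Rmx /partial /half_braid /= /restrict_Z /dmod_Z -eZ.
have hx := ract_hom x; have hy := ract_hom y; rewrite (dd_ob P) in hx hy.
have dh := cz_hom (czb_centralizer (dd_centralizer P)) (rm_ob y).
move: (ract x) (ract y) (delta _) hx hy dh => r s dl hx hy dh.
by diag tt.
Qed.

Lemma double_exists : inhabited (double C A).
Proof.
have [Z0 eZ zbP0] := centralizer_bialgebra_exists (centralizer_delta C A).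
have [Z eZ0] := centralizer_hopf d zbP0.
have zbP : centralizer_bialgebra A Z delta by rewrite eZ0.
have {}eZ : carrier Z = ZA C A by rewrite eZ0.
have [Om Oh OE] := exchange_law_exists (czb_centralizer zbP).
have O1r := distr_one zbP Oh OE; have O1l := distr_one_l zbP Oh OE.
have [D eD] := twisted_hopf Oh O1r O1l (distr_counit zbP Oh OE) (distr_comul zbP Oh OE)
  (distr_mul zbP Oh OE) (distr_mul_l zbP Oh OE).
have P : double_data A Z D delta Om by split; rewrite ?eD.
have [zP OP DP] := proj1 (double_dataE D Om eZ) P.
have [c cE] := rbraiding_exists P; have [c' c'E] := lbraiding_exists c.
unshelve refine (inhabits (@Double B d C A Z zP Om OP D DP c _ c' _)).
- by move=> x y; rewrite (R_braidE P) // cE.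
- move=> x y; rewrite c'E /flip_braiding cE.
  by rewrite -(R_braidE P).
Qed.

End TheDouble.

Theorem theorem8p13 (B : brcat) (d : autonomous B) (C : coend d) (A : hopf B) :
  inhabited (double C A) /\
  forall D : double C A,
    braided_isomorphic (center (rmod A)) (double_rmod D) /\
    braided_isomorphic (double_rmod D) (double_lmod D) /\
    braided_isomorphic (double_lmod D) (center' (lmod A)) /\
    braided_isomorphic (center' (lmod A)) (mirror (center (lmod A))).
Proof.
split; first exact: double_exists.
move=> D; have eZ := cz_ob (dbl_Z_structure D).
have P := proj2 (double_dataE (dbl_hopf D) (dbl_Omega D) eZ)
  (And3 (dbl_Z_structure D) (dbl_Omega_law D) (dbl_structure D)).
have cE (x y : rmodule D) : arr (dbl_rbraiding D x y : sarr (rmod_structured D)) =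
    half_braid (dbl_Z D) (delta C A) (restrict_A P x) (restrict_Z A (dbl_Z D) x)
      (restrict_A P y).
  by rewrite dbl_rbraidingE (R_braidE P).
have c'E (x y : lmodule D) : arr (dbl_lbraiding D x y : sarr (lmod_structured D)) =
    flip_braiding (dbl_rbraiding D) x y.
  by rewrite dbl_lbraidingE /flip_braiding dbl_rbraidingE.
split; last split; last split.
(* The functor was built from modules to half braidings; the statement asks for the opposite
   direction. *)
- have [F [G FG]] := strict_iso_sym (center_strict_iso cE).
  exact (strict_iso_braided FG).
- exact (flip_isomorphic c'E).
- exact (strict_iso_braided (left_center_strict_iso cE c'E)).
- exact (strict_iso_braided (mirror_strict_iso (lmod A))).
Qed.
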